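(* Let $\Omega\subset\mathbb{C}^d$ be a bounded convex domain with $C^{1,\alpha}$ boundary (for some $\alpha\in(0,1]$). If $f:\Omega\to\Omega$ is 1-Lipschitz with respect to the Kobayashi distance $K_\Omega$, then either $f$ has a fixed point in $\Omega$, or there exists $x\in\partial\Omega$ such that $$\lim_{k\to\infty} d_{\mathrm{Euc}}\big(f^k(p), T_x^{\mathbb{C}}\partial\Omega\big)=0$$ for all $p\in\Omega$.
   Context: $f^k$ is the $k$-fold iterate of $f$. $d_{\mathrm{Euc}}$ is Euclidean distance on $\mathbb{C}^d$. $K_\Omega$ is the Kobayashi distance. $f$ is 1-Lipschitz means $K_\Omega(f(p),f(q))\le K_\Omega(p,q)$ for all $p,q\in\Omega$ ($f$ is not assumed holomorphic). $T_x^{\mathbb{C}}\partial\Omega$ is the complex affine hyperplane through $x$ tangent to $\partial\Omega$ at $x$. *)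

(* Defs.v *)
From HB Require Import structures.
From mathcomp Require Import all_boot all_order all_algebra.
From mathcomp Require Import complex.
From mathcomp Require Import all_classical all_reals all_analysis.

Set Implicit Arguments.
Unset Strict Implicit.
Unset Printing Implicit Defensive.

Import Order.TTheory GRing.Theory Num.Theory.
Import numFieldNormedType.Exports.

Local Open Scope classical_set_scope.
Local Open Scope ring_scope.

(* [R[i]] carries no canonical topology of its own; naming it as a
   numFieldType gives access to the norm topology, and makes ['rV[Cx R]_d]
   a normed module over it.  The norm of the latter is the sup norm, so the
   Euclidean norm is defined separately below. *)
Definition Cx (R : realType) : numFieldType := (R[i])%C.

Section EuclideanSpace.
Variables (R : realType) (d : nat).
Implicit Types (v w z : 'rV[Cx R]_d) (A : set 'rV[Cx R]_d).

(* Inner product of C^d = R^(2d), i.e. the real part of the hermitian one. *)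
Definition rdot v w : R :=
  \sum_(j < d) (complex.Re (v 0 j) * complex.Re (w 0 j)
                + complex.Im (v 0 j) * complex.Im (w 0 j)).

Definition enorm v : R := Num.sqrt (rdot v v).

Definition dEuc z A : R := inf [set enorm (z - y) | y in A].

Definition rscale (t : R) v : 'rV[Cx R]_d := (Complex t 0 : Cx R) *: v.

Definition iscale v : 'rV[Cx R]_d := (Complex 0 1 : Cx R) *: v.

Definition boundary A : set 'rV[Cx R]_d := closure A `\` interior A.

Definition is_domain A : Prop := [/\ A !=set0, open A & connected A].

End EuclideanSpace.

Section Kobayashi.
Variables (R : realType) (d : nat).

Definition unit_disc : set (Cx R) := [set z | `|z| < 1].

(* artanh |(a - b) / (1 - b^* a)| *)
Definition poincare (a b : Cx R) : R :=
  let t : R := ComplexField.Normc.normc ((a - b) / (1 - conjc b * a)) in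
  2^-1 * ln ((1 + t) / (1 - t)).

Definition analytic_disc (Omega : set 'rV[Cx R]_d)
    (phi : Cx R -> 'rV[Cx R]_d) : Prop :=
  (forall z, unit_disc z -> derivable phi z 1) /\
  (forall z, unit_disc z -> Omega (phi z)).

(* [disc_chain Omega p q l]: p and q are joined by a nonempty finite chain of
   analytic discs in Omega of total Poincare length l. *)
Inductive disc_chain (Omega : set 'rV[Cx R]_d) :
    'rV[Cx R]_d -> 'rV[Cx R]_d -> R -> Prop :=
| chain_one phi a b :
    analytic_disc Omega phi -> unit_disc a -> unit_disc b ->
    disc_chain Omega (phi a) (phi b) (poincare a b)
| chain_cons phi a b q l :
    analytic_disc Omega phi -> unit_disc a -> unit_disc b ->
    disc_chain Omega (phi b) q l ->
    disc_chain Omega (phi a) q (poincare a b + l).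

Definition kobayashi (Omega : set 'rV[Cx R]_d) (p q : 'rV[Cx R]_d) : \bar R :=
  ereal_inf [set l%:E | l in disc_chain Omega p q].

End Kobayashi.

Section SmoothBoundary.
Variables (R : realType) (d : nat).
Implicit Types (Omega U : set 'rV[Cx R]_d) (x z : 'rV[Cx R]_d)
  (rho : 'rV[Cx R]_d -> R) (g : 'rV[Cx R]_d -> 'rV[Cx R]_d).

(* Every real directional derivative of rho at z is given by pairing with w;
   together with continuity of the gradient this says that rho is C^1 in the
   real sense. *)
Definition has_gradient rho z (w : 'rV[Cx R]_d) : Prop :=
  forall v, is_derive (0 : R) (1 : R) (fun t : R => rho (z + rscale t v))
              (rdot v w).

Definition C1_defining Omega x U rho g : Prop :=
  [/\ open U, U x, Omega `&` U = [set z | rho z < 0] `&` U,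
      (forall z, U z -> has_gradient rho z (g z)) &
      (forall z, U z -> g z != 0 /\ {for z, continuous g})].

Definition hoelder_on (alpha : R) U g : Prop :=
  exists M : R, forall z w, U z -> U w ->
    enorm (g z - g w) <= M * enorm (z - w) `^ alpha.

Definition C1alpha_boundary (alpha : R) Omega : Prop :=
  forall x, boundary Omega x ->
    exists U rho g, C1_defining Omega x U rho g /\ hoelder_on alpha U g.

(* x + (T /\ i T), where T = {v | d rho_x (v) = 0} is the real tangent space
   of the boundary at x.  At a boundary point any two local defining functions
   have proportional differentials, so the choice of rho is immaterial. *)
Definition complex_tangent Omega x : set 'rV[Cx R]_d :=
  [set y | exists U rho g, [/\ C1_defining Omega x U rho g,
     rdot (y - x) (g x) = 0 & rdot (iscale (y - x)) (g x) = 0]].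

End SmoothBoundary.

(* Main.v *)
(** If some orbit of f returns infinitely often to a bounded set for the Kobayashi distance K,
    a recurrent point has bounded orbit (Calka); K-balls being convex, the asymptotic centre of
    that orbit is a compact convex f-invariant set, and f composed with the homotheties shrinking
    it is strictly contracting there, which gives a fixed point of f.  Otherwise every orbit leaves
    every compact set.  Let x be a limit of the iterates of o at record times of K(o, f^n o)
    (Karlsson): their Gromov product with f^k o is at least K(o, f^k o) / 2, up to a constant
    independent of k.  But the Gromov product stays bounded near a pair x, y of boundary points
    with y outside the complex tangent hyperplane of x, so all orbits accumulate on that hyperplane.

    This last fact combines K(p, o) <= log(1 / dist(p, bd)) / 2 + C, which follows from a dyadic
    chain of discs along the normal (this uses C^{1,alpha}), with the lower bound
    K(p, z) >= log(|l z| / |l p|) / 2 for affine l with Re l > 0 on the domain, applied on both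
    sides of a point z of the chain at which the two tangent functionals are bounded away from 0.
    The lower bound is the Schwarz lemma, proved from Goursat's theorem. *)
Require Import Defs.
From HB Require Import structures.
From mathcomp Require Import all_boot all_order all_algebra.
From mathcomp Require Import complex.
From mathcomp Require Import all_classical all_reals all_analysis.
From mathcomp Require Import ring lra.

Import Order.TTheory GRing.Theory Num.Theory.
Import numFieldNormedType.Exports.

Local Open Scope classical_set_scope.
Local Open Scope ring_scope.

Set Implicit Arguments.
Unset Strict Implicit.
Unset Printing Implicit Defensive.

Local Notation normc := ComplexField.Normc.normc.
Local Notation Re := complex.Re.
Local Notation Im := complex.Im.

(** * Complex numbers and vectors *)

Section ComplexNumbers.
Variable R : realType.
Implicit Types (z w : Cx R) (t : R).

(** Estimates are proved for finite chains of discs and then passed to the infimum, so neither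
    geodesics nor extremal discs are needed: [ch_conv] aligns two chains to get convexity of balls,
    and [ch_cut] supplies what a point on a geodesic would give. As [f] is not holomorphic, no
    normal families are available, and the arguments about [f] use the metric only. The main
    obstacle is the coefficient 1/2 of the logarithm in the upper bound for K(p, o). It has to agree
    exactly with that of the lower bound: the two are compared on the same vanishing distance to the
    boundary, and only a bounded error may remain. A ball of fixed radius touching the boundary need
    not fit inside a C^{1,alpha} domain. Hence each halving of the depth b uses its own disc, of
    radius r large compared with b but shrinking with it, kept off the boundary by a margin s of
    order r^(1+alpha). A halving costs (ln 2)/2 plus errors of order s/b and b/r, and both must be
    summable over the dyadic scales; alpha > 0 leaves room for such an r. Moreover the foot point of
    p on the boundary varies with p, so all constants must be uniform near x. *)

Definition cr t : Cx R := Complex t 0.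

Lemma normrE z : `|z| = cr (normc z).
Proof. by []. Qed.

Lemma normc_ge0 z : 0 <= normc z :> R.
Proof. by case: z => a b; rewrite /= sqrtr_ge0. Qed.

Lemma normc_sqr z : normc z ^+ 2 = Re z ^+ 2 + Im z ^+ 2.
Proof. by case: z => a b; rewrite /= sqr_sqrtr // addr_ge0 // sqr_ge0. Qed.

Lemma normcN z : normc (- z) = normc z.
Proof. by case: z => a b; rewrite /= !sqrrN. Qed.

Lemma normcD z w : normc (z + w) <= normc z + normc w.
Proof. exact: (@le_normcD R z w). Qed.

Lemma normcBC z w : normc (z - w) = normc (w - z).
Proof. by rewrite -normcN opprB. Qed.

Lemma normcB z w : normc z - normc w <= normc (z - w).
Proof. by have := normcD (z - w) w; rewrite subrK; lra. Qed.

Lemma normcB_abs z w : `|normc z - normc w| <= normc (z - w).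
Proof.
by rewrite ler_norml; have := normcB z w; have := normcB w z; rewrite (normcBC w); lra.
Qed.

Lemma normcM z w : normc (z * w) = normc z * normc w.
Proof. exact: (ComplexField.Normc.normcM z w). Qed.

Lemma normcV z : normc z^-1 = (normc z)^-1.
Proof. exact: (ComplexField.Normc.normcV z). Qed.

Lemma normc0 : normc (0 : Cx R) = 0.
Proof. exact: ComplexField.Normc.normc0. Qed.

Lemma normc1 : normc (1 : Cx R) = 1.
Proof. exact: ComplexField.Normc.normc1. Qed.

Lemma normc_eq0 z : (normc z == 0) = (z == 0).
Proof.
apply/eqP/eqP => [|->]; last exact: normc0.
exact: ComplexField.Normc.eq0_normc.
Qed.

Lemma normc_gt0 z : (0 < normc z) = (z != 0).
Proof. by rewrite lt_neqAle normc_ge0 andbT eq_sym normc_eq0. Qed.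

Lemma normc_cr t : normc (cr t) = `|t|.
Proof. by rewrite /= expr0n /= addr0 sqrtr_sqr. Qed.

Lemma normc_conj z : normc (conjc z) = normc z.
Proof. by case: z => a b; rewrite /= sqrrN. Qed.

Lemma Re_le_normc z : `|Re z| <= normc z.
Proof.
rewrite -(@ler_pXn2r _ 2) ?nnegrE ?normc_ge0 // normc_sqr -normrX ger0_norm ?sqr_ge0 //.
by rewrite lerDl sqr_ge0.
Qed.

Lemma Im_le_normc z : `|Im z| <= normc z.
Proof.
rewrite -(@ler_pXn2r _ 2) ?nnegrE ?normc_ge0 // normc_sqr -normrX ger0_norm ?sqr_ge0 //.
by rewrite lerDr sqr_ge0.
Qed.

Lemma normc_le_ReIm z : normc z <= `|Re z| + `|Im z|.
Proof.
rewrite -(@ler_pXn2r _ 2) ?nnegrE ?normc_ge0 ?addr_ge0 // normc_sqr sqrrD.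
rewrite -!normrX !(ger0_norm (sqr_ge0 _)).
by have : 0 <= `|Re z| * `|Im z|; [rewrite mulr_ge0 | lra].
Qed.

Lemma ReD z w : Re (z + w) = Re z + Re w.
Proof. by case: z; case: w. Qed.
Lemma ImD z w : Im (z + w) = Im z + Im w.
Proof. by case: z; case: w. Qed.
Lemma ReN z : Re (- z) = - Re z.
Proof. by case: z. Qed.
Lemma ImN z : Im (- z) = - Im z.
Proof. by case: z. Qed.
Lemma ReM z w : Re (z * w) = Re z * Re w - Im z * Im w.
Proof. by case: z; case: w. Qed.
Lemma ImM z w : Im (z * w) = Re z * Im w + Im z * Re w.
Proof. by case: z; case: w. Qed.
Lemma Re_conj z : Re (conjc z) = Re z.
Proof. by case: z. Qed.
Lemma Im_conj z : Im (conjc z) = - Im z.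
Proof. by case: z. Qed.

Definition ReImE := (ReD, ImD, ReN, ImN, ReM, ImM, Re_conj, Im_conj).

Lemma Cx_eqP z w : Re z = Re w -> Im z = Im w -> z = w.
Proof. by case: z w => a b [c d] /= -> ->. Qed.

Lemma crD t u : cr (t + u) = cr t + cr u.
Proof. by apply: Cx_eqP; rewrite ?ReImE /= ?addr0. Qed.
Lemma crN t : cr (- t) = - cr t.
Proof. by apply: Cx_eqP; rewrite ?ReImE /= ?oppr0. Qed.
Lemma crM t u : cr (t * u) = cr t * cr u.
Proof. by apply: Cx_eqP; rewrite ?ReImE /=; ring. Qed.
Lemma conj_cr t : conjc (cr t) = cr t.
Proof. by apply: Cx_eqP; rewrite ?ReImE /= ?oppr0. Qed.
Lemma cr0 : cr 0 = 0. Proof. by []. Qed.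
Lemma cr1 : cr 1 = 1. Proof. by []. Qed.
Lemma crV t : cr t^-1 = (cr t)^-1.
Proof.
have [->|t0] := eqVneq t 0; first by rewrite invr0 cr0 invr0.
have ct0 : cr t != 0 by rewrite -normc_gt0 normc_cr normr_gt0.
by apply: (mulfI ct0); rewrite -crM divff // divff.
Qed.

Lemma cr_eq0 t : (cr t == 0) = (t == 0).
Proof. by rewrite -normc_eq0 normc_cr normr_eq0. Qed.

Lemma ltcr t u : (cr t < cr u) = (t < u).
Proof. exact: ltcR. Qed.
Lemma lecr t u : (cr t <= cr u) = (t <= u).
Proof. exact: lecR. Qed.

Lemma Cx_gt0 z : 0 < z -> exists2 t, 0 < t & z = cr t.
Proof.
case: z => a b; rewrite ltcE /= => /andP[/eqP b0 a0]; exists a => //.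
by apply: Cx_eqP.
Qed.

(** Balls of a [numFieldType] have radii in the field itself. A positive element of [Cx R] is real,
    so the topology can be tested with real radii. *)
Lemma nbhs_CxP z (P : set (Cx R)) :
  nbhs z P <-> exists2 e : R, 0 < e & forall w, normc (w - z) < e -> P w.
Proof.
split=> [/nbhs_ballP[e /= /Cx_gt0[t t0 ->] sP]|[e e0 sP]].
  exists t => // w wt; apply: sP; rewrite -ball_normE /ball_ /=.
  by rewrite normrE ltcr normcBC.
apply/nbhs_ballP; exists (cr e) => /=; first by rewrite -[0]cr0 ltcr.
move=> w; rewrite -ball_normE /ball_ /= normrE ltcr normcBC; exact: sP.
Qed.

Lemma cvg_CxP (T : Type) (F : set_system T) (FF : Filter F) (f : T -> Cx R) z :
  f @ F --> z <-> forall e : R, 0 < e -> \forall x \near F, normc (f x - z) < e.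
Proof.
split=> [cf e e0|cf P /nbhs_CxP[e e0 sP]].
  by apply: (cf [set w | normc (w - z) < e]); apply/nbhs_CxP; exists e.
rewrite /nbhs /=; apply: filterS (cf _ e0) => x; exact: sP.
Qed.

Lemma unit_discP z : unit_disc z <-> normc z < 1.
Proof. by rewrite /unit_disc /= normrE -cr1 ltcr. Qed.

Lemma ReIm_cvg (a b : R) :
  (fun p : R * R => Complex p.1 p.2 : Cx R) @ (a, b) --> (Complex a b : Cx R).
Proof.
apply/cvg_CxP => e e0; near=> p.
apply: le_lt_trans (normc_le_ReIm _) _; rewrite !ReImE /=.
rewrite [e](splitr e); apply: ltrD; rewrite distrC; near: p.
  exact: (@cvgr_dist_lt _ _ _ _ _ (@fst R R) a (@cvg_fst _ _ _ _ _) (e / 2) (divr_gt0 e0 (ltr0n _ 2))).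
exact: (@cvgr_dist_lt _ _ _ _ _ (@snd R R) b (@cvg_snd _ _ _ _ _) (e / 2) (divr_gt0 e0 (ltr0n _ 2))).
Unshelve. all: by end_near. Qed.

Lemma square_compact (M : R) :
  compact [set z : Cx R | `|Re z| <= M /\ `|Im z| <= M].
Proof.
have -> : [set z : Cx R | `|Re z| <= M /\ `|Im z| <= M] =
    (fun p : R * R => Complex p.1 p.2 : Cx R) @` (`[- M, M] `*` `[- M, M]).
  apply/seteqP; split=> [[a b] /= [aM bM]|_ [[a b] /= [aM bM] <-] /=].
    by exists (a, b) => //; split; rewrite /= in_itv /= -ler_norml.
  by move: aM bM; rewrite !in_itv /= !ler_norml.
apply: continuous_compact; last by apply: compact_setX; exact: segment_compact.
apply: continuous_subspaceT => -[a b]; exact: ReIm_cvg.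
Qed.

End ComplexNumbers.

(** * Euclidean and hermitian structure of C^d *)

Section Vectors.
Variables (R : realType) (d : nat).
Local Notation V := 'rV[Cx R]_d.
Implicit Types (u v w x y z : V) (c : Cx R) (t : R).

Lemma rscaleE t v : rscale t v = cr t *: v. Proof. by []. Qed.

Lemma rdotC v w : rdot v w = rdot w v.
Proof. by apply: eq_bigr => j _; rewrite mulrC [X in _ + X]mulrC. Qed.

Lemma rdotDl u v w : rdot (u + v) w = rdot u w + rdot v w.
Proof.
rewrite -big_split /=; apply: eq_bigr => j _.
by rewrite mxE !ReImE; ring.
Qed.

Lemma rdotZl t v w : rdot (cr t *: v) w = t * rdot v w.
Proof.
by rewrite mulr_sumr; apply: eq_bigr => j _; rewrite mxE !ReImE /=; ring.
Qed.

Lemma rdotNl v w : rdot (- v) w = - rdot v w.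
Proof. by rewrite -scaleN1r -cr1 -crN rdotZl mulN1r. Qed.

Lemma rdotBl u v w : rdot (u - v) w = rdot u w - rdot v w.
Proof. by rewrite rdotDl rdotNl. Qed.

Lemma rdotDr u v w : rdot w (u + v) = rdot w u + rdot w v.
Proof. by rewrite rdotC rdotDl !(rdotC w). Qed.
Lemma rdotZr t v w : rdot v (cr t *: w) = t * rdot v w.
Proof. by rewrite rdotC rdotZl rdotC. Qed.
Lemma rdotNr v w : rdot v (- w) = - rdot v w.
Proof. by rewrite rdotC rdotNl rdotC. Qed.
Lemma rdotBr u v w : rdot w (u - v) = rdot w u - rdot w v.
Proof. by rewrite rdotDr rdotNr. Qed.

Definition rdotE := (rdotDl, rdotBl, rdotNl, rdotZl, rdotDr, rdotBr, rdotNr, rdotZr).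

Lemma rdot0l v : rdot 0 v = 0.
Proof. by rewrite -(scale0r (0 : V)) -cr0 rdotZl mul0r. Qed.

Lemma rdot_normc v : rdot v v = \sum_(j < d) normc (v 0 j) ^+ 2.
Proof. by apply: eq_bigr => j _; rewrite normc_sqr !expr2. Qed.

Lemma rdot_ge0 v : 0 <= rdot v v.
Proof. by rewrite rdot_normc sumr_ge0 // => j _; rewrite sqr_ge0. Qed.

Lemma enorm_sqr v : enorm v ^+ 2 = rdot v v.
Proof. by rewrite sqr_sqrtr // rdot_ge0. Qed.

Lemma enorm_ge0 v : 0 <= enorm v.
Proof. exact: sqrtr_ge0. Qed.

Lemma normc_le_enorm v j : normc (v 0 j) <= enorm v.
Proof.
rewrite -(@ler_pXn2r _ 2) ?nnegrE ?normc_ge0 ?enorm_ge0 // enorm_sqr rdot_normc.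
by rewrite (bigD1 j) //= lerDl sumr_ge0 // => i _; rewrite sqr_ge0.
Qed.

Lemma enorm_eq0 v : (enorm v == 0) = (v == 0).
Proof.
apply/eqP/eqP => [v0|->]; last by rewrite /enorm rdot0l sqrtr0.
apply/rowP => j; rewrite mxE; apply/eqP; rewrite -normc_eq0.
by rewrite eq_le normc_ge0 andbT -v0 normc_le_enorm.
Qed.

Lemma enorm0 : enorm (0 : V) = 0.
Proof. by apply/eqP; rewrite enorm_eq0. Qed.

Lemma enorm_gt0 v : (0 < enorm v) = (v != 0).
Proof. by rewrite lt_neqAle enorm_ge0 andbT eq_sym enorm_eq0. Qed.

Lemma enormZ c v : enorm (c *: v) = normc c * enorm v.
Proof.
rewrite -[RHS]ger0_norm ?mulr_ge0 ?normc_ge0 ?enorm_ge0 //.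
rewrite -sqrtr_sqr exprMn enorm_sqr !rdot_normc mulr_sumr; congr Num.sqrt.
by rewrite rdot_normc; apply: eq_bigr => j _; rewrite mxE normcM exprMn.
Qed.

Lemma enormN v : enorm (- v) = enorm v.
Proof. by rewrite -scaleN1r enormZ normcN normc1 mul1r. Qed.

Lemma enormBC v w : enorm (v - w) = enorm (w - v).
Proof. by rewrite -enormN opprB. Qed.

Lemma rdot_le v w : `|rdot v w| <= enorm v * enorm w.
Proof.
have [->|w0] := eqVneq w 0; first by rewrite rdotC rdot0l enorm0 mulr0 normr0.
have ww : 0 < rdot w w by rewrite -enorm_sqr exprn_gt0 // enorm_gt0.
rewrite -(@ler_pXn2r _ 2) ?nnegrE ?mulr_ge0 ?enorm_ge0 //.
rewrite exprMn !enorm_sqr -normrX ger0_norm ?sqr_ge0 //.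
have := rdot_ge0 (cr (rdot w w) *: v - cr (rdot v w) *: w).
rewrite !rdotE (rdotC w v) => h.
have : 0 <= rdot w w * (rdot v v * rdot w w - rdot v w ^+ 2) by move: h; congr (_ <= _); ring.
by rewrite pmulr_rge0 // subr_ge0.
Qed.

Lemma enormD v w : enorm (v + w) <= enorm v + enorm w.
Proof.
rewrite -(@ler_pXn2r _ 2) ?nnegrE ?addr_ge0 ?enorm_ge0 //.
rewrite sqrrD !enorm_sqr !rdotE (rdotC w v).
have := le_trans (ler_norm _) (rdot_le v w); lra.
Qed.

Lemma enormB v w : enorm v - enorm w <= enorm (v - w).
Proof. by have := enormD (v - w) w; rewrite subrK; lra. Qed.

Lemma enorm_tri u v w : enorm (u - w) <= enorm (u - v) + enorm (v - w).
Proof. by have := enormD (u - v) (v - w); rewrite addrA subrK. Qed.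

Lemma enorm_sum_le v : enorm v <= \sum_(j < d) normc (v 0 j).
Proof.
have s0 : 0 <= \sum_(j < d) normc (v 0 j) :> R.
  by rewrite sumr_ge0 // => j _; rewrite normc_ge0.
rewrite -(@ler_pXn2r _ 2) ?nnegrE ?enorm_ge0 // enorm_sqr rdot_normc.
suff : \sum_(j < d) normc (v 0 j) ^+ 2 <= (\sum_(j < d) normc (v 0 j)) ^+ 2 :> R /\
    0 <= \sum_(j < d) normc (v 0 j) :> R by case.
elim/big_ind2 : _ => [|a1 a2 b1 b2 [h1 p1] [h2 p2]|j _].
- by rewrite expr0n.
- have := mulr_ge0 p1 p2; split; last exact: addr_ge0.
  by rewrite sqrrD; lra.
- by rewrite normc_ge0.
Qed.

(** The hermitian product, linear in [v]. In this form its vanishing is literally the pair of real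
    equations that defines [complex_tangent]. *)
Definition hdot v w : Cx R := Complex (rdot v w) (- rdot (iscale v) w).

Lemma hdot_sum v w : hdot v w = \sum_(j < d) v 0 j * conjc (w 0 j).
Proof.
have -> : \sum_(j < d) v 0 j * conjc (w 0 j) =
   Complex (\sum_(j < d) Re (v 0 j * conjc (w 0 j))) (\sum_(j < d) Im (v 0 j * conjc (w 0 j))) :> Cx R.
  elim/big_rec3 : _ => // j a b c _ ->; apply: Cx_eqP; by rewrite ?ReImE.
apply: Cx_eqP => /=.
  by apply: eq_bigr => j _; rewrite !ReImE; ring.
by rewrite -sumrN; apply: eq_bigr => j _; rewrite !mxE !ReImE /=; ring.
Qed.

Lemma hdotDl u v w : hdot (u + v) w = hdot u w + hdot v w.
Proof.
by rewrite !hdot_sum -big_split; apply: eq_bigr => j _; rewrite mxE mulrDl.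
Qed.

Lemma hdotZl c v w : hdot (c *: v) w = c * hdot v w.
Proof. by rewrite !hdot_sum mulr_sumr; apply: eq_bigr => j _; rewrite mxE mulrA. Qed.

Lemma hdotNl v w : hdot (- v) w = - hdot v w.
Proof. by rewrite -scaleN1r hdotZl mulN1r. Qed.

Lemma hdotBl u v w : hdot (u - v) w = hdot u w - hdot v w.
Proof. by rewrite hdotDl hdotNl. Qed.

Lemma hdotDr u v w : hdot w (u + v) = hdot w u + hdot w v.
Proof.
rewrite !hdot_sum -big_split; apply: eq_bigr => j _; rewrite mxE -[RHS]mulrDr; congr (_ * _).
by apply: Cx_eqP; rewrite !ReImE // opprD.
Qed.

Lemma hdotNr v w : hdot v (- w) = - hdot v w.
Proof.
rewrite !hdot_sum -sumrN; apply: eq_bigr => j _; rewrite mxE -mulrN; congr (_ * _).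
by apply: Cx_eqP; rewrite !ReImE // opprD.
Qed.

Lemma hdotBr u v w : hdot w (u - v) = hdot w u - hdot w v.
Proof. by rewrite hdotDr hdotNr. Qed.

Lemma hdotZr t v w : hdot v (cr t *: w) = cr t * hdot v w.
Proof.
rewrite !hdot_sum mulr_sumr; apply: eq_bigr => j _; rewrite mxE mulrCA; congr (_ * _).
by apply: Cx_eqP; rewrite !ReImE /=; ring.
Qed.

Lemma Re_hdot v w : Re (hdot v w) = rdot v w.
Proof. by []. Qed.

Lemma hdotvv v : hdot v v = cr (enorm v ^+ 2).
Proof.
rewrite hdot_sum enorm_sqr; apply: Cx_eqP.
  by rewrite -hdot_sum.
rewrite -hdot_sum /= -[RHS]oppr0; congr (- _).
by rewrite /rdot big1 // => j _; rewrite !mxE !ReImE /=; ring.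
Qed.

(** The real and imaginary parts are bounded separately; the resulting factor 2 is not sharp but
    only affects constants. *)
Lemma normc_hdot v w : normc (hdot v w) <= 2 * (enorm v * enorm w).
Proof.
apply: le_trans (normc_le_ReIm _) _ => /=; rewrite normrN mulr2n mulrDl !mul1r.
apply: lerD; first exact: rdot_le.
apply: le_trans (rdot_le _ _) _; rewrite /iscale enormZ.
by rewrite /= expr0n /= add0r expr1n sqrtr1 mul1r.
Qed.

Lemma nbhs_enormP x (P : set V) :
  nbhs x P <-> exists2 e : R, 0 < e & forall y, enorm (y - x) < e -> P y.
Proof.
split=> [/nbhs_ballP[e /= /Cx_gt0[t t0 ->] sP]|[e e0 sP]].
  exists t => // y yt; apply: sP; split; first by rewrite -[0]cr0 ltcr.
  move=> i j; rewrite -ball_normE /ball_ /= normrE ltcr normcBC (ord1 i).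
  by apply: le_lt_trans yt; have := normc_le_enorm (y - x) j; rewrite !mxE.
apply/nbhs_ballP; exists (cr (e / d.+1%:R)) => /=.
  by rewrite -[0]cr0 ltcr divr_gt0 // ltr0n.
move=> y [_ xy]; apply: sP; apply: le_lt_trans (enorm_sum_le _) _.
apply: (@le_lt_trans _ _ (\sum_(j < d) (e / d.+1%:R))).
  apply: ler_sum => j _; have := xy 0 j.
  by rewrite -ball_normE /ball_ /= normrE ltcr !mxE normcBC => /ltW.
rewrite sumr_const card_ord -[X in X < _]mulr_natr -mulrA gtr_pMr // mulrC.
by rewrite ltr_pdivrMr ?ltr0n // mul1r ltr_nat.
Qed.

Lemma open_enormP (A : set V) :
  open A <-> forall x, A x -> exists2 e : R, 0 < e & forall y, enorm (y - x) < e -> A y.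
Proof.
by rewrite openE; split=> [oA x /oA /nbhs_enormP|oA x /oA xA]; last exact/nbhs_enormP.
Qed.

Lemma closure_enormP (A : set V) x :
  closure A x <-> forall e : R, 0 < e -> exists2 y, A y & enorm (y - x) < e.
Proof.
split=> [cA e e0|cA P /nbhs_enormP[e e0 sP]].
  have /cA[y [Ay xy]] : nbhs x [set y | enorm (y - x) < e] by apply/nbhs_enormP; exists e.
  by exists y.
by have [y Ay xy] := cA e e0; exists y; split => //; apply: sP.
Qed.

Lemma continuous_enormP (W : V -> V) x :
  {for x, continuous W} <-> forall e : R, 0 < e ->
    exists2 r : R, 0 < r & forall y, enorm (y - x) < r -> enorm (W y - W x) < e.
Proof.
split=> [cW e e0|cW P /nbhs_enormP[e e0 sP]].
  have : nbhs (W x) [set y | enorm (y - W x) < e] by apply/nbhs_enormP; exists e.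
  by move=> /cW /nbhs_enormP.
have [r r0 rW] := cW e e0; apply/nbhs_enormP; exists r => // y /rW; exact: sP.
Qed.

Lemma bounded_enormP (A : set V) :
  bounded_set A -> exists2 M : R, 0 < M & forall x, A x -> enorm x <= M.
Proof.
move=> [[a b] [Mr AM]].
have /complex_realP[k ek] := Mr; move: AM; rewrite ek -/(cr k) => AM.
exists (d%:R * (`|k| + 1) + 1).
  by rewrite ltr_wpDl // mulr_ge0 // addr_ge0.
move=> x Ax; have := AM (cr (`|k| + 1)); rewrite ltcr => /(_ _ x Ax) h.
have {}h : `|x| <= cr (`|k| + 1) by apply: h; have := ler_norm k; lra.
apply: le_trans (enorm_sum_le _) _.
apply: (@le_trans _ _ (\sum_(j < d) (`|k| + 1))); last first.
  by rewrite sumr_const card_ord -[X in X <= _]mulr_natl lerDl.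
apply: ler_sum => j _; rewrite -lecr -normrE; apply: le_trans h.
change (`|x 0 j| <= mx_norm x); rewrite mx_normE -[leLHS]nngE num_le.
exact: (@le_bigmax _ _ _ _ (fun p : 'I_1 * 'I_d => `|x p.1 p.2|%:nng) (0, j)).
Qed.

End Vectors.

(** * Cluster points of bounded sequences and existence of minima *)

Section Compactness.
Variables (R : realType) (d : nat).
Local Notation V := 'rV[Cx R]_d.

(** This form of sequential compactness is used throughout instead of extracting subsequences. *)
Lemma bounded_seq_cluster (u : nat -> V) (M : R) : (forall n, enorm (u n) <= M) ->
  exists x, forall (e : R) (N : nat), 0 < e -> exists2 n, (N <= n)%N & enorm (u n - x) < e.
Proof.
move=> uM.
have cB : compact [set v : V | forall i, `|Re (v 0 i)| <= M /\ `|Im (v 0 i)| <= M].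
  by apply: (@rV_compact (Cx R) d (fun=> [set z | `|Re z| <= M /\ `|Im z| <= M])) => _; exact: square_compact.
have [|x [_ clx]] := cB (u @ \oo) _.
  exists 0 => // n _ i; split; apply: le_trans (uM n); apply: le_trans (normc_le_enorm _ i).
    exact: Re_le_normc.
  exact: Im_le_normc.
exists x => e N e0.
have [||y [[n /= Nn <-] h]] := clx (u @` [set n | (N <= n)%N]) [set y | enorm (y - x) < e].
- by exists N => // n Nn; exists n.
- by apply/nbhs_enormP; exists e.
by exists n.
Qed.

(** A cluster point of a minimizing sequence is a minimizer; for this, lower semicontinuity along
    [A] is enough. *)
Lemma min_attained (A : set V) (M : R) (f : V -> R) :
  A !=set0 -> (forall x, A x -> enorm x <= M) -> closed A ->
  (forall x, A x -> 0 <= f x) ->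
  (forall x, A x -> forall e : R, 0 < e -> exists2 r : R, 0 < r &
    forall y, A y -> enorm (y - x) < r -> f x - e <= f y) ->
  exists2 x, A x & forall y, A y -> f x <= f y.
Proof.
move=> [a Aa] AM clA f0 fc.
have hinf : has_inf (f @` A).
  by split; [exists (f a), a | exists 0 => _ [x Ax <-]; exact: f0].
have /choice[u hu] (n : nat) : exists x, A x /\ f x < inf (f @` A) + n.+1%:R^-1.
  have [|_ [x Ax <-] h] := @inf_adherent _ (f @` A) (n.+1%:R^-1) _ hinf.
    by rewrite invr_gt0 ltr0n.
  by exists x.
have [x clx] := bounded_seq_cluster (fun n => AM _ (proj1 (hu n))).
have Ax : A x.
  rewrite (closure_id A).1 //; apply/closure_enormP => e e0.
  by have [n _ h] := clx e 0%N e0; exists (u n) => //; have [] := hu n.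
exists x => // y Ay; apply: (@le_trans _ _ (inf (f @` A))); last first.
  by apply: ge_inf; [case: hinf | exists y].
apply/ler_addgt0Pr => e e0.
have [r r0 h] := fc _ Ax _ (divr_gt0 e0 (ltr0n _ 2)).
have [N hN] : exists N : nat, N.+1%:R^-1 < e / 2.
  exists (Num.bound (e / 2)^-1); rewrite invf_plt ?posrE ?divr_gt0 // ?ltr0n //.
  apply: lt_trans (archi_boundP _) _; first by rewrite invr_ge0 ltW // divr_gt0.
  by rewrite ltr_nat.
have [n Nn nx] := clx r N r0.
have [Aun hun] := hu n.
have hx := h _ Aun nx.
have : n.+1%:R^-1 <= N.+1%:R^-1 :> R by rewrite lef_pV2 ?posrE ?ltr0n // ler_nat ltnS.
move: hN hun hx; move: (n.+1%:R^-1) (N.+1%:R^-1) (inf _) => p q s; lra.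
Qed.

End Compactness.

(** * Goursat's theorem and the Schwarz lemma *)

Section Goursat.
Variable R : realType.

Lemma mvt_is_derive (f df : R -> R) (a b : R) : a < b ->
  (forall x, a <= x <= b -> is_derive x 1 f (df x)) ->
  exists2 c, a < c < b & f b - f a = df c * (b - a).
Proof.
move=> ab fd.
have [x xab|x xab|c cab ->] := @MVT R f df a b ab.
- by apply: fd; move: xab; rewrite in_itv /= => /andP[/ltW -> /ltW ->].
- apply: continuous_in_subspaceT x xab => y; rewrite inE /= in_itv /= => yab.
  by have h := fd y yab; apply: differentiable_continuous; apply/derivable1_diffP.
by exists c => //; move: cab; rewrite in_itv.
Qed.

Lemma nested_intervals (a q : nat -> R) : (forall n, 0 <= q n) ->
  (forall n, a n <= a n.+1) -> (forall n, a n.+1 + q n.+1 <= a n + q n) ->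
  exists x, forall n, a n <= x <= a n + q n.
Proof.
move=> q0 amono bmono.
have am n k : a n <= a (n + k)%N.
  by elim: k => [|k IH]; rewrite ?addn0 // addnS; apply: le_trans IH _.
have bm n k : a (n + k)%N + q (n + k)%N <= a n + q n.
  by elim: k => [|k IH]; rewrite ?addn0 // addnS; apply: le_trans IH.
have ab n m : a n <= a m + q m.
  apply: le_trans (am n m) _; rewrite addnC; apply: le_trans (bm m n).
  by rewrite lerDl.
have hs : has_sup (range a).
  by split; [exists (a 0%N), 0%N | exists (a 0%N + q 0%N) => _ [n _ <-]].
exists (sup (range a)) => n; apply/andP; split.
  by apply: ub_le_sup; [case: hs | exists n].
by apply: ge_sup; [case: hs | move=> _ [m _ <-]].
Qed.

(* The integral of U dt + V ds along the boundary of the rectangle, for primitives PU s of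
   U s and PV t of (fun s => V s t): additivity in the rectangle is then an identity. *)
Definition rect_sum (PU PV : R -> R -> R) (s t w h : R) : R :=
  (PU (s + w) (t + h) - PU (s + w) t - (PU s (t + h) - PU s t)) -
  (PV (t + h) (s + w) - PV (t + h) s - (PV t (s + w) - PV t s)).

(** Real differentiability of U + iV at one point with the complex-linear differential a + ib.
    Nothing is asked about continuity of the derivative, hence the need for Goursat. *)
Definition cauchy_riemann_at (P : R -> R -> Prop) (U V : R -> R -> R) (s t : R) :=
  exists a b : R, forall e : R, 0 < e -> exists2 r : R, 0 < r &
    forall s' t', P s' t' -> `|s' - s| < r -> `|t' - t| < r ->
    `|U s' t' - U s t - (a * (s' - s) - b * (t' - t))| <= e * (`|s' - s| + `|t' - t|) /\
    `|V s' t' - V s t - (b * (s' - s) + a * (t' - t))| <= e * (`|s' - s| + `|t' - t|).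

(** The linear part contributes a w h to each of the two brackets of [rect_sum], and these cancel.
    After subtracting it, the mean value theorem turns each bracket into a side length times a
    difference of remainders. *)
Lemma rect_sum_local (P : R -> R -> Prop) (U V PU PV : R -> R -> R) (s0 t0 e : R) :
  (forall s t, P s t -> is_derive t (1 : R) (PU s) (U s t)) ->
  (forall s t, P s t -> is_derive s (1 : R) (PV t) (V s t)) ->
  cauchy_riemann_at P U V s0 t0 -> 0 < e ->
  exists2 r : R, 0 < r & forall s t w h, 0 < w -> 0 < h -> w < r -> h < r ->
    s <= s0 <= s + w -> t <= t0 <= t + h ->
    (forall s' t', s <= s' <= s + w -> t <= t' <= t + h -> P s' t') ->
    `|rect_sum PU PV s t w h| <= 2 * e * (w + h) ^+ 2.
Proof.
move=> HU HV [a [b ab]] e0; have [r r0 {}ab] := ab e e0; exists r => //.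
move=> s t w h w0 h0 wr hr s0s t0t HP.
have dist s' t' : s <= s' <= s + w -> t <= t' <= t + h ->
    [/\ `|s' - s0| <= w, `|t' - t0| <= h, `|s' - s0| < r & `|t' - t0| < r].
  move=> hs ht; have [h1 h2] : `|s' - s0| <= w /\ `|t' - t0| <= h.
    by rewrite !ler_norml; lra.
  by split => //; lra.
have est s' t' : s <= s' <= s + w -> t <= t' <= t + h ->
    `|U s' t' - U s0 t0 - (a * (s' - s0) - b * (t' - t0))| <= e * (w + h) /\
    `|V s' t' - V s0 t0 - (b * (s' - s0) + a * (t' - t0))| <= e * (w + h).
  move=> hs ht; have [d1 d2 d3 d4] := dist _ _ hs ht.
  have [e1 e2] := ab _ _ (HP _ _ hs ht) d3 d4.
  by split; [apply: le_trans e1 _ | apply: le_trans e2 _];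
    rewrite ler_pM2l // lerD.
have hE : rect_sum PU PV s t w h =
  ((PU (s + w) (t + h) - PU s (t + h) - a * w * (t + h)) - (PU (s + w) t - PU s t - a * w * t)) -
  ((PV (t + h) (s + w) - PV t (s + w) - a * h * (s + w)) - (PV (t + h) s - PV t s - a * h * s)).
  by rewrite /rect_sum; ring.
have ss : s <= s <= s + w by lra.
have sw : s <= s + w <= s + w by lra.
have tt : t <= t <= t + h by lra.
have th : t <= t + h <= t + h by lra.
have [x|c cth c1] := @mvt_is_derive (fun x => PU (s + w) x - PU s x - a * w * x)
   (fun x => U (s + w) x - U s x - a * w) t (t + h) (ltac:(lra)).
  move=> xt; have i1 := HU _ _ (HP _ _ sw xt); have i2 := HU _ _ (HP _ _ ss xt).
  apply: is_derive_eq; rewrite /GRing.scale /=; ring.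
have [x|g cg g1] := @mvt_is_derive (fun x => PV (t + h) x - PV t x - a * h * x)
   (fun x => V x (t + h) - V x t - a * h) s (s + w) (ltac:(lra)).
  move=> xt; have i1 := HV _ _ (HP _ _ xt th); have i2 := HV _ _ (HP _ _ xt tt).
  apply: is_derive_eq; rewrite /GRing.scale /=; ring.
rewrite hE c1 g1.
have cth' : t <= c <= t + h by lra.
have cg' : s <= g <= s + w by lra.
have [u1 _] := est _ _ sw cth'; have [u2 _] := est _ _ ss cth'.
have [_ v1] := est _ _ cg' th; have [_ v2] := est _ _ cg' tt.
have k1 : `|U (s + w) c - U s c - a * w| <= 2 * (e * (w + h)).
  by move: u1 u2; rewrite !ler_norml; lra.
have k2 : `|V g (t + h) - V g t - a * h| <= 2 * (e * (w + h)).
  by move: v1 v2; rewrite !ler_norml; lra.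
have -> : t + h - t = h by ring.
have -> : s + w - s = w by ring.
apply: le_trans (ler_normB _ _) _; rewrite !normrM (gtr0_norm w0) (gtr0_norm h0).
have := ler_wpM2r (ltW h0) k1; have := ler_wpM2r (ltW w0) k2.
rewrite expr2; lra.
Qed.

(** Quadrisection: [rect_sum] of a rectangle is the sum over its four quarters, so some quarter
    keeps at least a fourth of the modulus. The nested quarters shrink to a point, where
    [rect_sum_local] gives a smaller bound. *)
Theorem goursat_rectangle (U V PU PV : R -> R -> R) (s1 t1 w h : R) :
  let P s t := s1 <= s <= s1 + w /\ t1 <= t <= t1 + h in
  0 < w -> 0 < h ->
  (forall s t, P s t -> is_derive t (1 : R) (PU s) (U s t)) ->
  (forall s t, P s t -> is_derive s (1 : R) (PV t) (V s t)) ->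
  (forall s t, P s t -> cauchy_riemann_at P U V s t) ->
  rect_sum PU PV s1 t1 w h = 0.
Proof.
move=> P w0 h0 HU HV HD; apply/eqP/negP => /negP A0.
pose q (n : nat) : R := 2^-1 ^+ n.
have q0 n : 0 < q n by rewrite exprn_gt0.
have qS n : q n = 2 * q n.+1 by rewrite /q exprS mulrA divff ?mul1r.
(* Half of the modulus, so that the inequality [bad] is strict from the start. *)
pose eps := `|rect_sum PU PV s1 t1 w h| / 2.
have eps0 : 0 < eps by rewrite divr_gt0 // normr_gt0.
pose bad (n : nat) (p : R * R) := eps * q n ^+ 2 < `|rect_sum PU PV p.1 p.2 (w * q n) (h * q n)|.
have step (np : nat * (R * R)) : exists p' : R * R, bad np.1 np.2 ->
   [/\ bad np.1.+1 p', np.2.1 <= p'.1 <= np.2.1 + w * q np.1.+1 &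
       np.2.2 <= p'.2 <= np.2.2 + h * q np.1.+1].
  case: np => n [s t] /=.
  have wq : 0 < w * q n.+1 by rewrite mulr_gt0.
  have hq : 0 < h * q n.+1 by rewrite mulr_gt0.
  have [b1|/negP b1] := pselect (bad n.+1 (s, t)); first by exists (s, t) => _; split => //=; lra.
  have [b2|/negP b2] := pselect (bad n.+1 (s + w * q n.+1, t)).
    by exists (s + w * q n.+1, t) => _; split => //=; lra.
  have [b3|/negP b3] := pselect (bad n.+1 (s, t + h * q n.+1)).
    by exists (s, t + h * q n.+1) => _; split => //=; lra.
  have [b4|/negP b4] := pselect (bad n.+1 (s + w * q n.+1, t + h * q n.+1)).
    by exists (s + w * q n.+1, t + h * q n.+1) => _; split => //=; lra.
  exists (s, t) => bd; exfalso; move: bd b1 b2 b3 b4; rewrite /bad /= -!leNgt.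
  have -> : rect_sum PU PV s t (w * q n) (h * q n) =
     rect_sum PU PV s t (w * q n.+1) (h * q n.+1)
   + rect_sum PU PV (s + w * q n.+1) t (w * q n.+1) (h * q n.+1)
   + rect_sum PU PV s (t + h * q n.+1) (w * q n.+1) (h * q n.+1)
   + rect_sum PU PV (s + w * q n.+1) (t + h * q n.+1) (w * q n.+1) (h * q n.+1).
    have e1 x y : x + y * q n = x + y * q n.+1 + y * q n.+1 by rewrite (qS n); ring.
    rewrite /rect_sum !e1; ring.
  rewrite (qS n) exprMn; set x := q n.+1 ^+ 2.
  move: (rect_sum _ _ _ _ _ _) (rect_sum _ _ (s + _) t _ _) (rect_sum _ _ s (t + _) _ _) (rect_sum _ _ _ _ _ _) => d0 b c a.
  have := ler_normD (a + b + c) d0; have := ler_normD (a + b) c; have := ler_normD a b.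
  lra.
have [F HF] := choice step.
pose sq := fix sq (n : nat) : R * R := if n is m.+1 then F (m, sq m) else (s1, t1).
have sqbad n : bad n (sq n).
  elim: n => [|n IH]; last by have [] := HF (n, sq n) IH.
  rewrite /bad /q !expr0 expr1n !mulr1 /= /eps.
  have : 0 < `|rect_sum PU PV s1 t1 w h| by rewrite normr_gt0.
  lra.
have sqS n := HF (n, sq n) (sqbad n).
have [s sP] : exists x, forall n, (sq n).1 <= x <= (sq n).1 + w * q n.
  apply: nested_intervals => n; first by rewrite mulr_ge0 // ltW.
    by have [_ /= + _] := sqS n; lra.
  by have [_ /= + _] := sqS n; rewrite (qS n); lra.
have [t tP] : exists x, forall n, (sq n).2 <= x <= (sq n).2 + h * q n.
  apply: nested_intervals => n; first by rewrite mulr_ge0 // ltW.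
    by have [_ /= _ +] := sqS n; lra.
  by have [_ /= _ +] := sqS n; rewrite (qS n); lra.
have sqin n : (s1 <= (sq n).1 /\ (sq n).1 + w * q n <= s1 + w) /\
              (t1 <= (sq n).2 /\ (sq n).2 + h * q n <= t1 + h).
  elim: n => [|n [[i1 i2] [i3 i4]]]; first by rewrite /q expr0 !mulr1 /=; lra.
  by have [_ /= + +] := sqS n; move: i2 i4; rewrite (qS n); lra.
have Pst : P s t.
  by have := sP 0%N; have := tP 0%N; rewrite /q expr0 !mulr1 /= /P; lra.
have wh0 : 0 < (w + h) ^+ 2 by rewrite exprn_gt0 // addr_gt0.
(* This tolerance makes the local bound on the n-th rectangle equal to eps * q n ^+ 2, the negation
   of [bad]. *)
have [r r0 loc] := rect_sum_local HU HV (HD s t Pst) (divr_gt0 eps0 (mulr_gt0 (ltr0n R 2) wh0)).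
have [n nr] : exists n, (w + h) * q n < r.
  have : (fun n => (w + h) * q n) @ \oo --> (w + h) * 0.
    apply: cvgMr; apply: cvg_expr; rewrite ger0_norm; lra.
  rewrite mulr0 => /cvgrPdist_lt /(_ r r0) [N _ HN]; exists N.
  have := HN N (leqnn N); rewrite sub0r normrN ger0_norm // mulr_ge0 ?ltW //; lra.
have := sqbad n; rewrite /bad ltNge => /negP; apply.
have wq := mulr_gt0 w0 (q0 n); have hq := mulr_gt0 h0 (q0 n).
move: nr; rewrite mulrDl => nr.
have [[i1 i2] [i3 i4]] := sqin n.
have HP s' t' : (sq n).1 <= s' <= (sq n).1 + w * q n -> (sq n).2 <= t' <= (sq n).2 + h * q n -> P s' t'.
  by rewrite /P; lra.
have wr : w * q n < r by lra.
have hr : h * q n < r by lra.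
apply: le_trans (loc _ _ _ _ wq hq wr hr (sP n) (tP n) HP) _.
rewrite -mulrDl exprMn.
have -> : 2 * (eps / (2 * (w + h) ^+ 2)) * ((w + h) ^+ 2 * q n ^+ 2) = eps * q n ^+ 2.
  by field; rewrite gt_eqF // addr_gt0.
by [].
Qed.

End Goursat.

(** * Complex differentiability and logarithmic polar coordinates *)

Section CircleMaximum.
Variable R : realType.
Implicit Types (F : Cx R -> Cx R) (c z : Cx R).

Lemma derivable_near (K : numFieldType) (W : normedModType K) (f : K -> W) x :
  derivable f x 1 -> forall e : K, 0 < e ->
  \forall h \near (0 : K), `|f (h + x) - f x - h *: 'D_1 f x| <= e * `|h|.
Proof.
move=> /derivable_nbhs df e e0.
have /eqaddoP /(_ e e0) := df.
apply: filterS => h.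
by rewrite /= /cst -![(_ + _ : _ -> _) _]/(_ + _) -![(- _ : _ -> _) _]/(- _) /= scaler1 opprD addrA.
Qed.

Lemma is_derive_frechet (f : R -> R) (x a : R) : is_derive x (1 : R) f a ->
  forall e : R, 0 < e -> exists2 r : R, 0 < r &
    forall h, `|h| < r -> `|f (h + x) - f x - h * a| <= e * `|h|.
Proof.
move=> [df Da] e e0.
have /nbhs_ballP[r /= r0 h] := derivable_near df e0.
exists r => // y yr; rewrite -Da; apply: h.
by rewrite -ball_normE /ball_ /= sub0r normrN.
Qed.

Definition cdiff F z (D : Cx R) := forall e : R, 0 < e -> exists2 r : R, 0 < r &
  forall h, normc h < r -> normc (F (z + h) - F z - D * h) <= e * normc h.

Lemma derivable_cdiff F z : derivable F z 1 -> exists D, cdiff F z D.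
Proof.
move=> dF; exists ('D_1 F z) => e e0.
have e0' : 0 < cr e by rewrite -cr0 ltcr.
have /nbhs_CxP[r r0 h] := derivable_near dF e0'.
exists r => // y yr.
have := h y; rewrite subr0 => /(_ yr); rewrite !normrE -crM lecr (addrC y z).
by rewrite [y *: _]mulrC.
Qed.

Lemma cdiff_cvg F z D : cdiff F z D -> F @ z --> F z.
Proof.
move=> dF; apply/(@cvg_CxP _ _ _ (nbhs_filter z)) => e e0.
have [r r0 h] := dF 1 ltr01.
apply/nbhs_CxP; exists (Num.min r (e / (2 + normc D))).
  by rewrite lt_min r0 divr_gt0 // ltr_wpDr // normc_ge0.
move=> w; rewrite lt_min => /andP[wr we].
have := h _ wr; rewrite mul1r (addrC z) subrK => h1.
have := normcD (F w - F z - D * (w - z)) (D * (w - z)). rewrite subrK normcM => h2.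
have : normc (w - z) * (2 + normc D) < e by rewrite -ltr_pdivlMr // ltr_wpDr // normc_ge0.
have := normc_ge0 (w - z); have := normc_ge0 D; lra.
Qed.

(** The primitive is a function of the integrand, so equal integrands get equal primitives.
    [circle_mean] relies on this when it compares the angles 0 and 2 pi. *)
Lemma primitive_exists (a : R) : exists prim : (R -> R) -> (R -> R),
  forall g, continuous g -> forall x, a < x -> is_derive x (1 : R) (prim g) (g x).
Proof.
suff /choice[prim h] (g : R -> R) : exists P : R -> R,
    continuous g -> forall x, a < x -> is_derive x (1 : R) P (g x) by exists prim.
exists (fun x => \int[lebesgue_measure]_(t in `[a, x]) g t)%R => cg x ax.
have [|dP Dg] := @continuous_FTC1_closed R g a x (x + 1) (ltac:(lra)) _ ax (cg x).
  apply: continuous_compact_integrable; first exact: segment_compact.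
  exact: continuous_subspaceT.
rewrite derive1E in Dg; exact: (DeriveDef dP Dg).
Qed.

(** The complex exponential of s + it. *)
Definition polar (s t : R) : Cx R := Complex (expR s * cos t) (expR s * sin t).

Lemma normc_polar s t : normc (polar s t) = expR s.
Proof.
by rewrite /= !exprMn -mulrDr cos2Dsin2 mulr1 sqrtr_sqr ger0_norm // expR_ge0.
Qed.

Lemma polarD s t s' t' : polar (s + s') (t + t') = polar s t * polar s' t'.
Proof.
by apply: Cx_eqP; rewrite ?ReImE /= expRD ?cosD ?sinD; ring.
Qed.

Lemma polar_near0 (e : R) : 0 < e -> exists2 r : R, 0 < r & forall s t, `|s| < r -> `|t| < r ->
  normc (polar s t - 1 - Complex s t) <= e * (`|s| + `|t|).
Proof.
move=> e0; pose e1 := Num.min 1 (e / 8).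
have e10 : 0 < e1 by rewrite lt_min ltr01 divr_gt0.
have e11 : e1 <= 1 by rewrite ge_min lexx.
have e14 : e1 <= e / 8 by rewrite ge_min lexx orbT.
have [r1 r10 h1] := is_derive_frechet (is_derive_expR (0 : R)) e10.
have [r2 r20 h2] := is_derive_frechet (is_derive_cos (0 : R)) e10.
have [r3 r30 h3] := is_derive_frechet (is_derive_sin (0 : R)) e10.
exists (Num.min (Num.min r1 r2) (Num.min r3 (e1 / 2))).
  by rewrite !lt_min r10 r20 r30 divr_gt0.
move=> s t; rewrite !lt_min => /andP[/andP[s1 _] /andP[_ s4]] /andP[/andP[_ t2] /andP[t3 t4]].
have := h1 s s1; have := h2 t t2; have := h3 t t3.
rewrite !addr0 expR0 cos0 sin0 !mulr1 !subr0 oppr0 mulr0 subr0 => k3 k2 k1.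
apply: le_trans (normc_le_ReIm _) _; rewrite !ReImE /=.
have es : `|expR s - 1| <= 2 * `|s|.
  have := ler_normD (expR s - 1 - s) s; rewrite subrK.
  by have := ler_wpM2r (normr_ge0 s) e11; rewrite mul1r; lra.
have st : `|sin t| <= 2 * `|t|.
  have := ler_normD (sin t - t) t; rewrite subrK.
  by have := ler_wpM2r (normr_ge0 t) e11; rewrite mul1r; lra.
have -> : expR s * cos t - 1 - s = (expR s - 1 - s) * cos t + (1 + s) * (cos t - 1) by ring.
have -> : expR s * sin t + - 0 - t = (expR s - 1) * sin t + (sin t - t) by ring.
have c1 : `|cos t| <= 1 by rewrite ler_norml cos_geN1 cos_le1.
have s2 : `|1 + s| <= 3 / 2 by apply: le_trans (ler_normD _ _) _; rewrite normr1; lra.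
apply: le_trans (lerD (ler_normD _ _) (ler_normD _ _)) _; rewrite !normrM.
have p1 : `|expR s - 1 - s| * `|cos t| <= e1 * `|s|.
  by apply: le_trans k1; rewrite ler_piMr.
have p2 : `|1 + s| * `|cos t - 1| <= 3 / 2 * (e1 * `|t|) by apply: ler_pM.
have p3 : `|expR s - 1| * `|sin t| <= e1 * (2 * `|t|) by apply: ler_pM => //; apply: le_trans es _; lra.
have s0 := normr_ge0 s; have t0 := normr_ge0 t.
have q1 : e1 * `|s| <= e / 8 * `|s| by rewrite ler_wpM2r.
have q2 : e1 * `|t| <= e / 8 * `|t| by rewrite ler_wpM2r.
have es0 := mulr_ge0 (ltW e0) s0; have et0 := mulr_ge0 (ltW e0) t0; lra.
Qed.

End CircleMaximum.

Section Schwarz.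
Variable R : realType.
Implicit Types (F : Cx R -> Cx R) (c z : Cx R).

(** The chain rule with derivative D p, where p = exp (s + it). By [polarD] the exponential near s +
    it is p times the exponential near 0, so [polar_near0] is all that is needed about it. *)
Lemma polar_cauchy_riemann F c s t D (P : R -> R -> Prop) :
  cdiff F (c + polar s t) D ->
  cauchy_riemann_at P (fun s t => Re (F (c + polar s t))) (fun s t => Im (F (c + polar s t))) s t.
Proof.
move=> dF; set p := polar s t; pose N := normc D * normc p.
have p0 : 0 < normc p by rewrite normc_polar expR_gt0.
have D0 := normc_ge0 D.
exists (Re (D * p)), (Im (D * p)) => e e0.
pose e1 := e / (4 * (normc p + 1)).
have p10 : 0 < normc p + 1 by lra.
have e10 : 0 < e1 by rewrite divr_gt0 // mulr_gt0.
have [r r0 hr] := dF _ e10.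
pose e2 := Num.min 1 (e / (4 * (N + 1))).
have N0 : 0 <= N by rewrite mulr_ge0 // normc_ge0.
have e20 : 0 < e2 by rewrite lt_min ltr01 divr_gt0 // mulr_gt0 //; lra.
have [q q0 hq] := polar_near0 e20.
exists (Num.min q (r / (4 * (normc p + 1)))).
  by rewrite lt_min q0 divr_gt0 // mulr_gt0.
move=> s' t' _; rewrite !lt_min => /andP[s1 s2] /andP[t1 t2].
have := hq _ _ s1 t1; set G := polar (s' - s) (t' - t); set S := `|_| + `|_| => hG.
have S0 : 0 <= S by rewrite addr_ge0.
have Gp : polar s' t' = p * G by rewrite -polarD [s + _]addrC [t + _]addrC !subrK.
have nc : normc (Complex (s' - s) (t' - t) : Cx R) <= S by apply: le_trans (normc_le_ReIm _) _.
have e21 : e2 <= 1 by rewrite ge_min lexx.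
have hG1 : normc (G - 1) <= 2 * S.
  have := normcD (G - 1 - Complex (s' - s) (t' - t)) (Complex (s' - s) (t' - t)).
  rewrite subrK; have := ler_wpM2r S0 e21; lra.
have hpG : normc (p * (G - 1)) <= normc p * (2 * S).
  by rewrite normcM ler_pM2l.
have small : normc (p * (G - 1)) < r.
  apply: le_lt_trans hpG _.
  have h1 : S < r / (2 * (normc p + 1)).
    rewrite (_ : r / (2 * _) = r / (4 * (normc p + 1)) + r / (4 * (normc p + 1))).
      exact: ltrD.
    by field; rewrite gt_eqF.
  move: h1; rewrite ltr_pdivlMr ?mulr_gt0 // => h1.
  by have := mulr_ge0 S0 (ltW p0); lra.
have := hr _ small.
have -> : c + p + p * (G - 1) = c + polar s' t' by rewrite Gp; ring.
rewrite mulrA => h.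
set Z := Complex (s' - s) (t' - t) : Cx R.
have key : normc (F (c + polar s' t') - F (c + p) - D * p * Z) <= e * S.
  have -> : F (c + polar s' t') - F (c + p) - D * p * Z =
    (F (c + polar s' t') - F (c + p) - D * p * (G - 1)) + D * p * (G - 1 - Z) by ring.
  apply: le_trans (normcD _ _) _.
  have h2 : normc (D * p * (G - 1 - Z)) <= e / 4 * S.
    rewrite !normcM -/N; apply: le_trans (ler_wpM2l N0 hG) _.
    rewrite mulrA ler_wpM2r //.
    apply: (@le_trans _ _ (N * (e / (4 * (N + 1))))).
      by rewrite ler_wpM2l // ge_min lexx orbT.
    rewrite mulrA ler_pdivrMr ?mulr_gt0 //; last lra.
    have -> : e / 4 * (4 * (N + 1)) = e * (N + 1) by field.
    by have := mulr_ge0 (ltW e0) N0; lra.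
  have h3 : e1 * normc (p * (G - 1)) <= e / 2 * S.
    apply: le_trans (ler_wpM2l (ltW e10) hpG) _.
    have -> : e1 * (normc p * (2 * S)) = (e / 2 * S) * (normc p / (normc p + 1)).
      by rewrite /e1; field; rewrite gt_eqF.
    apply: ler_piMr; first by rewrite mulr_ge0 // divr_ge0 // ltW.
    by rewrite ler_pdivrMr //; lra.
  have := mulr_ge0 (ltW e0) S0; lra.
split.
  have -> : Re (F (c + polar s' t')) - Re (F (c + p)) - (Re (D * p) * (s' - s) - Im (D * p) * (t' - t)) =
     Re (F (c + polar s' t') - F (c + p) - D * p * Z) by rewrite !ReImE /=; ring.
  exact: le_trans (Re_le_normc _) key.
have -> : Im (F (c + polar s' t')) - Im (F (c + p)) - (Im (D * p) * (s' - s) + Re (D * p) * (t' - t)) =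
     Im (F (c + polar s' t') - F (c + p) - D * p * Z) by rewrite !ReImE /=; ring.
exact: le_trans (Im_le_normc _) key.
Qed.

Lemma Re_cvg z : (@complex.Re R : Cx R -> R) @ z --> Re z.
Proof.
apply/(@cvgrPdist_lt _ _ _ _ (nbhs_filter z)) => e e0; apply/nbhs_CxP; exists e => // w we.
by apply: le_lt_trans we; have := Re_le_normc (w - z); rewrite !ReImE distrC.
Qed.

Lemma Im_cvg z : (@complex.Im R : Cx R -> R) @ z --> Im z.
Proof.
apply/(@cvgrPdist_lt _ _ _ _ (nbhs_filter z)) => e e0; apply/nbhs_CxP; exists e => // w we.
by apply: le_lt_trans we; have := Im_le_normc (w - z); rewrite !ReImE distrC.
Qed.

Lemma polar_cvg (f g : R -> R) x c : {for x, continuous f} -> {for x, continuous g} ->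
  (fun x => c + polar (f x) (g x)) @ x --> c + polar (f x) (g x).
Proof.
move=> cf cg; apply: cvgD; first exact: cvg_cst.
have c1 : (fun x => expR (f x) * cos (g x)) @ x --> expR (f x) * cos (g x).
  apply: cvgM; first exact: (cvg_comp _ _ cf (@continuous_expR R (f x))).
  exact: (cvg_comp _ _ cg (@continuous_cos R (g x))).
have c2 : (fun x => expR (f x) * sin (g x)) @ x --> expR (f x) * sin (g x).
  apply: cvgM; first exact: (cvg_comp _ _ cf (@continuous_expR R (f x))).
  exact: (cvg_comp _ _ cg (@continuous_sin R (g x))).
apply/(@cvg_CxP _ _ _ (nbhs_filter x)) => e e0; have e2 : 0 < e / 2 by lra.
have n1 := (@cvgrPdist_lt _ _ _ _ (nbhs_filter x) _ _).1 c1 _ e2.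
have n2 := (@cvgrPdist_lt _ _ _ _ (nbhs_filter x) _ _).1 c2 _ e2.
near=> y; apply: le_lt_trans (normc_le_ReIm _) _; rewrite !ReImE /=.
by rewrite [e](splitr e); apply: ltrD; rewrite distrC; near: y.
Unshelve. all: by end_near. Qed.

(* Writing F in the coordinates z = c + exp (s + i t) turns the mean of Re F over the
   circle of radius exp s into a primitive whose variation in s is controlled by Goursat's
   theorem; the point c itself is never reached, so F need not be differentiable there. *)
Lemma circle_mean F c (r r0 eps : R) : 0 < r -> r < r0 -> 0 < eps ->
  F @ c --> F c ->
  (forall z, 0 < normc (z - c) -> normc (z - c) < r0 -> exists D, cdiff F z D) ->
  ~ (forall z, normc (z - c) = r -> Re (F z) <= Re (F c) - eps).
Proof.
move=> rp rr0 eps0 cF dF hr.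
have eps2 : 0 < eps / 2 by lra.
have /nbhs_CxP[rho rho0 hrho] := (@cvg_CxP _ _ _ (nbhs_filter c) _ _).1 cF _ eps2.
(* The inner circle, of radius exp s1, lies where F differs from F c by less than eps / 2. *)
pose s2 : R := ln r; pose s1 : R := Num.min (s2 - 1) (ln (rho / 2)).
have s12 : s1 < s2 by rewrite /s1 gt_min; apply/orP; left; lra.
(* The lower limit of integration lies below both the radial interval [s1, s2] and the angular
   interval [0, 2 pi]. *)
pose a : R := Num.min (s1 - 1) (- 1).
have [prim primE] := primitive_exists a.
pose U s t := Re (F (c + polar s t)); pose V s t := Im (F (c + polar s t)).
(* V is controlled only for s <= s2, while [prim] expects a function continuous on the whole line;
   hence the truncation at s2. *)
pose PU s := prim (U s); pose PV t := prim (fun s => V (Num.min s s2) t).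
have er : expR s2 = r by rewrite lnK.
have pd s t : normc (c + polar s t - c) = expR s by rewrite addrAC subrr add0r normc_polar.
have cdF s t : s <= s2 -> exists D, cdiff F (c + polar s t) D.
  move=> ss; apply: dF; rewrite pd ?expR_gt0 //.
  by apply: le_lt_trans rr0; rewrite -er ler_expR.
have contF s t : s <= s2 -> F @ (c + polar s t) --> F (c + polar s t).
  by move=> ss; have [D hD] := cdF s t ss; exact: cdiff_cvg hD.
have HU (s t : R) : s <= s2 -> - 1 < t -> is_derive t (1 : R) (PU s) (U s t).
  move=> ss tt; apply: primE; last by rewrite /a gt_min tt orbT.
  move=> x; apply: (cvg_comp (fun x => F (c + polar s x)) (@complex.Re R)); last exact: Re_cvg.
  apply: (cvg_comp (fun x => c + polar s x) F); last exact: contF.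
  by apply: polar_cvg; [exact: cvg_cst | exact: cvg_id].
have HV (s t : R) : s <= s2 -> s1 - 1 < s -> is_derive s (1 : R) (PV t) (V s t).
  move=> ss sa; have -> : V s t = (fun s => V (Num.min s s2) t) s by rewrite /= min_l.
  apply: primE; last by rewrite /a gt_min sa.
  move=> x; apply: (cvg_comp (fun x => F (c + polar (Num.min x s2) t)) (@complex.Im R)); last exact: Im_cvg.
  apply: (cvg_comp (fun x => c + polar (Num.min x s2) t) F); last by apply: contF; rewrite ge_min lexx orbT.
  apply: polar_cvg; last exact: cvg_cst.
  by apply: continuous_min; [exact: cvg_id | exact: cvg_cst].
have [p [pi2 cosp sinp]] : exists p : R, [/\ 0 < p, cos p = 1 & sin p = 0].
  by exists (pi *+ 2); rewrite cos2pi sin2pi pmulrn_lgt0 // pi_gt0.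
have G : rect_sum PU PV s1 0 (s2 - s1) p = 0.
  have w0 : 0 < s2 - s1 by rewrite subr_gt0.
  have G0 := @goursat_rectangle R U V PU PV s1 0 (s2 - s1) p w0 pi2.
  have C1 : forall s t, s1 <= s <= s1 + (s2 - s1) /\ 0 <= t <= 0 + p -> is_derive t (1 : R) (PU s) (U s t).
    by move=> s t [ss tt]; apply: HU; lra.
  have C2 : forall s t, s1 <= s <= s1 + (s2 - s1) /\ 0 <= t <= 0 + p -> is_derive s (1 : R) (PV t) (V s t).
    by move=> s t [ss tt]; apply: HV; lra.
  have C3 : forall s t, s1 <= s <= s1 + (s2 - s1) /\ 0 <= t <= 0 + p ->
     cauchy_riemann_at (fun s t => s1 <= s <= s1 + (s2 - s1) /\ 0 <= t <= 0 + p) U V s t.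
    move=> s t [ss tt]; have [|D hD] := cdF s t; first lra.
    exact: (polar_cauchy_riemann _ hD).
  exact: (G0 C1 C2 C3).
(* The two radial sides carry the same values by periodicity and cancel, so the integrals of Re F
   over the outer and the inner circle coincide. *)
have VP : PV p = PV 0.
  rewrite /PV; congr prim; apply/funext => s.
  by rewrite /V /polar cosp sinp cos0 sin0.
move: G; rewrite /rect_sum [s1 + _]addrC subrK add0r VP subrr subr0 => /eqP.
rewrite subr_eq0 => /eqP G.
have D2 (t : R) : 0 <= t <= p -> is_derive t (1 : R) (PU s2) (U s2 t).
  by move=> ht; apply: HU; lra.
have M2 := @mvt_is_derive R (PU s2) (U s2) 0 p pi2.
have [t2 _ e2] := M2 D2.
have D1 (t : R) : 0 <= t <= p -> is_derive t (1 : R) (PU s1) (U s1 t).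
  by move=> ht; apply: HU; lra.
have M1 := @mvt_is_derive R (PU s1) (U s1) 0 p pi2.
have [t1 _ e1] := M1 D1.
(* Both means are values of Re F by the mean value theorem: the outer one is at most Re (F c) - eps,
   the inner one exceeds Re (F c) - eps / 2. *)
have E : U s2 t2 = U s1 t1.
  by apply: (@mulIf _ p); rewrite ?gt_eqF // -[p]subr0 -e1 -e2.
have u2 : U s2 t2 <= Re (F c) - eps by apply: hr; rewrite pd.
have u1 : Re (F c) - eps / 2 < U s1 t1.
  have : normc (c + polar s1 t1 - c) < rho.
    rewrite pd; apply: (@le_lt_trans _ _ (rho / 2)); last lra.
    rewrite -[leRHS]lnK ?posrE; last by lra.
    by rewrite ler_expR /s1 ge_min lexx orbT.
  move=> /hrho h; have := le_lt_trans (Re_le_normc _) h.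
  by rewrite !ReImE ltr_norml /U; lra.
lra.
Qed.

End Schwarz.

(** * The Schwarz lemma through a maximum principle *)

Section SchwarzLemma.
Variable R : realType.
Implicit Types (F g : Cx R -> Cx R) (c z : Cx R).

Lemma derivable_mul F g z : derivable F z 1 -> derivable g z 1 ->
  derivable (fun z => F z * g z) z 1.
Proof. exact: (@derivableM _ _ F g). Qed.

Lemma derivable_inv g z : g z != 0 -> derivable g z 1 -> derivable (fun z => (g z)^-1) z 1.
Proof. exact: (@derivableV _ _ g). Qed.

Lemma derivable_add F g z : derivable F z 1 -> derivable g z 1 ->
  derivable (fun z => F z + g z) z 1.
Proof. exact: (@derivableD _ _ _ F g). Qed.

Lemma derivable_sub F g z : derivable F z 1 -> derivable g z 1 ->
  derivable (fun z => F z - g z) z 1.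
Proof. exact: (@derivableB _ _ _ F g). Qed.

Lemma derivable_const c z : derivable (fun _ => c) z 1.
Proof. exact: (@derivable_cst _ _ _ c). Qed.

Lemma derivable_var z : derivable (fun z : Cx R => z) z 1.
Proof. exact: (@derivable_id _ _ z 1). Qed.

Lemma derivable_invz z : z != 0 -> derivable (fun z : Cx R => z^-1) z 1.
Proof. by move=> z0; exact: (@derivable_inv (fun z => z) z z0 (@derivable_var z)). Qed.

Lemma cdiff_ext F g z D (r : R) : 0 < r -> (forall h, normc h < r -> F (z + h) = g (z + h)) ->
  cdiff F z D -> cdiff g z D.
Proof.
move=> r0 Fg dF e e0; have [q q0 hq] := dF e e0.
exists (Num.min q r); first by rewrite lt_min q0.
move=> h; rewrite lt_min => /andP[hq' hr].
have g0 : F z = g z by have := Fg 0; rewrite addr0 normc0; apply.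
by rewrite -g0 -Fg //; apply: hq.
Qed.

Definition difference_quotient g (D : Cx R) z : Cx R := if z == 0 then D else g z * z^-1.

Lemma difference_quotient_cvg g D z : g 0 = 0 -> cdiff g 0 D -> derivable g z 1 ->
  difference_quotient g D @ z --> difference_quotient g D z.
Proof.
move=> g0 dg0 dg; have [->|z0] := eqVneq z 0.
  apply/(@cvg_CxP _ _ _ (nbhs_filter (0 : Cx R))) => e e0.
  have e20 : 0 < e / 2 by lra.
  have [r r0 hr] := dg0 _ e20; apply/nbhs_CxP; exists r => // w.
  rewrite subr0 /difference_quotient eqxx => wr.
  have [_|w0] := eqVneq w 0; first by rewrite subrr normc0.
  have := hr w wr; rewrite add0r g0 subr0 => h.
  have -> : g w * w^-1 - D = (g w - D * w) * w^-1 by rewrite mulrBl mulfK.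
  have nw : 0 < normc w by rewrite normc_gt0.
  by rewrite normcM normcV ltr_pdivrMr //; apply: le_lt_trans h _; rewrite ltr_pM2r //; lra.
have : derivable (fun z => g z * z^-1) z 1.
  by exact: (derivable_mul dg (derivable_invz z0)).
move=> /derivable_cdiff[E hE]; apply: (@cdiff_cvg _ _ _ E).
apply: (@cdiff_ext _ _ _ _ (normc z)) hE; first by rewrite normc_gt0.
move=> h hz; rewrite /difference_quotient; case: eqP => // zh.
by move: hz; rewrite -[h](addKr z) zh addr0 normcN ltxx.
Qed.

(* Strict maximum principle for [Re (c * q) + eta * |z|^2], q the difference quotient; as
   [circle_mean] ignores the centre, the singularity of q at 0 needs no removal. *)
Theorem schwarz g : (forall z, normc z < 1 -> derivable g z 1) ->
  (forall z, normc z < 1 -> normc (g z) <= 1) -> g 0 = 0 ->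
  forall z, normc z < 1 -> normc (g z) <= normc z.
Proof.
move=> dg bg g0.
have [D hD] : exists D, cdiff g 0 D by apply: derivable_cdiff; apply: dg; rewrite normc0.
pose q := difference_quotient g D.
have qE z : z != 0 -> q z = g z * z^-1 by rewrite /q /difference_quotient; case: eqP.
have cq z : normc z < 1 -> q @ z --> q z by move=> /dg; exact: difference_quotient_cvg.
have max c eta rho z : normc c = 1 -> 0 < eta -> 0 < rho -> rho < 1 -> normc z <= rho ->
    Re (c * q z) <= rho^-1 + eta.
  move=> c1 eta0 rho0 rho1 zrho.
  pose u z := Re (c * q z) + eta * (Re z * Re z + Im z * Im z).
  (* Maximizing u is rephrased as minimizing expR (- u), because [min_attained] expects a
     nonnegative function. *)
  have cu z' : normc z' < 1 -> (fun z => expR (- u z)) @ z' --> expR (- u z').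
    move=> z1; apply: (cvg_comp (fun z => - u z) (@expR R)); last exact: continuous_expR.
    have k1 : (fun z => c * q z) @ z' --> c * q z'.
      exact: (@cvgM _ _ _ (nbhs_filter z') (fun _ => c) q _ _ (cvg_cst _) (cq _ z1)).
    have k2 := cvg_comp (fun z => c * q z) (@complex.Re R) k1 (@Re_cvg R _).
    have k3 := @cvgD _ _ _ _ (nbhs_filter z') _ _ _ _
      (@cvgM _ _ _ (nbhs_filter z') _ _ _ _ (@Re_cvg R z') (@Re_cvg R z'))
      (@cvgM _ _ _ (nbhs_filter z') _ _ _ _ (@Im_cvg R z') (@Im_cvg R z')).
    have k4 := @cvgM _ _ _ (nbhs_filter z') (fun _ => eta) _ _ _ (cvg_cst _) k3.
    have k5 := @cvgD _ _ _ _ (nbhs_filter z') _ _ _ _ k2 (k4 (nbhs_filter z')).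
    exact: (@cvgN _ _ _ _ (nbhs_filter z') _ _ k5).
  pose A := [set v : 'rV[Cx R]_1 | normc (v 0 0) <= rho].
  have [|||||x Ax hx] := @min_attained R 1 A rho (fun v => expR (- u (v 0 0))).
  - by exists 0; rewrite /A /= mxE normc0 ltW.
  - move=> v Av; apply: le_trans (enorm_sum_le v) _.
    by rewrite big_ord_recl big_ord0 addr0.
  - move=> v /closure_enormP clv; rewrite /A /=; apply/ler_addgt0Pr => e e0.
    have [w Aw wv] := clv e e0.
    have := normc_le_enorm (w - v) 0; rewrite !mxE => h.
    have := normcB (v 0 0) (w 0 0); rewrite normcBC; move: Aw; rewrite /A /=; lra.
  - by move=> v _; exact: expR_ge0.
  - move=> v Av e e0; have v1 : normc (v 0 0) < 1 by apply: le_lt_trans rho1.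
    have := (@cvgrPdist_lt _ _ _ _ (nbhs_filter (v 0 0)) _ _).1 (cu _ v1) e e0.
    move=> /nbhs_CxP[r r0 hr]; exists r => // y _ yv.
    have /hr : normc (y 0 0 - v 0 0) < r.
      by apply: le_lt_trans yv; have := normc_le_enorm (y - v) 0; rewrite !mxE.
    by rewrite ltr_norml; lra.
  set z1 := x 0 0 in Ax hx.
  have umax w : normc w <= rho -> u w <= u z1.
    move=> wr; have := hx (const_mx w); rewrite /A /= mxE => /(_ wr).
    by rewrite ler_expR lerN2.
  have nz (w : Cx R) : Re w * Re w + Im w * Im w = normc w ^+ 2 by rewrite normc_sqr !expr2.
  have z1rho : normc z1 = rho.
    apply/eqP; rewrite eq_le Ax /= leNgt; apply/negP => z1lt.
    (* The disc of radius r0 about z1 stays in |z| <= rho, and its punctured interior avoids 0, the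
       only point where differentiability of q is unknown. *)
    pose r0 := if z1 == 0 then rho else Num.min (rho - normc z1) (normc z1).
    have r00 : 0 < r0.
      by rewrite /r0; case: eqVneq => // h; rewrite lt_min subr_gt0 z1lt normc_gt0.
    have r0rho : normc z1 + r0 <= rho.
      rewrite /r0; case: eqVneq => [->|h]; first by rewrite normc0 add0r.
      by rewrite -lerBrDl ge_min lexx.
    have z1D w : normc (w - z1) <= r0 -> normc w <= rho.
      by move=> h; have := normcB w z1; lra.
    (* On a circle about z1 one has |w|^2 = |z1|^2 + 2 Re (conj z1 (w - z1)) + |w - z1|^2. So on it
       Re F is u minus a constant, and maximality of u at z1 puts Re F below Re (F z1) by eta times
       the squared radius. *)
    pose F w := c * q w + cr (2 * eta) * (conjc z1 * (w - z1)).
    have r2 : 0 < r0 / 2 by lra.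
    have r2' : r0 / 2 < r0 by lra.
    have e0 : 0 < eta * (r0 / 2) ^+ 2 by rewrite mulr_gt0 // exprn_gt0.
    apply: (@circle_mean R F z1 (r0 / 2) r0 (eta * (r0 / 2) ^+ 2)) => //.
    - have z11 : normc z1 < 1 by lra.
      have k1 := @cvgM _ _ _ (nbhs_filter z1) (fun _ => c) q _ _ (cvg_cst _) (cq _ z11).
      have k2 := @cvgB _ _ _ _ (nbhs_filter z1) (fun w : Cx R => w) (fun _ => z1) _ _ (@cvg_id _ (nbhs z1)) (cvg_cst z1).
      have k3 := @cvgM _ _ _ (nbhs_filter z1) (fun _ => conjc z1) _ _ _ (cvg_cst _) (k2 (nbhs_filter z1)).
      have k4 := @cvgM _ _ _ (nbhs_filter z1) (fun _ => cr (2 * eta)) _ _ _ (cvg_cst _) (k3 (nbhs_filter z1)).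
      exact: (@cvgD _ _ _ _ (nbhs_filter z1) _ _ _ _ (k1 (nbhs_filter z1)) (k4 (nbhs_filter z1))).
    - move=> w w0 wr.
      have wn0 : w != 0.
        apply/eqP => w00; move: w0 wr; rewrite w00 sub0r normcN /r0.
        case: eqVneq => [->|_ _]; first by rewrite normc0 ltxx.
        by rewrite lt_min ltxx andbF.
      have wlt : normc w < 1 by apply: le_lt_trans rho1; apply: z1D; apply: ltW.
      have dFw : derivable (fun w => c * (g w * w^-1) + cr (2 * eta) * (conjc z1 * (w - z1))) w 1.
        apply: (derivable_add (derivable_mul (@derivable_const c w) (derivable_mul (dg w wlt) (derivable_invz wn0)))).
        apply: (derivable_mul (@derivable_const _ w) (derivable_mul (@derivable_const _ w) _)).
        exact: (derivable_sub (@derivable_var w) (@derivable_const z1 w)).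
      have [E hE] := derivable_cdiff dFw; exists E.
      apply: (@cdiff_ext _ _ _ _ (normc w)) hE; first by rewrite normc_gt0.
      move=> h hw; rewrite /F qE //; apply/eqP => wh.
      by move: hw; rewrite -[h](addKr w) wh addr0 normcN ltxx.
    - move=> w wr; have := umax w (z1D w (ltac:(lra))).
      rewrite /u /F subrr !mulr0 addr0 !nz.
      have -> : normc w ^+ 2 = normc z1 ^+ 2 + 2 * Re (conjc z1 * (w - z1)) + (r0 / 2) ^+ 2.
        by rewrite -wr !normc_sqr !ReImE; ring.
      rewrite [Re (_ + _)]ReD [Re (cr _ * _)]ReM /=; lra.
  have := umax z zrho; rewrite /u !nz z1rho.
  have h1 : Re (c * q z1) <= rho^-1.
    apply: le_trans (ler_norm _) _; apply: le_trans (Re_le_normc _) _.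
    have z10 : z1 != 0 by rewrite -normc_gt0 z1rho.
    rewrite normcM c1 mul1r qE // normcM normcV z1rho; apply: ler_piMl.
      by rewrite invr_ge0 ltW.
    by apply: bg; rewrite z1rho.
  have h2 : eta * rho ^+ 2 <= eta by apply: ler_piMr; [exact: ltW | rewrite expr_le1 // ltW].
  have h3 : 0 <= eta * normc z ^+ 2 by rewrite mulr_ge0 ?sqr_ge0 // ltW.
  lra.
move=> z z1; have [->|z0] := eqVneq z 0; first by rewrite g0 normc0.
have zp : 0 < normc z by rewrite normc_gt0.
suff : normc (q z) <= 1 by rewrite qE // normcM normcV ler_pdivrMr // mul1r.
have [->|qz0] := eqVneq (q z) 0; first by rewrite normc0.
have qp : 0 < normc (q z) by rewrite normc_gt0.
(* The rotation that makes c * q z a nonnegative real. *)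
pose c := conjc (q z) * cr (normc (q z))^-1.
have c1 : normc c = 1.
  by rewrite normcM normc_conj normc_cr gtr0_norm ?invr_gt0 // divff // gt_eqF.
have cqz : Re (c * q z) = normc (q z).
  apply: (@mulIf _ (normc (q z))); first by rewrite gt_eqF.
  rewrite -expr2 normc_sqr /c !ReImE /=; field.
  by rewrite gt_eqF.
apply/ler_addgt0Pr => e e0.
(* Close enough to 1 that rho^-1 <= 1 + e / 2, and large enough that z lies in the disc. *)
pose rho := Num.max (normc z) (1 + e / 2)^-1.
have rho0 : 0 < rho by rewrite lt_max zp.
have rho1 : rho < 1 by rewrite gt_max z1 invf_lt1 //; lra.
have e2 : 0 < e / 2 by lra.
have := max c (e / 2) rho z c1 e2 rho0 rho1; rewrite le_max lexx => /(_ isT).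
rewrite cqz; have : rho^-1 <= 1 + e / 2.
  by rewrite invf_ple ?posrE //; [rewrite le_max lexx orbT | lra].
lra.
Qed.

End SchwarzLemma.

(** * The Kobayashi distance through chains of discs *)

Section HyperbolicTangent.
Variable R : realType.
Implicit Types s t u : R.

(** The hyperbolic tangent, inverse to the function of t that appears in [poincare]. *)
Definition th s : R := (expR (2 * s) - 1) / (expR (2 * s) + 1).

Let E0 s : 0 < expR (2 * s) + 1. Proof. by have := expR_gt0 (2 * s); lra. Qed.

Lemma thE s : th s = 1 - 2 / (expR (2 * s) + 1).
Proof. by rewrite /th; field; rewrite gt_eqF. Qed.

Lemma th0 : th 0 = 0.
Proof. by rewrite /th mulr0 expR0 subrr mul0r. Qed.

Lemma th_lt1 s : th s < 1.
Proof. by rewrite ltr_pdivrMr //; lra. Qed.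

Lemma ler_th s t : (th s <= th t) = (s <= t).
Proof.
rewrite !thE lerD2l lerN2 ler_pM2l // lef_pV2 ?posrE // lerD2r ler_expR.
by rewrite ler_pM2l.
Qed.

Lemma th_ge0 s : 0 <= s -> 0 <= th s.
Proof. by rewrite -{2}th0 ler_th. Qed.

Lemma ltr_th s t : (th s < th t) = (s < t).
Proof. by rewrite !ltNge ler_th. Qed.

Lemma th_gt0 s : 0 < s -> 0 < th s.
Proof. by rewrite -{2}th0 ltr_th. Qed.

Lemma th_ratio s : (1 + th s) / (1 - th s) = expR (2 * s).
Proof. by rewrite thE; have := E0 s; have := expR_gt0 (2 * s) => h1 h2; field; rewrite !gt_eqF //; lra. Qed.

Lemma th_ln t : 0 <= t -> t < 1 -> th (2^-1 * ln ((1 + t) / (1 - t))) = t.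
Proof.
move=> t0 t1; rewrite thE mulrA divff // mul1r lnK; last first.
  by rewrite posrE divr_gt0 //; lra.
by field; rewrite !gt_eqF //; lra.
Qed.

Lemma ln_th s : 2^-1 * ln ((1 + th s) / (1 - th s)) = s.
Proof. by rewrite th_ratio expRK mulrA mulVf // mul1r. Qed.

Lemma thD s u : th (s + u) = (th u + th s) / (1 + th s * th u).
Proof.
rewrite /th mulrDr expRD; have := expR_gt0 (2 * s); have := expR_gt0 (2 * u).
move: (expR _) (expR _) => x y x0 y0.
have h : 0 < y * x by rewrite mulr_gt0.
by field; rewrite !gt_eqF //; lra.
Qed.

Lemma th_le s : 0 <= s -> th s <= 2 * s.
Proof.
move=> s0; rewrite ler_pdivrMr //.
have := expR_ge1Dx (- (2 * s)); rewrite expRN => h.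
have e0 := expR_gt0 (2 * s).
have : (1 - 2 * s) * expR (2 * s) <= 1.
  by rewrite -ler_pdivlMr // div1r.
lra.
Qed.

Lemma th_ge s : 0 <= s -> s <= 1 -> s / 2 <= th s.
Proof.
move=> s0 s1; rewrite ler_pdivlMr //.
by have := expR_ge1Dx (2 * s); move: (expR _) => x; nra.
Qed.

End HyperbolicTangent.

Section Mobius.
Variable R : realType.
Implicit Types (a z w u : Cx R).

Definition mobius a z : Cx R := (z + a) / (1 + conjc a * z).

Lemma mobius_den a z : normc a < 1 -> normc z < 1 -> 1 + conjc a * z != 0.
Proof.
move=> a1 z1; apply/eqP => h.
have : normc (conjc a * z) < 1.
  by rewrite normcM normc_conj; have := normc_ge0 a; have := normc_ge0 z; nra.
by rewrite -[conjc a * z](addKr 1) h addr0 normcN normc1 ltxx.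
Qed.

Lemma mobius_norm a z : normc a < 1 -> normc z < 1 -> normc (mobius a z) < 1.
Proof.
move=> a1 z1; have d0 := mobius_den a1 z1.
rewrite normcM normcV ltr_pdivrMr ?normc_gt0 // mul1r.
rewrite -(@ltr_pXn2r _ 2) ?nnegrE ?normc_ge0 // -subr_gt0.
have -> : normc (1 + conjc a * z) ^+ 2 - normc (z + a) ^+ 2 =
  (1 - normc a ^+ 2) * (1 - normc z ^+ 2).
  by rewrite !normc_sqr !ReImE /=; ring.
by rewrite mulr_gt0 // subr_gt0 expr_lt1 // normc_ge0.
Qed.

Lemma mobius0 a : mobius a 0 = a.
Proof. by rewrite /mobius mulr0 addr0 add0r divr1. Qed.

Lemma mobiusK a z : normc a < 1 -> normc z < 1 -> mobius a (mobius (- a) z) = z.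
Proof.
move=> a1 z1.
have na1 : normc (- a) < 1 by rewrite normcN.
have d0 := mobius_den na1 z1.
have d1 := mobius_den a1 (mobius_norm na1 z1).
have ca : conjc (- a) = - conjc a by apply: Cx_eqP; rewrite !ReImE.
set w := mobius (- a) z in d1 *.
have hw : w * (1 - conjc a * z) = z - a.
  by rewrite /w /mobius ca mulNr mulfVK // -mulNr -ca.
have -> : mobius a w = z * (1 + conjc a * w) / (1 + conjc a * w); last exact: mulfK.
rewrite /mobius; congr (_ / _).
apply/eqP; rewrite -subr_eq0.
have -> : w + a - z * (1 + conjc a * w) = w * (1 - conjc a * z) - (z - a) by ring.
by rewrite hw subrr.
Qed.

Lemma mobius_derivable a z u : normc a < 1 -> normc u <= 1 -> normc z < 1 ->
  derivable (fun z => mobius a (u * z)) z 1.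
Proof.
move=> a1 u1 z1.
have uz1 : normc (u * z) < 1.
  by rewrite normcM; have := normc_ge0 u; have := normc_ge0 z; nra.
have d1 : derivable (fun z => u * z) z 1 := derivable_mul (@derivable_const _ u z) (@derivable_var _ z).
have d2 : derivable (fun z => u * z + a) z 1 := derivable_add d1 (@derivable_const _ a z).
have d3 : derivable (fun z => (1 : Cx R) + (conjc a : Cx R) * (u * z)) z 1.
  exact: (derivable_add (@derivable_const _ 1 z) (derivable_mul (@derivable_const _ (conjc a : Cx R) z) d1)).
apply: (derivable_mul d2 (@derivable_inv _ (fun z => (1 : Cx R) + (conjc a : Cx R) * (u * z)) z _ d3)).
exact: mobius_den.
Qed.

End Mobius.

(** * Normalized analytic discs and Schwarz-Pick estimates *)

Section Discs.
Variables (R : realType) (d : nat).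
Local Notation V := 'rV[Cx R]_d.
Implicit Types (Om : set V) (p q x v w : V) (phi psi : Cx R -> V) (z a b : Cx R) (s t : R).

Lemma derivable_scal (k : Cx R -> Cx R) v z : derivable k z 1 -> derivable (fun z => k z *: v) z 1.
Proof. by move=> /derivable1_diffP dk; apply/derivable1_diffP; exact: differentiableZl. Qed.

Lemma derivable_addV phi psi z : derivable phi z 1 -> derivable psi z 1 ->
  derivable (fun z => phi z + psi z) z 1.
Proof. exact: (@derivableD _ _ _ phi psi). Qed.

Lemma derivable_scaleV c phi z : derivable phi z 1 -> derivable (fun z => c *: phi z) z 1.
Proof. exact: (@derivableZ _ _ _ phi c). Qed.

Lemma derivable_constV v z : derivable (fun _ : Cx R => v) z 1.
Proof. exact: (@derivable_cst _ _ _ v). Qed.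

Lemma derivable_compV phi (k : Cx R -> Cx R) z : derivable k z 1 -> derivable phi (k z) 1 ->
  derivable (fun z => phi (k z)) z 1.
Proof.
move=> /derivable1_diffP dk /derivable1_diffP dp; apply/derivable1_diffP.
exact: (differentiable_comp dk dp).
Qed.

Lemma derivable_coordV phi j z : derivable phi z 1 -> derivable (fun z => phi z 0 j) z 1.
Proof.
move=> /derivable1_diffP dp; apply/derivable1_diffP.
exact: (differentiable_comp dp (differentiable_coord (phi z) 0 j)).
Qed.

Lemma derivable_hdot phi w z : derivable phi z 1 -> derivable (fun z => hdot (phi z) w) z 1.
Proof.
move=> dp.
have -> : (fun z => hdot (phi z) w) = \sum_(j < d) (fun z => phi z 0 j * (conjc (w 0 j) : Cx R)).
  by apply/funext => y; rewrite hdot_sum fct_sumE.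
apply: (@derivable_sum _ _ _ d (fun j z => phi z 0 j * (conjc (w 0 j) : Cx R))) => j.
exact: (derivable_mul (@derivable_coordV phi j z dp) (@derivable_const _ (conjc (w 0 j) : Cx R) z)).
Qed.

Lemma analytic_disc_mobius Om phi a u : analytic_disc Om phi -> normc a < 1 -> normc u <= 1 ->
  analytic_disc Om (fun z => phi (mobius a (u * z))).
Proof.
move=> [dphi phiO] a1 u1.
have m1 z : normc z < 1 -> normc (mobius a (u * z)) < 1.
  move=> z1; apply: mobius_norm => //; rewrite normcM.
  by have := normc_ge0 u; have := normc_ge0 z; nra.
split=> z /unit_discP z1; last by apply: phiO; apply/unit_discP; exact: m1.
apply: (@derivable_compV phi (fun z => mobius a (u * z))); first exact: mobius_derivable.
by apply: dphi; apply/unit_discP; exact: m1.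
Qed.

Lemma analytic_disc_const Om p : Om p -> analytic_disc Om (fun _ => p).
Proof. by move=> Op; split=> z _ //; exact: derivable_constV. Qed.

(* [seg Om p q s]: an analytic disc takes the values p and q at two points at Poincare
   distance s, normalized to be 0 and th s. *)
Definition seg Om p q s := 0 <= s /\
  exists psi, [/\ analytic_disc Om psi, psi 0 = p & psi (cr (th s)) = q].

Lemma seg_in Om p q s : seg Om p q s -> Om p /\ Om q.
Proof.
move=> [s0 [psi [[_ h] <- <-]]]; split; apply: h; apply/unit_discP.
  by rewrite normc0.
by rewrite normc_cr ger0_norm ?th_ge0 // th_lt1.
Qed.

Lemma normc_th s : 0 <= s -> normc (cr (th s)) < 1.
Proof. by move=> s0; rewrite normc_cr ger0_norm ?th_ge0 // th_lt1. Qed.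

Lemma mobius_th s u : 0 <= s -> 0 <= u -> mobius (cr (th s)) (cr (th u)) = cr (th (s + u)).
Proof.
move=> s0 u0; rewrite /mobius thD.
by rewrite conj_cr !(crM, crD, crV).
Qed.

Lemma seg_const Om p s : 0 <= s -> Om p -> seg Om p p s.
Proof. by move=> s0 Op; split=> //; exists (fun _ => p); split=> //; exact: analytic_disc_const. Qed.

Lemma seg_of_disc Om phi a b : analytic_disc Om phi -> unit_disc a -> unit_disc b ->
  seg Om (phi a) (phi b) (poincare a b).
Proof.
move=> dphi /unit_discP a1 /unit_discP b1.
set w := mobius (- a) b.
have w1 : normc w < 1 by apply: mobius_norm; rewrite ?normcN.
have tw : ComplexField.Normc.normc ((a - b) / (1 - conjc b * a)) = normc w.
  rewrite /w /mobius [LHS]normcM [RHS]normcM !normcV normcBC; congr (_ / _).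
  rewrite -normc_conj; congr normc; apply: Cx_eqP; rewrite !ReImE /=; ring.
have t0 := normc_ge0 w.
have thp : th (poincare a b) = normc w by rewrite /poincare tw th_ln.
split.
  by rewrite -ler_th th0 thp.
(* A rotation carrying the positive radius through |w| to w; any unimodular number would do when w =
   0. *)
pose u : Cx R := if w == 0 then 1 else w / cr (normc w).
have u1 : normc u <= 1.
  rewrite /u; case: eqP => [_|/eqP w0]; first by rewrite normc1.
  by rewrite normcM normcV normc_cr ger0_norm ?normc_ge0 // divff // normc_eq0.
have uw : u * cr (normc w) = w.
  rewrite /u; case: eqP => [->|/eqP w0]; first by rewrite normc0 cr0 mulr0.
  by rewrite mulfVK // cr_eq0 normc_eq0.
exists (fun z => phi (mobius a (u * z))); split; first exact: analytic_disc_mobius.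
  by rewrite mulr0 mobius0.
by rewrite thp uw mobiusK.
Qed.

Lemma poincare_th s : 0 <= s -> poincare (0 : Cx R) (cr (th s)) = s.
Proof.
move=> s0; rewrite /poincare mulr0 subr0 divr1 sub0r normcN normc_cr ger0_norm ?th_ge0 //.
exact: ln_th.
Qed.

Lemma disc_of_seg Om p q s : seg Om p q s ->
  exists phi a b, [/\ analytic_disc Om phi, unit_disc a, unit_disc b & [/\ phi a = p, phi b = q & poincare a b = s]].
Proof.
move=> [s0 [psi [dpsi p0 pq]]]; exists psi, 0, (cr (th s)); split=> //.
- by apply/unit_discP; rewrite normc0.
- by apply/unit_discP; exact: normc_th.
- by split=> //; exact: poincare_th.
Qed.

(** The map z |-> [mobius] (th s) (- z) exchanges 0 and th s. *)
Lemma seg_sym Om p q s : seg Om p q s -> seg Om q p s.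
Proof.
move=> [s0 [psi [dpsi p0 pq]]]; split=> //.
exists (fun z => psi (mobius (cr (th s)) (- 1 * z))); split.
- by apply: analytic_disc_mobius => //; rewrite ?normc_th // normcN normc1.
- by rewrite mulr0 mobius0.
- by rewrite -p0 mulN1r /mobius addNr mul0r.
Qed.

Lemma disc_seg Om psi t u : analytic_disc Om psi -> 0 <= t -> t <= u ->
  seg Om (psi (cr (th t))) (psi (cr (th u))) (u - t).
Proof.
move=> dpsi t0 tu; have ut : 0 <= u - t by lra.
split=> //; exists (fun z => psi (mobius (cr (th t)) (1 * z))); split.
- by apply: analytic_disc_mobius => //; rewrite ?normc_th // normc1.
- by rewrite mulr0 mobius0.
- by rewrite mul1r mobius_th // addrC subrK.
Qed.

(** The real diameter of the disc is a Poincare geodesic, so a segment has intermediate points at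
    every length. *)
Lemma seg_path Om p q s : seg Om p q s -> exists g : R -> V, [/\ g 0 = p, g s = q &
  forall t u, 0 <= t -> t <= u -> u <= s -> seg Om (g t) (g u) (u - t)].
Proof.
move=> [s0 [psi [dpsi p0 pq]]]; exists (fun t => psi (cr (th t))); split=> //.
  by rewrite th0.
by move=> t u t0 tu us; exact: disc_seg.
Qed.

Definition convexS Om := forall t x y, 0 <= t -> t <= 1 -> Om x -> Om y ->
  Om (cr (1 - t) *: x + cr t *: y).

(** Two discs of the same length reach their end points at the same parameter th s, so they can be
    combined pointwise. This is the purpose of the normalization in [seg]. *)
Lemma seg_conv Om t p q p' q' s : convexS Om -> 0 <= t -> t <= 1 ->
  seg Om p q s -> seg Om p' q' s ->
  seg Om (cr (1 - t) *: p + cr t *: p') (cr (1 - t) *: q + cr t *: q') s.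
Proof.
move=> cO t0 t1 [s0 [psi [[dpsi psiO] <- <-]]] [_ [phi [[dphi phiO] <- <-]]]; split=> //.
exists (fun z => cr (1 - t) *: psi z + cr t *: phi z); split; [split=> z z1|by []|by []].
  exact: (derivable_addV (@derivable_scaleV (cr (1 - t)) _ _ (dpsi _ z1)) (@derivable_scaleV (cr t) _ _ (dphi _ z1))).
by apply: cO => //; [exact: psiO | exact: phiO].
Qed.

Lemma seg_ball Om x v (r : R) s : 0 < r -> 0 <= s ->
  (forall y, enorm (y - x) < r -> Om y) -> enorm v <= r * th s ->
  seg Om x (x + v) s.
Proof.
move=> r0 s0 hO hv; have [s00|sn0] := eqVneq s 0.
  move: hv; rewrite s00 th0 mulr0 => hv.
  have : enorm v = 0 by apply/eqP; rewrite eq_le hv enorm_ge0.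
  move/eqP; rewrite enorm_eq0 => /eqP ->; rewrite addr0; apply: seg_const => //.
  by apply: hO; rewrite subrr enorm0.
have tp : 0 < th s by apply: th_gt0; rewrite lt_neqAle eq_sym sn0.
split=> //; exists (fun z => x + z *: ((cr (th s))^-1 *: v)); split.
- split=> z /unit_discP z1.
    apply: (derivable_addV (@derivable_constV x z)).
    exact: (@derivable_scal _ ((cr (th s))^-1 *: v) _ (@derivable_var _ z)).
  apply: hO; rewrite addrAC subrr add0r !enormZ normcV normc_cr gtr0_norm //.
  rewrite mulrCA mulrC; apply: (@le_lt_trans _ _ (normc z * r)); last by rewrite gtr_pMl.
  by rewrite -mulrA ler_wpM2l ?normc_ge0 // ler_pdivrMr.
- by rewrite scale0r addr0.
- by rewrite scalerA divff ?scale1r // cr_eq0 gt_eqF.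
Qed.

(** Schwarz lemma for (h - h 0) / (h + conj (h 0)), the Cayley transform of the right half-plane
    that sends h 0 to 0. *)
Lemma half_plane_disc (h : Cx R -> Cx R) s : 0 <= s ->
  (forall z, unit_disc z -> derivable h z 1) -> (forall z, unit_disc z -> 0 < Re (h z)) ->
  normc (h (cr (th s)) - h 0) <= th s * normc (h (cr (th s)) + conjc (h 0)).
Proof.
move=> s0 dh hp; set c : Cx R := conjc (h 0).
have h00 : 0 < Re (h 0) by apply: hp; apply/unit_discP; rewrite normc0.
have den z : normc z < 1 -> h z + c != 0.
  move=> /unit_discP /hp hz; apply/eqP => /(congr1 (@complex.Re R)).
  by rewrite !ReImE /=; lra.
have dg z : normc z < 1 -> derivable (fun z => (h z - h 0) * (h z + c)^-1) z 1.
  move=> z1; have dhz := dh z (proj2 (unit_discP _) z1).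
  apply: (derivable_mul (derivable_sub dhz (@derivable_const _ (h 0) z))).
  apply: (@derivable_inv _ (fun z => h z + c) z); first exact: den.
  exact: (derivable_add dhz (@derivable_const _ c z)).
have bg z : normc z < 1 -> normc ((h z - h 0) * (h z + c)^-1) <= 1.
  move=> z1; rewrite normcM normcV ler_pdivrMr ?normc_gt0 ?den // mul1r.
  rewrite -(@ler_pXn2r _ 2) ?nnegrE ?normc_ge0 // -subr_ge0.
  have -> : normc (h z + c) ^+ 2 - normc (h z - h 0) ^+ 2 = 4 * (Re (h z) * Re (h 0)).
    by rewrite !normc_sqr !ReImE /=; ring.
  by rewrite mulr_ge0 // mulr_ge0 // ltW //; apply: hp; apply/unit_discP.
have g0 : (h 0 - h 0) * (h 0 + c)^-1 = 0 by rewrite subrr mul0r.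
have := @schwarz R (fun z => (h z - h 0) * (h z + c)^-1) dg bg g0 _ (normc_th s0).
rewrite normcM normcV ler_pdivrMr ?normc_gt0 ?den ?normc_th //.
by rewrite normc_cr ger0_norm ?th_ge0.
Qed.

End Discs.

(** * Chains of discs: convexity, lower bounds, cutting *)

Section Chains.
Variables (R : realType) (d : nat).
Local Notation V := 'rV[Cx R]_d.
Implicit Types (Om : set V) (p q x v w : V) (s t l : R).

(** The index counts discs and serves the induction of [ch_conv]. Unlike in [disc_chain], the empty
    chain is allowed. *)
Inductive seg_chain Om : nat -> V -> V -> R -> Prop :=
| seg_nil p : Om p -> seg_chain Om 0 p p 0
| seg_cons n p q r s l : seg Om p q s -> seg_chain Om n q r l ->
    seg_chain Om n.+1 p r (s + l).

(* p and q are joined by a chain of discs of total length l. *)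
Definition ch Om p q l := exists n, seg_chain Om n p q l.

Lemma ch_ind_seg Om (P : V -> V -> R -> Prop) :
  (forall p, Om p -> P p p 0) ->
  (forall p q r s l, seg Om p q s -> ch Om q r l -> P q r l -> P p r (s + l)) ->
  forall p q l, ch Om p q l -> P p q l.
Proof.
move=> P0 PS p q l [n h]; elim: h => [{}p|m {}p {}q r s {}l sg c IH]; first exact: P0.
by apply: PS sg _ IH; exists m.
Qed.

Lemma ch_refl Om p : Om p -> ch Om p p 0.
Proof. by move=> Op; exists 0%N; constructor. Qed.

Lemma ch_cons Om p q r s l : seg Om p q s -> ch Om q r l -> ch Om p r (s + l).
Proof. by move=> sg [n c]; exists n.+1; econstructor; eauto. Qed.

Lemma ch_seg Om p q s : seg Om p q s -> ch Om p q s.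
Proof.
move=> sg; rewrite -[s]addr0; apply: (ch_cons sg); apply: ch_refl.
by have [] := seg_in sg.
Qed.

Lemma ch_cat Om p q r s l : ch Om p q s -> ch Om q r l -> ch Om p r (s + l).
Proof.
move=> c; move: r l; elim/ch_ind_seg : c => [{}p Op r l|{}p {}q r {}s l sg c IH r' l' c'].
  by rewrite add0r.
by rewrite -addrA; apply: ch_cons sg _; apply: IH.
Qed.

Lemma ch_in Om p q l : ch Om p q l -> Om p /\ Om q.
Proof.
elim/ch_ind_seg => [//|{}p {}q r s {}l sg _ [_ Or]].
by split=> //; have [] := seg_in sg.
Qed.

Lemma ch_ge0 Om p q l : ch Om p q l -> 0 <= l.
Proof. by elim/ch_ind_seg => // {}p {}q r s {}l [s0 _] _ l0; exact: addr_ge0. Qed.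

Lemma ch_sym Om p q l : ch Om p q l -> ch Om q p l.
Proof.
elim/ch_ind_seg => [{}p Op|{}p {}q r s {}l sg _ IH]; first exact: ch_refl.
by rewrite addrC; apply: ch_cat IH _; apply: ch_seg; exact: seg_sym.
Qed.

(** A constant disc can be given any length, so a chain can be padded at its end. *)
Lemma ch_mono Om p q s l : ch Om p q s -> s <= l -> ch Om p q l.
Proof.
move=> c sl; have -> : l = s + (l - s) by ring.
apply: (ch_cat c); apply: ch_seg; apply: seg_const; first by rewrite subr_ge0.
by have [] := ch_in c.
Qed.

Lemma seg_split Om p q s t : 0 <= s -> 0 <= t -> seg Om p q (s + t) ->
  exists2 w, seg Om p w s & seg Om w q t.
Proof.
move=> s0 t0 sg; have [g [g0 gs hg]] := seg_path sg; exists (g s).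
  have := hg 0 s (lexx 0) s0; rewrite g0 subr0; apply; lra.
have := hg s (s + t) s0; rewrite gs (_ : s + t - s = t); last by ring.
by apply; lra.
Qed.

Lemma seg0 Om p q : seg Om p q 0 -> p = q.
Proof. by move=> [_ [psi [_ <- <-]]]; rewrite th0. Qed.

Lemma ch0 Om p q l : ch Om p q l -> l = 0 -> p = q.
Proof.
elim/ch_ind_seg => // {}p {}q r s {}l sg c IH sl.
have s0 : 0 <= s by case: sg.
have l0 := ch_ge0 c.
have s00 : s = 0 by lra.
by move: sg; rewrite s00 => /seg0 ->; apply: IH; lra.
Qed.

Lemma seg_chain_inv Om n p r l : seg_chain Om n p r l -> l != 0 ->
  exists m q s l', [/\ n = m.+1, l = s + l', seg Om p q s & seg_chain Om m q r l'].
Proof.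
case=> [q _|m {}p q {}r s l' sg c _]; first by rewrite eqxx.
by exists m, q, s, l'.
Qed.

(** Chains of equal total length are combined piecewise: the longer of the two first discs is cut to
    the length of the shorter, the pieces are combined by [seg_conv], and the rest has fewer discs
    in all because one first disc is used up. *)
Lemma ch_conv Om t p q p' q' l : convexS Om -> 0 <= t -> t <= 1 ->
  ch Om p q l -> ch Om p' q' l ->
  ch Om (cr (1 - t) *: p + cr t *: p') (cr (1 - t) *: q + cr t *: q') l.
Proof.
move=> cO t0 t1 [n c] [m c'].
have [k] := ubnP (n + m)%N; elim: k => // k IH in n m p q p' q' l c c' *.
move=> nmk; have [l0|ln0] := eqVneq l 0.
  have := ch0 (ex_intro _ n c) l0; have := ch0 (ex_intro _ m c') l0 => e1 e2.
  have [Op _] := ch_in (ex_intro _ n c); have [Op' _] := ch_in (ex_intro _ m c').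
  by rewrite l0 -e1 -e2; apply: ch_refl; apply: cO.
have [n' [w1 [s1 [l1 [en el1 sg1 c1]]]]] := seg_chain_inv c ln0.
have [m' [w2 [s2 [l2 [em el2 sg2 c2]]]]] := seg_chain_inv c' ln0.
have l10 := ch_ge0 (ex_intro _ _ c1).
have s10 : 0 <= s1 by case: sg1.
have l20 := ch_ge0 (ex_intro _ _ c2).
have s20 : 0 <= s2 by case: sg2.
have [s12|s21] := leP s1 s2.
  have s12' : 0 <= s2 - s1 by lra.
  move: sg2; rewrite (_ : s2 = s1 + (s2 - s1)); last by ring.
  move=> /(seg_split s10 s12')[w sga sgb].
  rewrite el1; apply: (ch_cons (seg_conv cO t0 t1 sg1 sga)).
  have e1 : l1 = (s2 - s1) + l2 by lra.
  apply: (IH n' m'.+1) => //; first by rewrite e1; apply: (seg_cons sgb).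
  by move: nmk; rewrite en em addSn ltnS.
have s21' : 0 <= s1 - s2 by lra.
move: sg1; rewrite (_ : s1 = s2 + (s1 - s2)); last by ring.
move=> /(seg_split s20 s21')[w sga sgb].
rewrite el2; apply: (ch_cons (seg_conv cO t0 t1 sga sg2)).
have e1 : l2 = (s1 - s2) + l1 by lra.
apply: (IH n'.+1 m') => //; first by rewrite e1; apply: (seg_cons sgb).
by move: nmk; rewrite en em addnS ltnS.
Qed.

(** Replacing the conjugate in [half_plane_disc] by the triangle inequality leaves moduli only, a
    form that telescopes along chains. *)
Lemma hdot_seg_bound Om (c : Cx R) w p q s :
  (forall v, Om v -> 0 < Re (c + hdot v w)) -> seg Om p q s ->
  normc (c + hdot q w - (c + hdot p w)) <= th s * (normc (c + hdot q w) + normc (c + hdot p w)).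
Proof.
move=> hp [s0 [psi [[dpsi psiO] <- <-]]].
have dh z : unit_disc z -> derivable (fun z => c + hdot (psi z) w) z 1.
  move=> z1; exact: (derivable_add (@derivable_const _ c z) (@derivable_hdot _ _ psi w z (dpsi z z1))).
have hh z : unit_disc z -> 0 < Re (c + hdot (psi z) w) by move=> z1; exact: hp (psiO z z1).
apply: le_trans (@half_plane_disc R (fun z => c + hdot (psi z) w) s s0 dh hh) _.
rewrite ler_wpM2l ?th_ge0 //; apply: le_trans (normcD _ _) _.
by rewrite normc_conj.
Qed.

(** A disc of length s multiplies the modulus by at most (1 + th s) / (1 - th s) = expR (2 * s). *)
Lemma ch_hdot_log Om (c : Cx R) w p q l :
  (forall v, Om v -> 0 < Re (c + hdot v w)) -> ch Om p q l ->
  normc (c + hdot q w) <= expR (2 * l) * normc (c + hdot p w).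
Proof.
move=> hp; elim/ch_ind_seg => [{}p Op|{}p {}q r s {}l sg _ IH].
  by rewrite mulr0 expR0 mul1r.
apply: le_trans IH _; rewrite mulrDr expRD mulrAC [leRHS]mulrC ler_pM2l ?expR_gt0 //.
have h1 := hdot_seg_bound hp sg; have h2 := normcB (c + hdot q w) (c + hdot p w).
have t1 := th_lt1 s; rewrite -th_ratio mulrAC ler_pdivlMr ?subr_gt0 //; lra.
Qed.

(** For each disc of the chain, the functional tested is the pairing with the displacement w = q - p
    itself, so that its increment is |w|^2. *)
Lemma ch_enorm Om (M : R) p q l : 0 < M -> (forall v, Om v -> enorm v <= M) ->
  ch Om p q l -> enorm (q - p) <= 16 * M * l.
Proof.
move=> M0 OM; elim/ch_ind_seg => [{}p Op|{}p {}q r s {}l sg _ IH].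
  by rewrite subrr enorm0 mulr0.
apply: le_trans (enorm_tri r q p) _; rewrite addrC mulrDr lerD //.
set w := q - p; have s0 : 0 <= s by case: sg.
have [w0|wn0] := eqVneq (enorm w) 0; first by rewrite w0 !mulr_ge0 // ltW.
have wp : 0 < enorm w by rewrite lt_neqAle eq_sym wn0 enorm_ge0.
have MW : 0 < M * enorm w by rewrite mulr_gt0.
(* The real part of the pairing is at least - M |w| on the domain; twice that amount makes the
   shifted real part strictly positive. *)
pose c : Cx R := cr (2 * (M * enorm w)).
have hv v : Om v -> `|rdot v w| <= M * enorm w /\ normc (hdot v w) <= 2 * (M * enorm w).
  move=> /OM vM; have h : enorm v * enorm w <= M * enorm w by rewrite ler_pM2r.
  split; first exact: le_trans (rdot_le v w) h.
  by apply: le_trans (normc_hdot v w) _; rewrite ler_pM2l.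
have pos v : Om v -> 0 < Re (c + hdot v w).
  by move=> /hv[]; rewrite ReD /= ler_norml; lra.
have bd v : Om v -> normc (c + hdot v w) <= 4 * (M * enorm w).
  move=> /hv[_ h]; apply: le_trans (normcD _ _) _.
  by rewrite normc_cr ger0_norm; lra.
have [Op Oq] := seg_in sg.
have := hdot_seg_bound pos sg.
have -> : c + hdot q w - (c + hdot p w) = cr (enorm w ^+ 2).
  by rewrite -hdotvv hdotBl; ring.
rewrite normc_cr ger0_norm ?sqr_ge0 // => h.
have t2 := th_le s0; have t0 := th_ge0 s0.
have b1 := bd _ Oq; have b2 := bd _ Op.
have : th s * (normc (c + hdot q w) + normc (c + hdot p w)) <= 2 * s * (8 * (M * enorm w)).
  by apply: ler_pM => //; [rewrite addr_ge0 ?normc_ge0 | lra].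
move=> /(le_trans h); rewrite expr2.
have -> : 2 * s * (8 * (M * enorm w)) = 16 * M * s * enorm w by ring.
by rewrite ler_pM2r.
Qed.

Lemma lipschitz_ivt (f : R -> R) s (K c : R) : 0 <= s -> 0 <= K ->
  (forall t u, 0 <= t -> t <= u -> u <= s -> `|f u - f t| <= K * (u - t)) ->
  f 0 <= c -> c <= f s -> exists t, [/\ 0 <= t, t <= s & f t = c].
Proof.
move=> s0 K0 fK f0c cfs.
pose cl t := Num.max 0 (Num.min s t).
have cl0 t : 0 <= cl t by rewrite le_max lexx.
have cls t : cl t <= s by rewrite ge_max s0 ge_min lexx.
have clid t : 0 <= t -> t <= s -> cl t = t by move=> t0 ts; rewrite /cl min_r // max_r.
have clm t u : t <= u -> cl t <= cl u /\ cl u - cl t <= u - t.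
  by move=> tu; rewrite /cl /Num.max /Num.min; do !case: ifPn; rewrite -?leNgt; lra.
have lip t u : t <= u -> `|f (cl u) - f (cl t)| <= K * (u - t).
  move=> tu; have [h1 h2] := clm t u tu; apply: le_trans (fK _ _ (cl0 t) h1 (cls u)) _.
  exact: ler_wpM2l.
have cont : {within `[0, s], continuous (f \o cl)}.
  apply: continuous_subspaceT => x; apply/(@cvgrPdist_lt _ _ _ _ (nbhs_filter x)) => e e0.
  apply/nbhs_ballP; exists (e / (K + 1)); first by rewrite /= divr_gt0 // ltr_wpDl.
  move=> y; rewrite -ball_normE /ball_ /= ltr_pdivlMr ?ltr_wpDl // => xy.
  have [yx|xy'] := leP y x.
    apply: le_lt_trans (lip _ _ yx) _; move: xy; rewrite ger0_norm ?subr_ge0 //; lra.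
  have := lip _ _ (ltW xy'); rewrite distrC; move: xy; rewrite ltr0_norm ?subr_lt0 //; lra.
have /(IVT s0 cont)[t] : Num.min ((f \o cl) 0) ((f \o cl) s) <= c <= Num.max ((f \o cl) 0) ((f \o cl) s).
  by rewrite /= !clid // ge_min le_max f0c cfs orbT.
rewrite in_itv /= => /andP[t0 ts] ft; exists t; split=> //.
by rewrite -ft clid.
Qed.

(** By [ch_enorm], h is Lipschitz along the path of each disc, so the intermediate value theorem
    applies on the first disc whose end exceeds c. The two parts have exactly the total length l. *)
Lemma ch_cut Om (M : R) (h : V -> R) (K c : R) p q l : 0 < M -> (forall v, Om v -> enorm v <= M) ->
  0 <= K -> (forall v w, Om v -> Om w -> `|h w - h v| <= K * enorm (w - v)) ->
  h p <= c -> c <= h q -> ch Om p q l ->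
  exists z l1 l2, [/\ Om z, h z = c, ch Om p z l1, ch Om z q l2 & l1 + l2 = l].
Proof.
move=> M0 OM K0 hK hp hq chpq; move: hp hq.
elim/ch_ind_seg : chpq => [{}p Op hp hq|{}p w {}q s {}l sg cwq IH hp hq].
  exists p, 0, 0; split=> //; try exact: ch_refl; last by rewrite addr0.
  by apply/eqP; rewrite eq_le hp hq.
have [hw|hw] := leP (h w) c.
  have [z [l1 [l2 [Oz hz c1 c2 e]]]] := IH hw hq.
  exists z, (s + l1), l2; split=> //; last by rewrite -addrA e.
  exact: ch_cons sg c1.
have [g [g0 gs hg]] := seg_path sg; have s0 : 0 <= s by case: sg.
have gO t : 0 <= t -> t <= s -> Om (g t).
  by move=> t0 ts; have [] := seg_in (hg 0 t (lexx 0) t0 ts).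
have [||||t [t0 ts ht]] := @lipschitz_ivt (h \o g) s (K * (16 * M)) c s0.
- by rewrite !mulr_ge0 // ltW.
- move=> t u t0 tu us /=; have t1 := le_trans tu us; have u0 := le_trans t0 tu.
  apply: le_trans (hK _ _ (gO _ t0 t1) (gO _ u0 us)) _.
  by rewrite -mulrA ler_wpM2l //; apply: (ch_enorm M0 OM); apply: ch_seg; exact: hg.
- by rewrite /= g0.
- by rewrite /= gs ltW.
exists (g t), t, ((s - t) + l); split=> //; last by ring.
- exact: gO.
- by have := ch_seg (hg 0 t (lexx 0) t0 ts); rewrite g0 subr0.
- by apply: ch_cons cwq; have := hg t s t0 ts (lexx s); rewrite gs.
Qed.

(** The straight segment is divided into n + 1 steps. By convexity a ball of radius r about each
    division point lies in the domain, and a disc of length 1 covers r * th 1 in it. *)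
Lemma ch_exists Om (r : R) (n : nat) p q : convexS Om -> 0 < r ->
  (forall y, enorm (y - p) < r -> Om y) -> (forall y, enorm (y - q) < r -> Om y) ->
  enorm (q - p) <= n.+1%:R * (r * th 1) -> ch Om p q n.+1%:R.
Proof.
move=> cO r0 hp hq pq; set N : R := n.+1%:R in pq *.
have N0 : 0 < N by rewrite ltr0n.
pose x (i : nat) := p + cr (i%:R / N) *: (q - p).
have xb i : (i <= n.+1)%N -> forall y, enorm (y - x i) < r -> Om y.
  move=> iN y yr; set t : R := i%:R / N; have t0 : 0 <= t by rewrite divr_ge0 // ler0n.
  have t1 : t <= 1 by rewrite ler_pdivrMr // mul1r ler_nat.
  have -> : y = cr (1 - t) *: (p + (y - x i)) + cr t *: (q + (y - x i)).
    apply/rowP => j; rewrite !mxE -/t crD crN cr1; ring.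
  by apply: cO => //; [apply: hp | apply: hq]; rewrite addrAC subrr add0r.
have step i : (i < n.+1)%N -> seg Om (x i) (x i.+1) 1.
  move=> iN; have -> : x i.+1 = x i + cr N^-1 *: (q - p).
    by rewrite /x -addrA -scalerDl -crD; congr (_ + cr _ *: _); rewrite -[i.+1%:R]natr1 mulrDl mul1r.
  apply: (@seg_ball _ _ Om (x i) _ r 1 r0 ler01 (xb i (ltnW iN))).
  by rewrite enormZ normc_cr gtr0_norm ?invr_gt0 // mulrC ler_pdivrMr // mulrC.
have main i : (i <= n.+1)%N -> ch Om p (x i) i%:R.
  elim: i => [_|i IH iN].
    rewrite /x mul0r cr0 scale0r addr0; apply: ch_refl; apply: hp.
    by rewrite subrr enorm0.
  by rewrite -natr1; apply: (ch_cat (IH (ltnW iN))); apply: ch_seg; exact: step.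
by have := main n.+1 (leqnn _); rewrite /x divff ?gt_eqF // cr1 scale1r addrC subrK.
Qed.

End Chains.

(** * The real-valued distance, compactness of its balls, and shrinking maps *)

Section KobayashiDistance.
Variables (R : realType) (d : nat) (Om : set 'rV[Cx R]_d) (M : R).
Local Notation V := 'rV[Cx R]_d.
Implicit Types (p q x v w : V) (s t l : R).
Hypothesis M0 : 0 < M.
Hypothesis OM : forall v, Om v -> enorm v <= M.
Hypothesis cO : convexS Om.
Hypothesis oO : forall x, Om x -> exists2 r : R, 0 < r & forall y, enorm (y - x) < r -> Om y.

Definition Kd p q : R := inf [set l | ch Om p q l].

Lemma ch_ex p q : Om p -> Om q -> exists l, ch Om p q l.
Proof.
move=> Op Oq; have [r1 r10 h1] := oO Op; have [r2 r20 h2] := oO Oq.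
pose r := Num.min r1 r2; have r0 : 0 < r by rewrite lt_min r10.
have rt : 0 < r * th 1 by rewrite mulr_gt0 // th_gt0.
exists (Num.bound (enorm (q - p) / (r * th 1))).+1%:R.
apply: (@ch_exists _ _ Om r) => //.
- by move=> y; rewrite lt_min => /andP[/h1].
- by move=> y; rewrite lt_min => /andP[_ /h2].
rewrite -ler_pdivrMr //; apply: ltW.
apply: lt_le_trans (archi_boundP _) _; first by rewrite divr_ge0 ?enorm_ge0 // ltW.
by rewrite ler_nat.
Qed.

Lemma Kd_le p q l : ch Om p q l -> Kd p q <= l.
Proof. by move=> c; apply: ge_inf => //; exists 0 => k; exact: ch_ge0. Qed.

Lemma Kd_ge p q a : Om p -> Om q -> (forall l, ch Om p q l -> a <= l) -> a <= Kd p q.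
Proof. by move=> Op Oq h; apply: lb_le_inf; [exact: ch_ex | move=> l; exact: h]. Qed.

Lemma Kd_lt p q l : Om p -> Om q -> Kd p q < l -> ch Om p q l.
Proof.
move=> Op Oq h.
have [k c kl] := inf_lt (ch_ex Op Oq) h.
exact: ch_mono c (ltW kl).
Qed.

Lemma Kd_ge0 p q : Om p -> Om q -> 0 <= Kd p q.
Proof. by move=> Op Oq; apply: Kd_ge => // l; exact: ch_ge0. Qed.

Lemma Kd_refl p : Om p -> Kd p p = 0.
Proof.
by move=> Op; apply/eqP; rewrite eq_le Kd_ge0 // andbT; apply: Kd_le; exact: ch_refl.
Qed.

Lemma Kd_sym p q : Kd p q = Kd q p.
Proof.
by rewrite /Kd; congr inf; apply/seteqP; split=> l /=; exact: ch_sym.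
Qed.

Lemma Kd_tri q p r : Om p -> Om q -> Om r -> Kd p r <= Kd p q + Kd q r.
Proof.
move=> Op Oq Or; apply/ler_addgt0Pr => e e0.
have h1 : ch Om p q (Kd p q + e / 2) by apply: Kd_lt => //; lra.
have h2 : ch Om q r (Kd q r + e / 2) by apply: Kd_lt => //; lra.
by apply: le_trans (Kd_le (ch_cat h1 h2)) _; lra.
Qed.

Lemma Kd_conv t p q p' q' a : 0 <= t -> t <= 1 -> Om p -> Om q -> Om p' -> Om q' ->
  Kd p q <= a -> Kd p' q' <= a ->
  Kd (cr (1 - t) *: p + cr t *: p') (cr (1 - t) *: q + cr t *: q') <= a.
Proof.
move=> t0 t1 Op Oq Op' Oq' h1 h2; apply/ler_addgt0Pr => e e0.
by apply: Kd_le; apply: ch_conv => //; apply: Kd_lt => //; lra.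
Qed.

Lemma Kd_enorm p q : Om p -> Om q -> enorm (q - p) <= 16 * M * Kd p q.
Proof.
move=> Op Oq; have M16 : 0 < 16 * M by rewrite mulr_gt0.
rewrite -ler_pdivrMl //; apply: Kd_ge => // l c; rewrite ler_pdivrMl //.
exact: ch_enorm c.
Qed.

Lemma Kd_near p e : Om p -> 0 < e ->
  exists2 r : R, 0 < r & forall y, enorm (y - p) < r -> Om y /\ Kd p y <= e.
Proof.
move=> Op e0; have [r r0 hr] := oO Op; have te := th_gt0 e0.
exists (Num.min r (r * th e)); first by rewrite lt_min r0 mulr_gt0.
move=> y; rewrite lt_min => /andP[y1 y2]; split; first exact: hr.
apply: Kd_le; apply: ch_seg; have -> : y = p + (y - p) by rewrite addrC subrK.
exact: (seg_ball r0 (ltW e0) hr (ltW y2)).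
Qed.

Lemma ch_disc_chain p q l : ch Om p q l -> disc_chain Om p q l.
Proof.
elim/ch_ind_seg => [{}p Op|{}p {}q r s {}l sg c IH].
  (* [disc_chain] has no empty chain, so a constant disc of length 0 stands in for it. *)
  have -> : 0 = poincare (0 : Cx R) 0.
    by rewrite /poincare subrr mul0r normc0 addr0 subr0 divr1 ln1 mulr0.
  apply: (@chain_one _ _ Om (fun _ => p)); first exact: analytic_disc_const.
    by apply/unit_discP; rewrite normc0.
  by apply/unit_discP; rewrite normc0.
have [phi [a [b [dphi a1 b1 [pa qb <-]]]]] := disc_of_seg sg.
by rewrite -pa; apply: chain_cons => //; rewrite qb.
Qed.

Lemma disc_chain_ch p q l : disc_chain Om p q l -> ch Om p q l.
Proof.
elim=> [phi a b dphi a1 b1|phi a b r k dphi a1 b1 _ IH].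
  by apply: ch_seg; exact: seg_of_disc.
by apply: ch_cons IH; exact: seg_of_disc.
Qed.

Lemma kobayashiE p q : Om p -> Om q -> kobayashi Om p q = (Kd p q)%:E.
Proof.
move=> Op Oq; rewrite /kobayashi /Kd -ereal_inf_EFin; last exact: ch_ex.
  by congr ereal_inf; congr image; apply/seteqP; split=> l; [exact: disc_chain_ch | exact: ch_disc_chain].
by exists 0 => l; exact: ch_ge0.
Qed.

Definition shrink t o p := cr (1 - t) *: p + cr t *: o.

(* The disc [(1 - t) psi + t o] is traversed faster: the room around o absorbs the
   difference between psi (th s) and psi (th (c * s)). *)
Lemma seg_shrink t o c p q s (r : R) : 0 < t -> t < 1 -> Om o -> 0 < r ->
  (forall y, enorm (y - o) < r -> Om y) ->
  2^-1 <= c -> c <= 1 -> 64 * M * (1 - c) <= r * t -> s <= 2^-1 -> seg Om p q s ->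
  seg Om (shrink t o p) (shrink t o q) (c * s).
Proof.
move=> t0 t1 Oo r0 hr c2 c1 hc s2 sg.
have s0 : 0 <= s by case: sg.
have [Op Oq] := seg_in sg.
have [s00|sn0] := eqVneq s 0.
  move: sg; rewrite s00 mulr0 => /seg0 <-; apply: seg_const => //.
  by apply: cO => //; exact: ltW.
have sp : 0 < s by rewrite lt_neqAle eq_sym sn0.
have cp : 0 < c by lra.
have csp : 0 < c * s by rewrite mulr_gt0.
have css : c * s <= s by rewrite ger_pMl.
have := sg; move=> [_ [psi [dpsi' p0 pq]]]; have [dpsi psiO] := dpsi'.
pose b := th (c * s); have bp : 0 < b by exact: th_gt0.
pose w := q - psi (cr b).
have wle : enorm w <= 16 * M * (s - c * s).
  rewrite /w -pq; apply: (ch_enorm M0 OM); apply: ch_seg.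
  exact: (disc_seg dpsi' (ltW csp) css).
(* Chosen so that at the parameter b the term t b v supplies (1 - t) (q - psi b), exactly what the
   slower disc still misses. *)
pose v := cr ((1 - t) / t / b) *: w.
have vr : enorm v <= r.
  rewrite enormZ normc_cr ger0_norm; last by apply: divr_ge0; [apply: divr_ge0; lra | exact: ltW].
  have bs : c * s / 2 <= b by apply: (th_ge (ltW csp)); lra.
  have bs4 : s / 4 <= b.
    by apply: le_trans bs; have := ler_wpM2r s0 c2; lra.
  rewrite mulrAC ler_pdivrMr // mulrAC ler_pdivrMr //.
  (* The hypothesis on 64 M (1 - c) enters here: the missing part is at most 16 M (1 - c) s, while b
     is at least s / 4. *)
  have h1 : (1 - t) * enorm w <= enorm w by apply: ler_piMl; [exact: enorm_ge0 | lra].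
  have h2 : 16 * M * (s - c * s) <= r * t * (s / 4).
    have := ler_wpM2r s0 hc; lra.
  have h3 : r * t * (s / 4) <= r * t * b by rewrite ler_pM2l // mulr_gt0.
  lra.
split; first exact: ltW.
exists (fun z => cr (1 - t) *: psi z + cr t *: (o + z *: v)); split.
- split=> z z1.
    apply: (derivable_addV (@derivable_scaleV _ _ (cr (1 - t)) _ _ (dpsi z z1))).
    apply: (@derivable_scaleV _ _ (cr t) (fun z => o + z *: v)).
    exact: (derivable_addV (@derivable_constV _ _ o z) (@derivable_scal _ _ _ v _ (@derivable_var _ z))).
  apply: cO; [exact: ltW|exact: ltW|exact: psiO|].
  apply: hr; rewrite addrAC subrr add0r enormZ.
  have z1' := (unit_discP z).1 z1.
  apply: (@le_lt_trans _ _ (normc z * r)); first by rewrite ler_wpM2l ?normc_ge0.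
  by rewrite gtr_pMl.
- by rewrite p0 scale0r addr0.
- rewrite -/b /v scalerDr !scalerA -!crM.
  have -> : t * b * ((1 - t) / t / b) = 1 - t by field; rewrite !gt_eqF.
  by rewrite /w scalerBr /shrink addrCA [_ + (_ - _)]addrC subrK addrC.
Qed.

Lemma shrink_in t o p : 0 <= t -> t <= 1 -> Om o -> Om p -> Om (shrink t o p).
Proof. by move=> t0 t1 Oo Op; apply: cO. Qed.

(** The factor c depends on t and on the size of a ball about o, but not on p and q. *)
Lemma shrink_contraction t o : 0 < t -> t < 1 -> Om o ->
  exists c, [/\ 0 <= c, c < 1 & forall p q, Om p -> Om q ->
    Kd (shrink t o p) (shrink t o q) <= c * Kd p q].
Proof.
move=> t0 t1 Oo; have [r r0 hr] := oO Oo.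
pose k := Num.min 2^-1 (r * t / (64 * M)).
have k0 : 0 < k by rewrite lt_min invr_gt0 ltr0n divr_gt0 ?mulr_gt0.
have k2 : k <= 2^-1 by rewrite ge_min lexx.
pose c := 1 - k; have c2 : 2^-1 <= c by rewrite /c; lra.
have c1 : c <= 1 by rewrite /c; lra.
have cg0 : 0 < c by lra.
have hc : 64 * M * (1 - c) <= r * t.
  rewrite /c opprB addrC subrK mulrC -ler_pdivlMr ?mulr_gt0 //.
  by rewrite ge_min lexx orbT.
(* [seg_shrink] needs s <= 1/2, where th s is comparable to s; longer discs are cut into pieces of
   length at most 1/2. *)
have segc n p q s : s <= n%:R * 2^-1 -> seg Om p q s -> ch Om (shrink t o p) (shrink t o q) (c * s).
  elim: n p s => [|n IH] p s sn sg.
    have s0 : 0 <= s by case: sg.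
    by apply: ch_seg; apply: (seg_shrink t0 t1 Oo r0 hr) => //; lra.
  have [s2|s2] := leP s 2^-1.
    by apply: ch_seg; apply: (seg_shrink t0 t1 Oo r0 hr).
  move: sg; rewrite (_ : s = 2^-1 + (s - 2^-1)); last by ring.
  move=> /seg_split[||w sg1 sg2]; [lra|lra|].
  rewrite mulrDr; apply: (@ch_cat _ _ _ _ (shrink t o w)).
    by apply: ch_seg; apply: (seg_shrink t0 t1 Oo r0 hr).
  by apply: IH sg2; move: sn; rewrite -natr1; lra.
have chc p q l : ch Om p q l -> ch Om (shrink t o p) (shrink t o q) (c * l).
  elim/ch_ind_seg => [{}p Op|{}p {}q u s {}l sg _ IH].
    by rewrite mulr0; apply: ch_refl; apply: shrink_in => //; exact: ltW.
  rewrite mulrDr; apply: ch_cat IH; have s0 : 0 <= s by case: sg.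
  apply: (segc (Num.bound (2 * s))) sg.
  have : 2 * s < (Num.bound (2 * s))%:R by apply: archi_boundP; lra.
  lra.
exists c; split; [lra|by rewrite /c; lra|] => p q Op Oq.
rewrite -ler_pdivrMl //; apply: Kd_ge => // l /chc /Kd_le.
by rewrite ler_pdivrMl.
Qed.

Hypothesis sup_hyp : forall x, closure Om x -> ~ Om x ->
  exists w, forall v, Om v -> rdot (v - x) w < 0.

(** A limit x on the boundary is excluded by its supporting functional w: [ch_hdot_log] bounds |<y -
    x, w>| from below for all y in the ball. Limits inside the domain follow from continuity of
    K. *)
Lemma Kd_ball_closed o s : Om o -> closed [set x | Om x /\ Kd o x <= s].
Proof.
move=> Oo x /closure_enormP clx.
have [Ox|nOx] := pselect (Om x).
  split=> //; apply/ler_addgt0Pr => e e0; have [r r0 hr] := Kd_near Ox e0.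
  have [y [Oy oy] /hr[_ xy]] := clx r r0.
  by apply: le_trans (Kd_tri Oo Oy Ox) _; rewrite (Kd_sym y x); lra.
exfalso; have clOx : closure Om x.
  by apply/closure_enormP => e e0; have [y [Oy _] yx] := clx e e0; exists y.
have [w hw] := sup_hyp clOx nOx.
pose c : Cx R := hdot x w.
have cE v : c + hdot v (- w) = - hdot (v - x) w by rewrite hdotNr hdotBl opprB.
have pos v : Om v -> 0 < Re (c + hdot v (- w)).
  by move=> /hw h; rewrite cE ReN Re_hdot oppr_gt0.
pose N := normc (c + hdot o (- w)).
have N0 : 0 < N.
  rewrite /N normc_gt0; apply/eqP => h; have := pos o Oo; rewrite h /=.
  by rewrite ltxx.
have w0 := enorm_ge0 w.
pose E := expR (2 * (s + 1)) * (2 * (enorm w + 1)).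
have E0 : 0 < E by rewrite mulr_gt0 ?expR_gt0 //; lra.
have [y [Oy oy] yx] := clx (N / E) (divr_gt0 N0 E0).
have chy : ch Om y o (s + 1) by apply: ch_sym; apply: Kd_lt => //; lra.
have := ch_hdot_log pos chy; rewrite -/N leNgt => /negP; apply.
rewrite cE normcN.
move: yx; rewrite ltr_pdivlMr // => yx; apply: le_lt_trans yx.
rewrite /E mulrCA ler_pM2l ?expR_gt0 //; apply: le_trans (normc_hdot _ _) _.
by have := enorm_ge0 (y - x); nra.
Qed.

Lemma Kd_seq_cluster (u : nat -> V) o s : Om o -> (forall n, Om (u n) /\ Kd o (u n) <= s) ->
  exists x, [/\ Om x, Kd o x <= s &
    forall (e : R) (N : nat), 0 < e -> exists2 n, (N <= n)%N & Kd x (u n) <= e].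
Proof.
move=> Oo hu; have [x clx] := bounded_seq_cluster (fun n => OM (proj1 (hu n))).
have [Ox ox] : Om x /\ Kd o x <= s.
  have := @Kd_ball_closed o s Oo x; apply; apply/closure_enormP => e e0.
  by have [n _ h] := clx e 0%N e0; exists (u n).
exists x; split=> // e N e0; have [r r0 hr] := Kd_near Ox e0.
by have [n Nn /hr[_ h]] := clx r N r0; exists n.
Qed.

Lemma Kd_eq0 p q : Om p -> Om q -> Kd p q <= 0 -> q = p.
Proof.
move=> Op Oq h; apply/eqP; rewrite -subr_eq0 -enorm_eq0 eq_le enorm_ge0 andbT.
by apply: le_trans (Kd_enorm Op Oq) _; rewrite pmulr_rle0 // mulr_gt0.
Qed.

(** * Dynamics of 1-Lipschitz self-maps: a fixed point or escape *)

Variable f : V -> V.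
Hypothesis fO : forall p, Om p -> Om (f p).
Hypothesis fK : forall p q, Om p -> Om q -> Kd (f p) (f q) <= Kd p q.

Lemma iter_in p k : Om p -> Om (iter k f p).
Proof. by move=> Op; elim: k => //= k; exact: fO. Qed.

Lemma iter_contr p q k : Om p -> Om q -> Kd (iter k f p) (iter k f q) <= Kd p q.
Proof.
move=> Op Oq; elim: k => //= k; apply: le_trans; apply: fK; exact: iter_in.
Qed.

(* Edelstein: on a compact set a contraction [F] fixes any minimizer of [Kd x (F x)]. *)
Lemma contraction_fixed (C : set V) (F : V -> V) (c : R) : C !=set0 -> closed C ->
  (forall x, C x -> Om x) -> (forall x, C x -> C (F x)) -> 0 <= c -> c < 1 ->
  (forall x y, Om x -> Om y -> Kd (F x) (F y) <= c * Kd x y) ->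
  exists2 x, C x & F x = x.
Proof.
move=> C0 clC CO CF c0 c1 hF.
have [|||x Cx hx] := @min_attained R d C M (fun x => Kd x (F x)) C0 _ clC.
- by move=> x Cx; exact/OM/CO.
- by move=> x Cx; apply: Kd_ge0; apply: CO => //; exact: CF.
- move=> x Cx e e0; have Ox := CO _ Cx; have e2 : 0 < e / 2 by lra.
  have [r r0 hr] := Kd_near Ox e2; exists r => // y Cy /hr[Oy xy].
  have OFx := CO _ (CF _ Cx); have OFy := CO _ (CF _ Cy).
  have h1 := Kd_tri Ox Oy OFx; have h2 := Kd_tri Oy OFy OFx.
  have h3 := hF _ _ Oy Ox; rewrite (Kd_sym y x) in h3.
  have h4 : c * Kd x y <= Kd x y by apply: ler_piMl; [exact: Kd_ge0 | exact: ltW].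
  lra.
exists x => //; have Ox := CO _ Cx; have OFx := CO _ (CF _ Cx).
apply: Kd_eq0 => //; have k0 := Kd_ge0 Ox OFx.
have := le_trans (hx _ (CF _ Cx)) (hF _ _ Ox OFx).
have [//|kp] := leP (Kd x (F x)) 0.
by rewrite -subr_le0 -[X in X - _]mul1r -mulrBl pmulr_lle0 //; lra.
Qed.

Theorem bounded_orbit_fixed p B : Om p -> (forall k, Kd p (iter k f p) <= B) ->
  exists q, Om q /\ f q = q.
Proof.
move=> Op hB; pose a k := iter k f p.
have aO k : Om (a k) by exact: iter_in.
(* The points whose upper limit of distances to the orbit is at most B. The starting point p belongs
   to it, which makes it nonempty and stable under shrinking towards p. *)
pose C := [set x | Om x /\ forall e, 0 < e -> exists N, forall k, (N <= k)%N -> Kd x (a k) <= B + e].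
have Cp : C p.
  by split=> // e e0; exists 0%N => k _; apply: le_trans (hB k) _; rewrite lerDl ltW.
have CO x : C x -> Om x by case.
have Cball x : C x -> Om x /\ Kd p x <= B + (B + 1).
  move=> [Ox /(_ 1 ltr01)[N hN]]; split=> //.
  apply: le_trans (Kd_tri Op (aO N) Ox) _; rewrite (Kd_sym (a N)); apply: lerD => //.
    exact: hB.
  exact: hN.
have clC : closed C.
  move=> x clx; have [Ox _] : Om x /\ Kd p x <= B + (B + 1).
    by have := @Kd_ball_closed p (B + (B + 1)) Op x; apply; apply: closureS clx => y /Cball.
  split=> // e e0; have e2 : 0 < e / 2 by lra.
  have [r r0 hr] := Kd_near Ox e2.
  have [y [Oy Cy] /hr[_ xy]] := (closure_enormP _ _).1 clx r r0.
  have [N hN] := Cy _ e2; exists N => k /hN h.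
  by apply: le_trans (Kd_tri Ox Oy (aO k)) _; lra.
have Cf x : C x -> C (f x).
  move=> [Ox hx]; split; first exact: fO.
  move=> e /hx[N hN]; exists N.+1 => -[//|k] Nk.
  exact: le_trans (fK Ox (aO k)) (hN k Nk).
(* Convexity of K is applied to the pairs (x, a k) and (p, a k), whose second entries combine to a k
   again. *)
have Cs t x : 0 <= t -> t <= 1 -> C x -> C (shrink t p x).
  move=> t0 t1 [Ox hx]; split; first exact: shrink_in.
  move=> e e0; have [N hN] := hx e e0; exists N => k Nk.
  have -> : a k = cr (1 - t) *: a k + cr t *: a k by rewrite -scalerDl -crD subrK cr1 scale1r.
  apply: Kd_conv => //; first exact: hN.
  by apply: le_trans (hB k) _; lra.
(* The factor 1 / (n + 2) lies strictly between 0 and 1 for every n and tends to 0. *)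
have fix_n (n : nat) : exists x, C x /\ shrink n.+2%:R^-1 p (f x) = x.
  have t0 : 0 < n.+2%:R^-1 :> R by rewrite invr_gt0 ltr0n.
  have t1 : n.+2%:R^-1 < 1 :> R by rewrite invf_lt1 ?ltr0n // ltr1n.
  have [c [c0 c1 hc]] := shrink_contraction t0 t1 Op.
  have [||x Cx Fx] := @contraction_fixed C (fun x => shrink n.+2%:R^-1 p (f x)) c (ex_intro _ p Cp) clC CO _ c0 c1.
  - by move=> x Cx; apply: Cs; [exact: ltW|exact: ltW|exact: Cf].
  - move=> x y Ox Oy; apply: le_trans (hc _ _ (fO Ox) (fO Oy)) _.
    by rewrite ler_wpM2l // fK.
  by exists x.
have [z hz] := choice fix_n.
have [w [Ow _ clw]] := Kd_seq_cluster Op (fun n => Cball _ (proj1 (hz n))).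
exists w; split=> //; apply/eqP; rewrite -subr_eq0 -enorm_eq0 eq_le enorm_ge0 andbT.
apply/ler_addgt0Pr => e e0; rewrite add0r.
(* 34 = 16 + 16 + 2, from the three distances [d1], [d2] and [d3] between f w and w. *)
pose K := 34 * M; have K0 : 0 < K by rewrite mulr_gt0.
have eK : 0 < e / K by rewrite divr_gt0.
have [n] := clw (e / K) (Num.bound (e / K)^-1) eK.
set N := Num.bound _ => Nn h.
have nK : n.+2%:R^-1 <= e / K.
  rewrite invf_ple ?posrE ?ltr0n //; apply: ltW.
  apply: lt_le_trans (archi_boundP _) _; first by rewrite invr_ge0 ltW.
  by rewrite ler_nat; apply: leq_trans Nn _; rewrite (leq_trans (leqnSn _)) // leqnSn.
have [[Oz _] Fz] := hz n; have Ofz := fO Oz.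
have d1 : enorm (f w - f (z n)) <= 16 * M * (e / K).
  apply: le_trans (Kd_enorm Ofz (fO Ow)) _; rewrite ler_wpM2l ?mulr_ge0 ?(ltW M0) //.
  by apply: le_trans (fK Oz Ow) _; rewrite Kd_sym.
have d2 : enorm (z n - w) <= 16 * M * (e / K).
  by apply: le_trans (Kd_enorm Ow Oz) _; rewrite ler_wpM2l ?mulr_ge0 ?(ltW M0).
have d3 : enorm (f (z n) - z n) <= 2 * M * (e / K).
  have -> : f (z n) - z n = cr n.+2%:R^-1 *: (f (z n) - p).
    by rewrite -{2}Fz /shrink; apply/rowP => j; rewrite !mxE crD crN cr1; ring.
  rewrite enormZ normc_cr ger0_norm ?invr_ge0 ?ler0n // mulrC ler_pM ?enorm_ge0 ?invr_ge0 ?ler0n //.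
  apply: le_trans (enormD _ _) _; rewrite enormN.
  by have := OM Ofz; have := OM Op; lra.
have := enorm_tri (f w) (f (z n)) w; have := enorm_tri (f (z n)) (z n) w.
have : e = 34 * M * (e / K) by rewrite mulrC mulfVK // gt_eqF.
move: d1 d2 d3; set q := e / K; lra.
Qed.

(* Return times to the unit ball have bounded gaps: two nearby points of the orbit in that
   ball return to it after the same time. *)
Lemma recurrent_bounded y : Om y ->
  (forall e (N : nat), 0 < e -> exists2 m, (N <= m)%N & Kd y (iter m f y) <= e) ->
  exists B, forall k, Kd y (iter k f y) <= B.
Proof.
move=> Oy rec; pose b k := iter k f y; have bO k : Om (b k) by exact: iter_in.
pose S n := Kd y (b n) <= 1.
have [N gap] : exists N, forall n, S n -> exists m, [/\ (0 < m)%N, (m <= N)%N & S (n + m)%N].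
  apply: contrapT => /forallNP hN.
  have /choice[u hu] (N : nat) : exists n, S n /\ forall m, (0 < m)%N -> (m <= N)%N -> ~ S (n + m)%N.
    have /existsNP[n /not_implyP[Sn hn]] := hN N; exists n; split=> // m m0 mN Sm.
    by apply: hn; exists m.
  have [w [Ow _ clw]] := Kd_seq_cluster (u := fun N => b (u N)) Oy (fun N => conj (bO _) (proj1 (hu N))).
  have q0 : 0 < 4^-1 :> R by rewrite invr_gt0.
  have h0 : 0 < 2^-1 :> R by rewrite invr_gt0.
  have [N0 _ wN0] := clw _ 0%N q0.
  have [m' m'N ym'] := rec 2^-1 (u N0).+1 h0.
  pose m := (m' - u N0)%N; have m0 : (0 < m)%N by rewrite subn_gt0.
  have em : (m + u N0 = m')%N by rewrite subnK // ltnW.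
  (* The orbit points at times u N0 and u N are both within 1/4 of w, and the first is within 1/2 of
     y after m steps. The second is then within 1/2 + 1/2 of y, although m <= N lies in its gap. *)
  have [N mN wN] := clw _ m q0.
  apply: (proj2 (hu N) m m0 mN); rewrite /S.
  have e1 : b (u N + m)%N = iter m f (b (u N)) by rewrite addnC /b iterD.
  have e2 : b m' = iter m f (b (u N0)) by rewrite -em /b iterD.
  have := Kd_tri Oy (bO m') (bO (u N + m)%N).
  have := iter_contr m (bO (u N0)) (bO (u N)); rewrite -e1 -e2.
  have := Kd_tri (bO (u N0)) Ow (bO (u N)); rewrite (Kd_sym _ w).
  by move: wN0 wN ym'; rewrite -/(b m'); lra.
(* A return to the unit ball occurs within the last N times before k, so K y (b k) is at most 1 plus
   N steps of size D. *)
have back k : exists n, [/\ (n <= k)%N, (k <= n + N)%N & S n].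
  elim: k => [|k [n [nk kn Sn]]].
    by exists 0%N; split=> //; rewrite /S Kd_refl.
  have [kN|kN] := leqP k.+1 (n + N); first by exists n; split=> //; exact: leqW.
  have [m [m0 mN Sm]] := gap _ Sn; exists (n + m)%N; split=> //.
    by apply: leq_trans (ltnW kN); rewrite leq_add2l.
  by rewrite addnAC -addn1 leq_add.
pose D := Kd y (f y); have D0 : 0 <= D by apply: Kd_ge0 => //; exact: fO.
have walk n j : Kd (b n) (b (n + j)%N) <= j%:R * D.
  elim: j => [|j IH]; first by rewrite addn0 mul0r Kd_refl.
  apply: le_trans (Kd_tri (bO n) (bO (n + j)%N) (bO _)) _.
  rewrite -natr1 mulrDl mul1r lerD // addnS.
  have := iter_contr (n + j) Oy (fO Oy); rewrite -iterSr; exact.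
exists (1 + N%:R * D) => k; have [n [nk kn Sn]] := back k.
apply: le_trans (Kd_tri Oy (bO n) (bO k)) _; apply: lerD => //.
rewrite -{1}(subnKC nk); apply: le_trans (walk _ _) _.
by rewrite ler_wpM2r // ler_nat leq_subLR.
Qed.

(** A cluster point y of returning iterates is recurrent: two iterates of p near y, at times n j <=
    n i, show that f^(n i - n j) moves y little. *)
Theorem fixed_or_escape : (exists q, Om q /\ f q = q) \/
  forall p B, Om p -> exists N, forall n, (N <= n)%N -> B < Kd p (iter n f p).
Proof.
have [[p [B [Op hB]]]|none] := pselect (exists p B, Om p /\ forall N, exists n, (N <= n)%N /\ Kd p (iter n f p) <= B).
  left; have [n hn] := choice hB; pose u j := iter (n j) f p.
  have [y [Oy _ cly]] := Kd_seq_cluster (u := u) Op (fun j => conj (iter_in _ Op) (proj2 (hn j))).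
  have [|B' hB'] := @recurrent_bounded y Oy; last exact: bounded_orbit_fixed Oy hB'.
  move=> e N e0; have e2 : 0 < e / 2 by lra.
  have [j _ yj] := cly _ 0%N e2; have [i ij yi] := cly _ (n j + N)%N e2.
  have nij : (n j + N <= n i)%N by apply: leq_trans ij _; have [] := hn i.
  have nji : (n j <= n i)%N by apply: leq_trans nij; exact: leq_addr.
  exists (n i - n j)%N; first by rewrite leq_subRL // .
  set m := (n i - n j)%N.
  have e1 : u i = iter m f (u j) by rewrite /u -iterD subnK.
  have := iter_contr m Oy (iter_in (n j) Op); rewrite -/(u j) -e1.
  have := Kd_tri Oy (iter_in (n i) Op) (iter_in m Oy); rewrite -/(u i).
  by rewrite (Kd_sym (u i)); lra.
right=> p B Op; apply: contrapT => /forallNP hN; apply: none; exists p, B; split=> // N.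
have /existsNP[n /not_implyP[Nn /negP]] := hN N; rewrite -leNgt => h.
by exists n.
Qed.

End KobayashiDistance.

(** * Geometry of the boundary *)

Section NormalApproach.
Variables (R : realType) (d : nat) (Om : set 'rV[Cx R]_d).
Local Notation V := 'rV[Cx R]_d.
Variables (r0 A alpha : R) (x n : V).
Hypothesis A0 : 0 <= A.
Hypothesis alpha0 : 0 < alpha.
Hypothesis n1 : enorm n = 1.
Hypothesis inner : forall v, enorm v < r0 ->
  rdot v n < - (A * (enorm v * enorm v `^ alpha)) -> Om (x + v).

Lemma cross_ratio (X Y : R) : 0 < X -> 0 < Y ->
  (1 + (X - Y) / (X + Y)) / (1 - (X - Y) / (X + Y)) = X / Y.
Proof. by move=> X0 Y0; field; rewrite !gt_eqF //; lra. Qed.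

Definition normal_pt (t : R) : V := x + cr (- t) *: n.

Lemma seg_normal_double (b r s : R) : 0 < b -> s = A * (2 * r * (2 * r) `^ alpha) ->
  2 * r <= r0 -> s <= b / 2 -> s + 2 * b <= r -> 0 <= s ->
  seg Om (normal_pt (2 * b)) (normal_pt b)
    (2^-1 * ln ((2 * b - s) * (2 * r - s - b) / ((b - s) * (2 * r - s - 2 * b)))).
Proof.
move=> b0 sE rr0 sb sr s0.
have r_gt0 : 0 < r by lra.
have rs : 0 < r - s by lra.
pose phi (z : Cx R) := x + (- (cr r + cr (r - s) * z)) *: n.
have dphi : analytic_disc Om phi.
  split=> z /unit_discP z1.
    apply: (derivable_addV (@derivable_constV _ _ x z)).
    apply: (@derivable_scal _ _ (fun z => - (cr r + cr (r - s) * z)) n z).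
    have h : derivable (fun z => cr r + cr (r - s) * z) z 1.
      exact: (derivable_add (@derivable_const _ (cr r) z) (derivable_mul (@derivable_const _ (cr (r - s)) z) (@derivable_var _ z))).
    exact: (@derivableN _ _ _ _ _ _ h).
  apply: inner; rewrite enormZ normcN n1 mulr1.
    apply: le_lt_trans (normcD _ _) _; rewrite normcM !normc_cr !gtr0_norm //.
    by have : (r - s) * normc z < r - s; [rewrite gtr_pMr | lra].
  set m := normc _; have m2r : m <= 2 * r.
    apply: le_trans (normcD _ _) _; rewrite normcM !normc_cr !gtr0_norm //.
    by have : (r - s) * normc z < r - s; [rewrite gtr_pMr | lra].
  have m0 : 0 <= m by exact: normc_ge0.
  have hs : A * (m * m `^ alpha) <= s.
    rewrite sE ler_wpM2l // ler_pM ?powR_ge0 //.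
    by apply: ge0_ler_powR; rewrite ?nnegrE // ?mulr_ge0 // ltW.
  have nn : hdot n n = 1 by rewrite hdotvv n1 expr1n.
  rewrite -Re_hdot hdotZl nn mulr1 !ReImE /= mul0r subr0.
  have := Re_le_normc z; rewrite ler_norml => /andP[zl _].
  have : (r - s) * (- 1) < (r - s) * Re z by rewrite ltr_pM2l //; lra.
  lra.
have aP (t : R) : - (r - s) < t - r -> t - r < r - s ->
   unit_disc (cr ((t - r) / (r - s))) /\ phi (cr ((t - r) / (r - s))) = normal_pt t.
  move=> t1 t2; split.
    apply/unit_discP; rewrite normc_cr ltr_norml.
    by rewrite ltr_pdivrMr // ltr_pdivlMr // mulN1r mul1r t1.
  rewrite /phi /normal_pt; congr (_ + _ *: _); rewrite -crM -crD -crN; congr cr.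
  by field; rewrite gt_eqF.
have [u1 e1] : unit_disc (cr ((2 * b - r) / (r - s))) /\ phi (cr ((2 * b - r) / (r - s))) = normal_pt (2 * b).
  by apply: aP; lra.
have [u2 e2] : unit_disc (cr ((b - r) / (r - s))) /\ phi (cr ((b - r) / (r - s))) = normal_pt b.
  by apply: aP; lra.
have := seg_of_disc dphi u1 u2; rewrite e1 e2; congr (seg _ _ _ _).
set a := (2 * b - r) / (r - s) in u1 *; set c := (b - r) / (r - s) in u2 *.
rewrite /poincare.
rewrite conj_cr.
rewrite -[1 in X in normc X]cr1 -crM -!crN -!crD -crV -crM normc_cr.
have den1 : 0 < b - s by lra.
have den2 : 0 < 2 * r - s - 2 * b by lra.
have num1 : 0 < 2 * b - s by lra.
have num2 : 0 < 2 * r - s - b by lra.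
have nd : 1 + - (c * a) = ((2 * b - s) * (2 * r - s - b) + (b - s) * (2 * r - s - 2 * b)) / (2 * (r - s) ^+ 2).
  by rewrite /a /c; field; rewrite gt_eqF.
have nn0 : 0 < (2 * b - s) * (2 * r - s - b) + (b - s) * (2 * r - s - 2 * b).
  exact: (addr_gt0 (mulr_gt0 num1 num2) (mulr_gt0 den1 den2)).
have tE : (a + - c) / (1 + - (c * a)) =
   ((2 * b - s) * (2 * r - s - b) - (b - s) * (2 * r - s - 2 * b)) /
   ((2 * b - s) * (2 * r - s - b) + (b - s) * (2 * r - s - 2 * b)).
  by rewrite nd /a /c; field; rewrite !gt_eqF.
have tp : 0 <= (a + - c) / (1 + - (c * a)).
  rewrite tE; apply: divr_ge0; last exact: ltW.
  rewrite subr_ge0; apply: ler_pM; lra.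
rewrite (ger0_norm tp) tE -(cross_ratio (mulr_gt0 num1 num2) (mulr_gt0 den1 den2)).
by [].
Qed.

(** The cross ratio is at most 2 (1 + s/b) (1 + b/r). The factor 2 is what a half-plane would give;
    s/b measures the roughness of the boundary and b/r the finite size of the disc. *)
Lemma ch_normal_double (b r s : R) : 0 < b -> s = A * (2 * r * (2 * r) `^ alpha) ->
  2 * r <= r0 -> s <= b / 2 -> s + 2 * b <= r -> 0 <= s ->
  ch Om (normal_pt (2 * b)) (normal_pt b) (2^-1 * (ln 2 + (s / b + b / r))).
Proof.
move=> b0 sE rr0 sb sr s0.
apply: ch_mono (ch_seg (seg_normal_double b0 sE rr0 sb sr s0)) _.
have r_gt0 : 0 < r by lra.
have den1 : 0 < b - s by lra.
have den2 : 0 < 2 * r - s - 2 * b by lra.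
have sb0 : 0 <= s / b by rewrite divr_ge0 // ltW.
have br0 : 0 < b / r by rewrite divr_gt0.
have p1 : 0 < 1 + s / b by lra.
have p2 : 0 < 1 + b / r by lra.
rewrite ler_pM2l ?invr_gt0 //.
have -> : (2 * b - s) * (2 * r - s - b) / ((b - s) * (2 * r - s - 2 * b)) =
  ((2 * b - s) / (b - s)) * ((2 * r - s - b) / (2 * r - s - 2 * b)).
  by field; rewrite !gt_eqF.
apply: (@le_trans _ _ (ln (2 * (1 + s / b) * (1 + b / r)))).
  rewrite ler_ln ?posrE; last 2 first.
  - by rewrite mulr_gt0 // divr_gt0 //; lra.
  - by rewrite !mulr_gt0.
  apply: ler_pM.
  - by apply: divr_ge0; lra.
  - by apply: divr_ge0; lra.
  - rewrite ler_pdivrMr //.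
    have -> : 2 * (1 + s / b) * (b - s) = 2 * b - s + (s / b) * (b - 2 * s) by field; rewrite gt_eqF.
    by rewrite lerDl mulr_ge0 //; lra.
  - rewrite ler_pdivrMr //.
    have -> : (1 + b / r) * (2 * r - s - 2 * b) = 2 * r - s - b + (b / r) * (r - s - 2 * b) by field; rewrite gt_eqF.
    by rewrite lerDl mulr_ge0 //; lra.
rewrite !lnM ?posrE ?mulr_gt0 // -addrA lerD2l lerD // le_ln1Dx //; lra.
Qed.

End NormalApproach.

(** * The sharp logarithmic upper bound along normals *)

Section NormalUpperBound.
Variables (R : realType) (d : nat) (Om : set 'rV[Cx R]_d).
Local Notation V := 'rV[Cx R]_d.
Variables (r0 A alpha : R).
Hypothesis r00 : 0 < r0.
Hypothesis A0 : 0 <= A.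
Hypothesis alpha0 : 0 < alpha.
Hypothesis alpha1 : alpha <= 1.

(* The radius of the k-th disc is proportional to [(2 mu) ^- k]: the errors at step k are
   of order [(((2 mu)^-1) `^ alpha / mu) ^+ k] and [mu ^+ k], so both series must converge. *)
Lemma dyadic_ratios : exists mu e : R, [/\ 0 < mu, (2 * mu)^-1 <= 1, mu <= e, e < 1 &
  ((2 * mu)^-1) `^ alpha / mu <= e].
Proof.
have al0 := alpha0; have al1 := alpha1.
have pw (y : R) : 0 < 2 `^ y :> R by exact: powR_gt0.
have pw1 (y : R) : y < 0 -> 2 `^ y < 1 :> R.
  move=> y0; rewrite /powR ifF; last by apply/negbTE; rewrite gt_eqF.
  by rewrite -[ltRHS]expR0 ltr_expR nmulr_rlt0 //; apply: ln_gt0; lra.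
(* With this mu the second ratio is 2 to the power (alpha/4 - 1) alpha + alpha/4, which is at most -
   alpha/2 because alpha <= 1. *)
pose mu : R := 2 `^ (- (alpha / 4)); pose la := ((2 * mu)^-1) `^ alpha / mu.
have p2 (y z : R) : 2 `^ (y + z) = 2 `^ y * 2 `^ z :> R by rewrite powRD // pnatr_eq0 implybT.
have mu1 : mu < 1 by apply: pw1; rewrite oppr_lt0 divr_gt0.
have rE : (2 * mu)^-1 = 2 `^ (alpha / 4 - 1).
  have -> : 2 * mu = 2 `^ (1 - alpha / 4) by rewrite p2 powRr1.
  by rewrite -powRN opprB.
have laE : la = 2 `^ ((alpha / 4 - 1) * alpha + alpha / 4).
  by rewrite /la rE -powRrM /mu powRN invrK p2.
have la1 : la < 1.
  rewrite laE; apply: pw1.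
  have aa : alpha * alpha <= alpha by apply: ler_piMr => //; exact: ltW.
  have : (alpha / 4 - 1) * alpha + alpha / 4 <= - (alpha / 2) by lra.
  by move/le_lt_trans; apply; rewrite oppr_lt0 divr_gt0.
exists mu, (Num.max mu la); split.
- exact: pw.
- by rewrite rE ltW // pw1 //; lra.
- by rewrite le_max lexx.
- by rewrite gt_max mu1.
- by rewrite le_max lexx orbT.
Qed.

Lemma ch_normal_dyadic (x n : V) mu e b0 k : enorm n = 1 ->
  (forall v, enorm v < r0 -> rdot v n < - (A * (enorm v * enorm v `^ alpha)) -> Om (x + v)) ->
  0 < mu -> (2 * mu)^-1 <= 1 -> mu <= e -> e < 1 -> ((2 * mu)^-1) `^ alpha / mu <= e ->
  0 < b0 -> 8 * b0 <= r0 -> 8 * A * (8 * b0) `^ alpha <= 2^-1 ->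
  Om (normal_pt x n b0) ->
  ch Om (normal_pt x n b0) (normal_pt x n (b0 / 2 ^+ k))
    (2^-1 * (k%:R * ln 2 + (1 - e ^+ k) / (1 - e))).
Proof.
move=> n1 inner mu0 rho1 mue e1 lae b00 br0 Asmall Ob.
have A00 := A0; have e0 : 0 < e by lra.
elim: k => [|k IH].
  rewrite expr0 divr1 mul0r subrr mul0r addr0 mulr0; exact: ch_refl.
set rho := (2 * mu)^-1 in rho1 lae.
have rho0 : 0 < rho by rewrite invr_gt0 mulr_gt0.
pose b := b0 / 2 ^+ k.+1; pose m := mu ^+ k.+1.
have p20 : 0 < 2 ^+ k.+1 :> R by rewrite exprn_gt0.
have b_gt0 : 0 < b by rewrite divr_gt0.
have m_gt0 : 0 < m by rewrite exprn_gt0.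
have b2 : b0 / 2 ^+ k = 2 * b by rewrite /b exprS invfM; field; rewrite gt_eqF // exprn_gt0.
(* Then b/r = m/4, and 2r is 8 b0 times a power of (2 mu)^-1. Each of s/b and b/r is at most e^(k+1)
   / 2, so the errors sum to a geometric series. *)
pose r := 4 * b / m; pose s := A * (2 * r * (2 * r) `^ alpha).
have r2 : 2 * r = 8 * b0 * rho ^+ k.+1.
  rewrite /r /b /m /rho exprVn exprMn; field.
  by rewrite !gt_eqF.
have r2pow : (2 * r) `^ alpha = (8 * b0) `^ alpha * (rho `^ alpha) ^+ k.+1.
  rewrite r2 powRM ?exprn_ge0 ?(ltW rho0) ?mulr_ge0 ?(ltW b00) //; congr (_ * _).
  elim: (k.+1) => [|j IHj]; first by rewrite !expr0 powR1.
  by rewrite !exprS powRM ?exprn_ge0 ?(ltW rho0) // IHj.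
have sb : s / b <= e ^+ k.+1 / 2.
  have -> : s / b = 8 * A * (8 * b0) `^ alpha * (rho `^ alpha / mu) ^+ k.+1.
    rewrite /s r2pow /r exprMn exprVn -/m; field; by rewrite !gt_eqF.
  have h0 : 0 <= rho `^ alpha / mu by rewrite divr_ge0 ?powR_ge0 // ltW.
  rewrite [leRHS]mulrC; apply: ler_pM => //.
  - by rewrite !mulr_ge0 ?powR_ge0.
  - by rewrite exprn_ge0.
  - by apply: lerXn2r => //; rewrite nnegrE ltW.
have br : b / r <= e ^+ k.+1 / 2.
  have -> : b / r = m / 4 by rewrite /r; field; rewrite !gt_eqF.
  have : m <= e ^+ k.+1 by apply: lerXn2r => //; rewrite nnegrE ltW.
  have := exprn_gt0 k.+1 e0; lra.
have ek1 : e ^+ k.+1 <= 1 by rewrite exprn_ile1 // ltW.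
have r_gt0 : 0 < r by rewrite divr_gt0 // mulr_gt0.
have s0 : 0 <= s.
  by apply: mulr_ge0 => //; apply: mulr_ge0; [rewrite mulr_ge0 // ltW | exact: powR_ge0].
have sb2 : s <= b / 2.
  have : s / b <= 2^-1 by lra.
  by rewrite ler_pdivrMr // mulrC.
have m1 : m <= 1 by rewrite exprn_ile1 ?ltW //; lra.
have br4 : 4 * b <= r.
  by rewrite /r ler_pdivlMr // ler_piMr // mulr_ge0 // ltW.
have rr0 : 2 * r <= r0.
  apply: le_trans br0; rewrite r2; apply: ler_piMr; first by rewrite mulr_ge0 // ltW.
  by rewrite exprn_ile1 // ltW.
have sr : s + 2 * b <= r by lra.
have step := ch_normal_double A0 alpha0 n1 inner b_gt0 (erefl s) rr0 sb2 sr s0.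
rewrite -b2 in step; apply: ch_mono (ch_cat IH step) _.
rewrite -mulrDr ler_pM2l ?invr_gt0 // -natr1 mulrDl mul1r.
have -> : (1 - e ^+ k.+1) / (1 - e) = (1 - e ^+ k) / (1 - e) + e ^+ k.
  by rewrite exprS; field; rewrite gt_eqF //; lra.
have : e ^+ k.+1 <= e ^+ k by rewrite exprS ler_piMl // ?exprn_ge0 // ltW.
lra.
Qed.

Lemma dyadic_scale (t t0 : R) : 0 < t -> t <= t0 -> exists k, t0 / 2 < t * 2 ^+ k /\ t * 2 ^+ k <= t0.
Proof.
move=> tp tt0.
have ex : exists k : nat, t0 / 2 < t * 2 ^+ k.
  exists (Num.bound (t0 / t)).
  have : t0 / t < 2 ^+ Num.bound (t0 / t).
    apply: lt_trans (archi_boundP _) _; first by rewrite divr_ge0 ?ltW //; lra.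
    by rewrite -natrX ltr_nat ltn_expl.
  by rewrite ltr_pdivrMr // mulrC; lra.
case: (ex_minnP ex) => k tk kmin; exists k; split=> //.
case: k tk kmin => [|k] tk kmin; first by rewrite expr0 mulr1.
have [h|h] := leP (t * 2 ^+ k) (t0 / 2); first by rewrite exprS; lra.
by have := kmin _ h; rewrite ltnn.
Qed.

Variable M : R.
Hypothesis OM : forall v, Om v -> enorm v <= M.
Hypothesis cO : convexS Om.
Hypothesis oO : forall x, Om x -> exists2 r : R, 0 < r & forall y, enorm (y - x) < r -> Om y.

(** The constants t0 and C are found before x and n: the foot point of p moves with p, and the bound
    is applied at each of these points. *)
Lemma ch_normal_upper o : Om o -> exists t0 C : R, 0 < t0 /\ forall x n, enorm n = 1 ->
  (forall v, enorm v < r0 -> rdot v n < - (A * (enorm v * enorm v `^ alpha)) -> Om (x + v)) ->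
  forall t, 0 < t -> t <= t0 -> ch Om (normal_pt x n t) o (2^-1 * ln t^-1 + C).
Proof.
have A00 := A0; have r000 := r00; have al0 := alpha0.
move=> Oo; have [mu [e [mu0 rho1 mue e1 lae]]] := dyadic_ratios.
have [ro ro0 hro] := oO Oo.
(* Makes the Hoelder error at depth b at most b / 8 and meets the smallness condition of
   [ch_normal_dyadic]; the 1 covers A = 0. *)
pose D := 16 * A + 1; have D0 : 0 < D by rewrite /D; lra.
pose t0 := Num.min (r0 / 8) (D^-1 `^ alpha^-1 / 8).
have D1 : 0 < D^-1 `^ alpha^-1 by apply: powR_gt0; rewrite invr_gt0.
have t00 : 0 < t0 by rewrite lt_min !divr_gt0.
have small b : 0 < b -> b <= t0 -> 8 * b <= r0 /\ (8 * b) `^ alpha <= D^-1.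
  move=> b0; rewrite le_min => /andP[h1 h2]; split; first by lra.
  have -> : D^-1 = (D^-1 `^ alpha^-1) `^ alpha by rewrite -powRrM mulVf ?gt_eqF // powRr1 // invr_ge0 ltW.
  by apply: (ge0_ler_powR (ltW al0)); rewrite ?nnegrE; lra.
(* The dyadic chain ends at a depth b in (t0 / 2, t0], about which a ball of this radius fits.
   Boundedly many discs of length 1 then lead to o. *)
pose dl := t0 / 4; have dl0 : 0 < dl by rewrite divr_gt0.
pose rr := Num.min ro dl; have rr0 : 0 < rr by rewrite lt_min ro0.
have rth : 0 < rr * th 1 by rewrite mulr_gt0 // th_gt0.
have M0 : 0 <= M by apply: le_trans (OM Oo); exact: enorm_ge0.
pose N := Num.bound (2 * M / (rr * th 1)).
exists t0, (2^-1 * (ln t0 + (1 - e)^-1) + N.+1%:R); split=> // x n n1 inner t tp tt0.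
have [k [k1 k2]] := dyadic_scale tp tt0.
set b := t * 2 ^+ k in k1 k2; have b0 : 0 < b by lra.
have [b8 b8a] := small b b0 k2.
have tE : t = b / 2 ^+ k by rewrite /b mulfK // gt_eqF // exprn_gt0.
have ball y : enorm (y - normal_pt x n b) < dl -> Om y.
  move=> yd; have -> : y = x + (y - x) by rewrite addrC subrK.
  have yx : y - x = cr (- b) *: n + (y - normal_pt x n b).
    by rewrite /normal_pt opprD [cr _ *: n + _]addrC addrA subrK.
  have nv : enorm (y - x) <= 2 * b.
    rewrite yx; apply: le_trans (enormD _ _) _; rewrite enormZ n1 mulr1 normc_cr normrN gtr0_norm //.
    by rewrite /dl in yd; lra.
  apply: inner; first by lra.
  have v0 := enorm_ge0 (y - x).
  have h1 : rdot (y - x) n <= - b + dl.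
    rewrite yx rdotDl rdotZl -enorm_sqr n1 expr1n mulr1 lerD2l.
    by apply: le_trans (ler_norm _) _; apply: le_trans (rdot_le _ _) _; rewrite n1 mulr1 ltW.
  have h2 : A * (enorm (y - x) * enorm (y - x) `^ alpha) <= A * (2 * b * D^-1).
    apply: ler_wpM2l => //; apply: ler_pM => //; first exact: powR_ge0.
    apply: (le_trans _ b8a).
    by apply: (ge0_ler_powR (ltW al0)); rewrite ?nnegrE; lra.
  have h3 : A * (2 * b * D^-1) <= b / 8.
    have -> : A * (2 * b * D^-1) = b / 8 * (16 * A / D) by field; rewrite gt_eqF.
    by rewrite ler_piMr ?divr_ge0 ?(ltW b0) // ler_pdivrMr // mul1r /D lerDl.
  by rewrite /dl in h1; lra.
have Ob : Om (normal_pt x n b) by apply: ball; rewrite subrr enorm0.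
have As : 8 * A * (8 * b) `^ alpha <= 2^-1.
  apply: (@le_trans _ _ (8 * A * D^-1)); first by rewrite ler_wpM2l // mulr_ge0.
  by rewrite ler_pdivrMr // /D; lra.
have c1 := ch_normal_dyadic k n1 inner mu0 rho1 mue e1 lae b0 b8 As Ob.
have c2 : ch Om (normal_pt x n b) o N.+1%:R.
  apply: (ch_exists cO rr0).
  - by move=> y; rewrite lt_min => /andP[_ /ball].
  - by move=> y; rewrite lt_min => /andP[/hro].
  rewrite -ler_pdivrMr //; apply: (@le_trans _ _ (2 * M / (rr * th 1))).
    rewrite ler_pM2r ?invr_gt0 //; apply: le_trans (enormD _ _) _; rewrite enormN.
    by have := OM Oo; have := OM Ob; lra.
  apply: ltW; apply: lt_le_trans (archi_boundP _) _; last by rewrite ler_nat.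
  by rewrite divr_ge0 ?mulr_ge0 // ltW.
rewrite -tE in c1; apply: ch_mono (ch_cat (ch_sym c1) c2) _.
rewrite [leRHS]addrA lerD2r -mulrDr ler_pM2l ?invr_gt0 // [leRHS]addrA lerD //.
  have -> : k%:R * ln 2 = ln b - ln t :> R.
    by rewrite /b lnM ?posrE ?exprn_gt0 // lnXn // addrAC subrr add0r mulr_natl.
  have lb : ln b <= ln t0 by rewrite ler_ln ?posrE.
  by rewrite lnV ?posrE //; lra.
rewrite -[leRHS]mul1r ler_pM2r ?invr_gt0 ?subr_gt0 // lerBlDr lerDl exprn_ge0 //.
by apply: le_trans mue; exact: ltW.
Qed.

End NormalUpperBound.

(** * Supporting hyperplanes, uniqueness of normals, and nearest points *)

Section BoundaryGeometry.
Variables (R : realType) (d : nat) (Om : set 'rV[Cx R]_d).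
Local Notation V := 'rV[Cx R]_d.
Implicit Types (x z v w : V) (U : set V) (rho : V -> R) (g : V -> V).
Hypothesis cO : convexS Om.
Hypothesis oO : forall x, Om x -> exists2 r : R, 0 < r & forall y, enorm (y - x) < r -> Om y.

Lemma closure_segment x z t : closure Om x -> Om z -> 0 < t -> t <= 1 ->
  Om (x + cr t *: (z - x)).
Proof.
move=> /closure_enormP clx Oz t0 t1; have [r r0 hr] := oO Oz.
have [y Oy yx] := clx _ (mulr_gt0 t0 r0).
have -> : x + cr t *: (z - x) = cr (1 - t) *: y + cr t *: (z + cr ((1 - t) / t) *: (x - y)).
  rewrite [cr t *: (z + cr _ *: _)]scalerDr scalerA -crM (mulrC t) divfK ?gt_eqF //.
  by apply/rowP => j; rewrite !mxE !crD !crN cr1; ring.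
apply: cO => //; first exact: ltW.
apply: hr; rewrite addrAC subrr add0r enormZ normc_cr ger0_norm; last first.
  by rewrite divr_ge0 ?subr_ge0 // ltW.
rewrite mulrAC ltr_pdivrMr // enormBC (mulrC r); apply: le_lt_trans yx.
by apply: ler_piMl; [exact: enorm_ge0 | lra].
Qed.

Lemma gradient_line rho z w v : has_gradient rho z w -> forall e, 0 < e ->
  exists2 r : R, 0 < r & forall t, `|t| < r ->
    `|rho (z + cr t *: v) - rho z - t * rdot v w| <= e * `|t|.
Proof.
move=> hg e e0; have [r r0 hr] := is_derive_frechet (hg v) e0; exists r => // t /hr.
by rewrite addr0 /rscale -/(cr t) -/(cr 0) cr0 scale0r addr0.
Qed.

Lemma C1_near x U rho g : C1_defining Om x U rho g -> forall z, U z -> C1_defining Om z U rho g.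
Proof. by move=> [oU Ux OU hg gc] z Uz; split. Qed.

Lemma C1_in x U rho g z : C1_defining Om x U rho g -> U z -> (Om z <-> rho z < 0).
Proof.
move=> [_ _ OU _ _] Uz; have := congr1 (fun A : set V => A z) OU; rewrite /setI /=.
by move=> E; split=> [Oz|rz]; [have [] : (rho z < 0 /\ U z) by rewrite -E | have [] : (Om z /\ U z) by rewrite E].
Qed.

(** [has_gradient] gives continuity of rho along lines only, so x is approached along a segment
    ending at a point of the domain. *)
Lemma defining_le0 x U rho g : C1_defining Om x U rho g -> closure Om x -> Om !=set0 -> rho x <= 0.
Proof.
move=> C1 clx [z0 Oz0]; have [oU Ux OU hg gc] := C1.
apply/ler_addgt0Pr => e e0; rewrite add0r.
have [r r0 hr] := gradient_line (z0 - x) (hg x Ux) ltr01.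
have [q q0 hq] := (open_enormP _).1 oU x Ux.
pose L := 1 + `|rdot (z0 - x) (g x)|; have L0 : 0 < L by rewrite ltr_wpDr.
pose E := enorm (z0 - x) + 1; have E0 : 0 < E by rewrite ltr_wpDl ?enorm_ge0.
pose t := Num.min (Num.min 1 (r / 2)) (Num.min (e / L) (q / E / 2)).
have t0 : 0 < t by rewrite !lt_min ltr01 !divr_gt0.
have [t1 tr tL tE] : [/\ t <= 1, t <= r / 2, t <= e / L & t <= q / E / 2].
  by split; rewrite !ge_min lexx ?orbT.
have Ot : Om (x + cr t *: (z0 - x)) by exact: closure_segment.
have Ut : U (x + cr t *: (z0 - x)).
  apply: hq; rewrite addrAC subrr add0r enormZ normc_cr gtr0_norm //.
  apply: (@le_lt_trans _ _ (t * E)); first by rewrite ler_pM2l // /E lerDl.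
  have qE : 0 < q / E by rewrite divr_gt0.
  rewrite -ltr_pdivlMr //; lra.
have := (C1_in C1 Ut).1 Ot; have tr' : t < r by lra.
have := hr t; rewrite gtr0_norm // mul1r => /(_ tr').
rewrite ler_norml => /andP[h2 _] h3; move: tL; rewrite ler_pdivlMr // /L => tL.
have := ler_norm (- rdot (z0 - x) (g x)); rewrite normrN => h4.
have := ler_wpM2l (ltW t0) h4; lra.
Qed.

(** Otherwise z can be pushed along g x to a point z' of the domain with strictly positive pairing.
    Moving from x towards z' then stays in the domain by convexity, yet increases rho from a value
    >= 0. *)
Lemma support x U rho g : C1_defining Om x U rho g -> closure Om x -> ~ Om x ->
  forall z, Om z -> rdot (z - x) (g x) < 0.
Proof.
move=> C1 clx nOx z Oz; have [oU Ux OU hg gc] := C1.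
rewrite ltNge; apply/negP => zx.
have gx0 : g x != 0 by have [] := gc x Ux.
have gg : 0 < rdot (g x) (g x) by rewrite -enorm_sqr exprn_gt0 // enorm_gt0.
have [r r0 hr] := oO Oz.
pose s := r / (2 * enorm (g x)); have gp : 0 < enorm (g x) by rewrite enorm_gt0.
have s0 : 0 < s by rewrite divr_gt0 // mulr_gt0.
pose z' := z + cr s *: g x.
have Oz' : Om z'.
  apply: hr; rewrite addrAC subrr add0r enormZ normc_cr gtr0_norm // /s.
  by rewrite invfM mulrA mulfVK ?gt_eqF //; lra.
pose a := rdot (z' - x) (g x).
have a0 : 0 < a.
  by rewrite /a /z' addrAC rdotDl rdotZl; have := mulr_gt0 s0 gg; lra.
have a2 : 0 < a / 2 by lra.
have [q q0 hq] := gradient_line (z' - x) (hg x Ux) a2.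
have [p p0 hp] := (open_enormP _).1 oU x Ux.
pose E := enorm (z' - x) + 1; have E0 : 0 < E by rewrite ltr_wpDl ?enorm_ge0.
pose t := Num.min (Num.min 1 (q / 2)) (p / E / 2).
have t0 : 0 < t by rewrite !lt_min ltr01 !divr_gt0.
have [t1 tq tE] : [/\ t <= 1, t <= q / 2 & t <= p / E / 2].
  by split; rewrite !ge_min lexx ?orbT.
have Ot : Om (x + cr t *: (z' - x)) by exact: closure_segment.
have Ut : U (x + cr t *: (z' - x)).
  apply: hp; rewrite addrAC subrr add0r enormZ normc_cr gtr0_norm //.
  apply: (@le_lt_trans _ _ (t * E)); first by rewrite ler_pM2l // /E lerDl.
  have qE : 0 < p / E by rewrite divr_gt0.
  rewrite -ltr_pdivlMr //; lra.
have h1 := (C1_in C1 Ut).1 Ot.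
have h2 : 0 <= rho x by rewrite leNgt; apply/negP => /(C1_in C1 Ux).2.
have tq' : t < q by lra.
have := hq t; rewrite gtr0_norm // => /(_ tq'); rewrite -/a ler_norml => /andP[h3 _].
have := mulr_gt0 t0 a0; lra.
Qed.

Lemma inward_direction x U rho g v : C1_defining Om x U rho g -> closure Om x -> Om !=set0 ->
  rdot v (g x) < 0 -> exists2 t : R, 0 < t & Om (x + cr t *: v).
Proof.
move=> C1 clx O0 v0; have [oU Ux OU hg gc] := C1.
have v2 : 0 < - rdot v (g x) / 2 by lra.
have [q q0 hq] := gradient_line v (hg x Ux) v2.
have [p p0 hp] := (open_enormP _).1 oU x Ux.
pose E := enorm v + 1; have E0 : 0 < E by rewrite ltr_wpDl ?enorm_ge0.
pose t := Num.min (q / 2) (p / E / 2).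
have t0 : 0 < t by rewrite !lt_min !divr_gt0.
have [tq tE] : t <= q / 2 /\ t <= p / E / 2 by split; rewrite !ge_min lexx ?orbT.
have Ut : U (x + cr t *: v).
  apply: hp; rewrite addrAC subrr add0r enormZ normc_cr gtr0_norm //.
  apply: (@le_lt_trans _ _ (t * E)); first by rewrite ler_pM2l // /E lerDl.
  have qE : 0 < p / E by rewrite divr_gt0.
  rewrite -ltr_pdivlMr //; lra.
exists t => //; apply: (C1_in C1 Ut).2.
have r0 := defining_le0 C1 clx O0.
have tq' : t < q by lra.
have := hq t; rewrite gtr0_norm // => /(_ tq'); rewrite ler_norml => /andP[_ h3].
have := mulr_gt0 t0 v2; lra.
Qed.

(** Every direction v with <v, g x> < 0 enters the domain, hence has <v, w> < 0. Two half-spaces so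
    nested have proportional normals. *)
Lemma normal_unique x U rho g w : C1_defining Om x U rho g -> closure Om x -> Om !=set0 ->
  (forall z, Om z -> rdot (z - x) w < 0) -> exists2 c, 0 < c & w = cr c *: g x.
Proof.
move=> C1 clx O0 hw; set a := g x.
have a0 : a != 0 by have [_ Ux _ _ gc] := C1; have [] := gc x Ux.
have aa : 0 < rdot a a by rewrite -enorm_sqr exprn_gt0 // enorm_gt0.
have imp v : rdot v a < 0 -> rdot v w < 0.
  move=> /(inward_direction C1 clx O0)[t t0 /hw].
  by rewrite addrAC subrr add0r rdotZl pmulr_rlt0.
pose c := rdot w a / rdot a a.
have c0 : 0 < c.
  rewrite divr_gt0 //; have := imp (- a); rewrite !rdotNl !oppr_lt0 (rdotC w).
  exact.
exists c => //; apply/eqP; rewrite -subr_eq0 -enorm_eq0.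
set u := w - cr c *: a.
have ua : rdot u a = 0 by rewrite rdotBl rdotZl divfK ?gt_eqF // subrr.
have uw : rdot u w = rdot u u.
  have wE : w = u + cr c *: a by rewrite subrK.
  by rewrite [in LHS]wE rdotDr rdotZr ua mulr0 addr0.
clearbody u; rewrite eq_le enorm_ge0 andbT leNgt; apply/negP => up.
have uu : 0 < rdot u u by rewrite -enorm_sqr exprn_gt0.
have wa : 0 < rdot w a by move: c0; rewrite pmulr_lgt0 // invr_gt0.
(* The value for which u - s a is orthogonal to w, while its pairing with a is still negative. *)
pose s := rdot u u / rdot w a; have s0 : 0 < s by rewrite divr_gt0.
have us : rdot (u - cr s *: a) a < 0.
  by rewrite (rdotBl u (cr s *: a)) (rdotZl s a) ua sub0r oppr_lt0 mulr_gt0.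
have := imp _ us; rewrite (rdotBl u (cr s *: a)) (rdotZl s a) uw (rdotC a w).
by rewrite /s divfK ?gt_eqF // subrr ltxx.
Qed.

(** Minimizes the distance to p over the complement of the domain; the given x keeps this set
    nonempty and the minimizer no farther than x. *)
Lemma boundary_nearest x p : closure Om x -> ~ Om x -> Om p ->
  exists2 y, [/\ closure Om y, ~ Om y & enorm (y - p) <= enorm (x - p)] &
    forall z, enorm (z - p) < enorm (y - p) -> Om z.
Proof.
move=> clx nOx Op.
pose A := [set y | ~ Om y /\ enorm (y - p) <= enorm (x - p)].
have [|||||y [nOy yxp] hy] := @min_attained R d A (enorm p + enorm (x - p)) (fun y => enorm (y - p)).
- by exists x.
- by move=> y [_ h]; have := enormB y p; lra.
- move=> y /closure_enormP cly; split.
    move=> /oO[r r0 hr]; have [z [nOz _] zy] := cly r r0.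
    by apply: nOz; exact: hr.
  apply/ler_addgt0Pr => e e0; have [z [_ zp] zy] := cly e e0.
  by have := enorm_tri y z p; rewrite (enormBC y z); lra.
- by move=> y _; exact: enorm_ge0.
- move=> y _ e e0; exists e => // z _ zy.
  by have := enorm_tri y z p; rewrite (enormBC y z); lra.
have nearz z : enorm (z - p) < enorm (y - p) -> Om z.
  move=> zp; apply: contrapT => nOz; have : A z by split=> //; lra.
  by move=> /hy; lra.
exists y; last exact: nearz.
split; [|exact: nOy|exact: yxp].
apply/closure_enormP => e e0.
have yp : 0 < enorm (y - p).
  rewrite enorm_gt0 subr_eq0; apply/eqP => yp; apply: nOy; by rewrite yp.
pose t := Num.min 2^-1 (e / (2 * enorm (y - p))).
have t0 : 0 < t by rewrite lt_min invr_gt0 ltr0n divr_gt0 // mulr_gt0.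
have t1 : t <= 2^-1 by rewrite ge_min lexx.
have te : t <= e / (2 * enorm (y - p)) by rewrite ge_min lexx orbT.
exists (y + cr t *: (p - y)).
  apply: nearz; have -> : y + cr t *: (p - y) - p = cr (1 - t) *: (y - p).
    by apply/rowP => j; rewrite !mxE crD crN cr1; ring.
  by rewrite enormZ normc_cr gtr0_norm ?gtr_pMl //; lra.
rewrite addrAC subrr add0r enormZ normc_cr gtr0_norm // enormBC.
move: te; rewrite ler_pdivlMr ?mulr_gt0 // => te; lra.
Qed.

Lemma rdot_extremal (v n : V) (D : R) : enorm n = 1 -> enorm v = D -> rdot v n <= - D ->
  v = cr (- D) *: n.
Proof.
move=> n1 vD h; have D0 : 0 <= D by rewrite -vD enorm_ge0.
apply/eqP; rewrite crN scaleNr -addr_eq0 -enorm_eq0 -sqrf_eq0 eq_le sqr_ge0 andbT.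
rewrite enorm_sqr rdotDl !(rdotDr v) !rdotZl !rdotZr (rdotC n v) -!enorm_sqr n1 vD.
by have := ler_wpM2l D0 h; lra.
Qed.

(** The ball about p lies on one side of the hyperplane at x and touches it at x, so p - x is the
    equality case of Cauchy-Schwarz. *)
Lemma ball_normal x p w : ~ Om x -> w != 0 -> (forall z, Om z -> rdot (z - x) w < 0) ->
  0 < enorm (x - p) -> (forall z, enorm (z - p) < enorm (x - p) -> Om z) ->
  p = x + cr (- enorm (x - p)) *: (cr (enorm w)^-1 *: w).
Proof.
move=> nOx w0 hw xp hball; set D := enorm (x - p); set n := cr _ *: w.
have wp : 0 < enorm w by rewrite enorm_gt0.
have n1 : enorm n = 1 by rewrite enormZ normc_cr gtr0_norm ?invr_gt0 // mulVf // gt_eqF.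
have hn z : Om z -> rdot (z - x) n < 0.
  by move=> /hw; rewrite rdotZr pmulr_rlt0 // invr_gt0.
have key : rdot (p - x) n <= - D.
  rewrite lerNr; apply/ler_addgt0Pr => e e0.
  pose s := Num.max 0 (D - e); have s0 : 0 <= s by rewrite le_max lexx.
  have sD : s < D by rewrite gt_max xp /=; lra.
  have : Om (p + cr s *: n).
    by apply: hball; rewrite addrAC subrr add0r enormZ n1 mulr1 normc_cr ger0_norm.
  move=> /hn; rewrite addrAC rdotDl rdotZl -enorm_sqr n1 expr1n mulr1.
  have : D - e <= s by rewrite le_max lexx orbT.
  lra.
have vD : enorm (p - x) = D by rewrite enormBC.
by rewrite -(rdot_extremal n1 vD key) addrC subrK.
Qed.

End BoundaryGeometry.

(** * Bounded Gromov product off the complex tangent hyperplane *)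

Section GromovProduct.
Variables (R : realType) (d : nat) (Om : set 'rV[Cx R]_d) (M alpha : R).
Local Notation V := 'rV[Cx R]_d.
Implicit Types (x y z v w : V) (U : set V) (rho : V -> R) (g : V -> V).
Hypothesis M0 : 0 < M.
Hypothesis OM : forall v, Om v -> enorm v <= M.
Hypothesis cO : convexS Om.
Hypothesis oO : forall x, Om x -> exists2 r : R, 0 < r & forall y, enorm (y - x) < r -> Om y.
Hypothesis alpha0 : 0 < alpha.
Hypothesis alpha1 : alpha <= 1.

Definition unit_normal w : V := cr (enorm w)^-1 *: w.

Lemma enorm_unit_normal w : w != 0 -> enorm (unit_normal w) = 1.
Proof.
rewrite -enorm_gt0 => w0; rewrite enormZ normc_cr gtr0_norm ?invr_gt0 // mulVf //.
by rewrite gt_eqF.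
Qed.

Lemma unit_normalZ c w : 0 < c -> unit_normal (cr c *: w) = unit_normal w.
Proof.
move=> c0; have [->|w0] := eqVneq w 0; first by rewrite /unit_normal !scaler0.
have w1 : 0 < enorm w by rewrite enorm_gt0.
rewrite /unit_normal enormZ normc_cr gtr0_norm // scalerA -crM; congr (cr _ *: _).
by field; rewrite !gt_eqF.
Qed.

Lemma unit_normal_dist v w : w != 0 -> v != 0 ->
  enorm (unit_normal v - unit_normal w) <= 2 * (enorm (v - w) / enorm w).
Proof.
rewrite -!enorm_gt0 => w0 v0.
have -> : unit_normal v - unit_normal w =
   cr (enorm w)^-1 *: (v - w) + cr ((enorm v)^-1 - (enorm w)^-1) *: v.
  by apply/rowP => j; rewrite !mxE crD crN; ring.
apply: le_trans (enormD _ _) _; rewrite !enormZ !normc_cr mulr2n mulrDl !mul1r.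
rewrite gtr0_norm ?invr_gt0 // mulrC lerD2l.
have -> : (enorm v)^-1 - (enorm w)^-1 = (enorm w - enorm v) / (enorm w * enorm v).
  by field; rewrite !gt_eqF.
rewrite normrM (gtr0_norm (_ : 0 < (_ * _)^-1)) ?invr_gt0 ?mulr_gt0 // invfM mulrA mulfVK ?gt_eqF //.
rewrite ler_pM2r ?invr_gt0 // ler_norml.
by have := enormB v w; have := enormB w v; rewrite (enormBC w v); lra.
Qed.

Lemma is_derive_line rho y v s w : has_gradient rho (y + cr s *: v) w ->
  is_derive s (1 : R) (fun t => rho (y + cr t *: v)) (rdot v w).
Proof.
move=> hg; have h := hg v.
have -> : (fun t => rho (y + cr t *: v)) =
  (fun t : R => rho (y + cr s *: v + rscale t v)) \o (fun t => t - s).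
  by apply/funext => t /=; rewrite rscaleE -addrA -scalerDl -crD [s + _]addrC subrK.
have k1 : is_derive s (1 : R) (fun t : R => t - s) 1 by exact: is_derive_shift.
rewrite -[rdot v w]mulr1; apply: is_derive1_comp k1.
by rewrite subrr.
Qed.

(** First-order expansion of rho at y with Hoelder error. The constants serve all y near x because
    |g y| stays above |g x| / 2 there. *)
Lemma inner_uniform x U rho g : C1_defining Om x U rho g -> hoelder_on alpha U g ->
  Om !=set0 -> exists r A : R, [/\ 0 < r, 0 <= A & forall y, closure Om y -> enorm (y - x) < r ->
    [/\ U y, g y != 0 & forall v, enorm v < r ->
      rdot v (unit_normal (g y)) < - (A * (enorm v * enorm v `^ alpha)) -> Om (y + v)]].
Proof.
move=> C1 [M' hM'] O0; have [oU Ux OU hg gc] := C1.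
have [p p0 hp] := (open_enormP _).1 oU x Ux.
have [gx0 /continuous_enormP cg] := gc x Ux.
have gp : 0 < enorm (g x) by rewrite enorm_gt0.
have m0 : 0 < enorm (g x) / 2 by lra.
have [q q0 hq] := cg _ m0.
pose m := enorm (g x) / 2; pose A := `|M'| / m.
have A0 : 0 <= A by rewrite divr_ge0 // ltW.
exists (Num.min (p / 2) q), A; split=> //; first by rewrite lt_min q0 divr_gt0.
move=> y cly; rewrite lt_min => /andP[yp yq].
have Uy : U y by apply: hp; lra.
have [gy0 _] := gc y Uy; have gyp : 0 < enorm (g y) by rewrite enorm_gt0.
have my : m <= enorm (g y).
  by have := enormB (g x) (g y); rewrite enormBC; have := hq y yq; rewrite /m; lra.
split=> // v; rewrite lt_min => /andP[vp _] hv.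
have v0 := enorm_ge0 v.
have sv (s : R) : 0 <= s -> s <= 1 -> enorm (cr s *: v) <= enorm v.
  by move=> s0 s1; rewrite enormZ normc_cr ger0_norm //; exact: ler_piMl.
have Us (s : R) : 0 <= s <= 1 -> U (y + cr s *: v).
  move=> /andP[s0 s1]; apply: hp; rewrite addrAC.
  by apply: le_lt_trans (enormD _ _) _; have := sv s s0 s1; lra.
have D1 (s : R) : 0 <= s <= 1 -> is_derive s (1 : R) (fun t => rho (y + cr t *: v)) (rdot v (g (y + cr s *: v))).
  by move=> hs; apply: is_derive_line; exact: hg (Us s hs).
have [c /andP[c0 c1] mv] := mvt_is_derive ltr01 D1.
have U1 : U (y + v) by have := Us 1; rewrite cr1 scale1r; apply; rewrite ler01 lexx.
apply: (C1_in C1 U1).2.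
move: mv; rewrite cr1 cr0 scale1r scale0r addr0 subr0 mulr1 => mv.
have ry := defining_le0 cO oO (C1_near C1 Uy) cly O0.
have cc : 0 <= c <= 1 by rewrite !ltW.
have hc := hM' _ _ (Us c cc) Uy; rewrite addrAC subrr add0r in hc.
have pc : enorm (cr c *: v) `^ alpha <= enorm v `^ alpha.
  apply: ge0_ler_powR; rewrite ?nnegrE ?enorm_ge0 ?(ltW alpha0) //.
  by apply: sv; exact: ltW.
have hc2 : enorm (g (y + cr c *: v) - g y) <= `|M'| * enorm v `^ alpha.
  apply: le_trans hc _; apply: le_trans (_ : `|M'| * enorm (cr c *: v) `^ alpha <= _).
    by rewrite ler_wpM2r ?powR_ge0 // ler_norm.
  by rewrite ler_wpM2l.
have h3 : rdot v (g (y + cr c *: v)) <= rdot v (g y) + enorm v * (`|M'| * enorm v `^ alpha).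
  set G := g (y + _); have -> : G = g y + (G - g y) by rewrite addrC subrK.
  rewrite rdotDr lerD2l; apply: le_trans (ler_norm _) _; apply: le_trans (rdot_le _ _) _.
  exact: ler_wpM2l.
have h4 : rdot v (g y) < - (`|M'| * (enorm v * enorm v `^ alpha)).
  move: hv; rewrite rdotZr mulrC ltr_pdivrMr // => hv; apply: lt_le_trans hv _.
  rewrite mulNr lerN2.
  have -> : `|M'| * (enorm v * enorm v `^ alpha) = A * (enorm v * enorm v `^ alpha) * m.
    by rewrite /A; field; rewrite gt_eqF.
  apply: ler_wpM2l my; apply: (mulr_ge0 A0); apply: (mulr_ge0 v0); exact: powR_ge0.
lra.
Qed.

Lemma closure_bound x : closure Om x -> enorm x <= M.
Proof.
move=> /closure_enormP clx; apply/ler_addgt0Pr => e e0.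
have [y /OM yM yx] := clx e e0; have := enormB x y; rewrite enormBC; lra.
Qed.

Lemma ch_support_log y n p z l : (forall v, Om v -> rdot (v - y) n < 0) -> ch Om p z l ->
  normc (hdot (z - y) n) <= expR (2 * l) * normc (hdot (p - y) n).
Proof.
move=> sup c.
pose k : Cx R := hdot y n.
have kE v : k + hdot v (- n) = - hdot (v - y) n by rewrite hdotNr hdotBl opprB.
have pos v : Om v -> 0 < Re (k + hdot v (- n)).
  by move=> /sup h; rewrite kE ReN Re_hdot oppr_gt0.
have nE v : normc (k + hdot v (- n)) = normc (hdot (v - y) n).
  by rewrite kE; exact: normcN.
by have := ch_hdot_log pos c; rewrite (nE z) (nE p).
Qed.

(** Moving the base point and turning the normal each cost at most eps / 4. *)
Lemma hdot_perturb x y z n m eps : enorm n = 1 -> enorm (y - x) <= eps / 8 ->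
  enorm (z - x) <= 2 * M -> enorm (n - m) <= eps / (16 * M) -> 
  eps <= normc (hdot (z - x) m) -> eps / 2 <= normc (hdot (z - y) n).
Proof.
move=> n1 yx zx nm hz; have M'0 := M0.
have e : hdot (z - x) m = hdot (z - y) n - (hdot (x - y) n + hdot (z - x) (n - m)).
  by rewrite (hdotBr n m) (hdotBl z x n) (hdotBl z y) (hdotBl x y); ring.
have b1 : normc (hdot (x - y) n) <= eps / 4.
  by apply: le_trans (normc_hdot _ _) _; rewrite n1 mulr1 enormBC; lra.
have b2 : normc (hdot (z - x) (n - m)) <= eps / 4.
  apply: le_trans (normc_hdot _ _) _.
  have -> : eps / 4 = 2 * (2 * M * (eps / (16 * M))) by field; rewrite gt_eqF.
  by rewrite ler_pM2l //; apply: ler_pM => //; exact: enorm_ge0.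
move: hz b1 b2; rewrite e.
move: (hdot (z - y) n) (hdot (x - y) n) (hdot (z - x) (n - m)) => X Y Z hz b1 b2.
have := le_trans hz (normcD _ _); rewrite normcN; have := normcD Y Z; lra.
Qed.

(** With D the distance from p to its foot point y, K(p, o) is at most - ln D / 2 plus a constant,
    while the functional supporting at y forces l >= (ln (eps / 2) - ln D) / 2. The terms in D
    cancel. *)
Lemma near_boundary_length x U rho g o eps : C1_defining Om x U rho g -> hoelder_on alpha U g ->
  closure Om x -> ~ Om x -> Om o -> 0 < eps ->
  exists r C : R, 0 < r /\ forall p z l, Om p -> Om z -> enorm (p - x) < r ->
    eps <= normc (hdot (z - x) (unit_normal (g x))) -> ch Om p z l -> Kd Om p o <= l + C.
Proof.
move=> C1 Hg clx nOx Oo eps0; have [oU Ux OU hg gc] := C1.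
have aux (a1 a2 a3 l c : R) : a1 <= 2^-1 * - a2 + c -> a3 <= 2 * l + a2 -> a1 <= l + (c - 2^-1 * a3).
  by lra.
have [r1 [A [r10 A0 inn]]] := inner_uniform C1 Hg (ex_intro _ o Oo).
have [t0 [C0 [t00 upper]]] := ch_normal_upper r10 A0 alpha0 alpha1 OM cO oO Oo.
have [gx0 /continuous_enormP cg] := gc x Ux.
have gp : 0 < enorm (g x) by rewrite enorm_gt0.
have M'0 := M0.
pose e1 := eps / (32 * M) * enorm (g x); have e10 : 0 < e1 by rewrite mulr_gt0 // divr_gt0 // mulr_gt0.
have [q q0 hq] := cg _ e10.
pose r := Num.min (Num.min (r1 / 2) t0) (Num.min (q / 2) (eps / 16)).
exists r, (C0 - 2^-1 * ln (eps / 2)); split; first by rewrite !lt_min t00 !divr_gt0.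
move=> p z l Op Oz; rewrite !lt_min => /andP[/andP[px1 pt0] /andP[pq pe]] hz c.
have [y [cly nOy yp] hball] := boundary_nearest oO clx nOx Op.
rewrite (enormBC x) in yp.
have yx : enorm (y - x) <= 2 * enorm (p - x) by have := enorm_tri y p x; lra.
have yx8 : enorm (y - x) <= eps / 8 by lra.
have zx : enorm (z - x) <= 2 * M.
  by apply: le_trans (enormD _ _) _; rewrite enormN; have := OM Oz; have := closure_bound clx; lra.
have yr1 : enorm (y - x) < r1 by lra.
have hy : enorm (g y - g x) < e1 by apply: hq; lra.
have Dt0 : enorm (y - p) <= t0 by lra.
have [Uy gy0 inner] := inn y cly yr1.
have nm : enorm (unit_normal (g y) - unit_normal (g x)) <= eps / (16 * M).
  apply: le_trans (unit_normal_dist gx0 gy0) _.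
  have -> : eps / (16 * M) = 2 * (e1 / enorm (g x)) by rewrite /e1; field; rewrite !gt_eqF.
  by rewrite ler_pM2l // ler_pM2r ?invr_gt0 // ltW.
set n := unit_normal (g y) in inner nm.
have n1 : enorm n = 1 by exact: enorm_unit_normal.
have C1y := C1_near C1 Uy.
have sup := support cO oO C1y cly nOy.
have D0 : 0 < enorm (y - p).
  by rewrite enorm_gt0 subr_eq0; apply/eqP => e; apply: nOy; rewrite e.
have pE := ball_normal nOy gy0 sup D0 hball; rewrite -/(unit_normal _) -/n in pE.
set D := enorm (y - p) in D0 pE Dt0.
have up : Kd Om p o <= 2^-1 * ln D^-1 + C0.
  by apply: Kd_le; rewrite pE; exact: (upper y n n1 inner D D0 Dt0).
have supn v : Om v -> rdot (v - y) n < 0.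
  by move=> /sup h; rewrite rdotZr pmulr_rlt0 // invr_gt0 enorm_gt0.
have low := ch_support_log supn c.
have pn : normc (hdot (p - y) n) = D.
  by rewrite pE addrAC subrr add0r hdotZl hdotvv n1 expr1n mulr1 normc_cr normrN gtr0_norm.
have zn : eps / 2 <= normc (hdot (z - y) n).
  exact: (hdot_perturb n1 yx8 zx nm hz).
have low2 : ln (eps / 2) <= 2 * l + ln D.
  rewrite -[2 * l]expRK -lnM ?posrE ?expR_gt0 // ler_ln ?posrE ?mulr_gt0 ?expR_gt0 ?divr_gt0 //.
  by apply: le_trans zn _; rewrite -pn.
move: up low2; rewrite lnV ?posrE //.
exact: aux.
Qed.

Hypothesis boundaryO : forall x, closure Om x -> ~ Om x ->
  exists U rho g, C1_defining Om x U rho g /\ hoelder_on alpha U g.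

(* A common zero on the closure would be a boundary point whose normal is proportional to
   both normals, so that the two tangent hyperplanes would coincide. *)
Lemma hyperplanes_separated x U rho g y U' rho' g' :
  C1_defining Om x U rho g -> C1_defining Om y U' rho' g' ->
  closure Om x -> ~ Om x -> closure Om y -> ~ Om y -> Om !=set0 ->
  hdot (y - x) (unit_normal (g x)) != 0 ->
  exists2 eps : R, 0 < eps & forall z, Om z -> eps <= normc (hdot (z - x) (unit_normal (g x))) \/
     eps <= normc (hdot (z - y) (unit_normal (g' y))).
Proof.
move=> C1 C1' clx nOx cly nOy O0 xy; apply: contrapT => /forall2NP hno.
set n := unit_normal (g x) in xy hno; set n' := unit_normal (g' y) in hno.
have [_ Ux _ _ /(_ x Ux)[gx0 _]] := C1; have [_ Uy _ _ /(_ y Uy)[gy0 _]] := C1'.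
have n1 : enorm n = 1 by exact: enorm_unit_normal.
have n1' : enorm n' = 1 by exact: enorm_unit_normal.
have /choice[u hu] (k : nat) : exists z, [/\ Om z, normc (hdot (z - x) n) < k.+1%:R^-1 &
    normc (hdot (z - y) n') < k.+1%:R^-1].
  have k0 : 0 < k.+1%:R^-1 :> R by rewrite invr_gt0 ltr0n.
  have [//|/existsNP[z /not_implyP[Oz /not_orP[/negP h1 /negP h2]]]] := hno k.+1%:R^-1.
  by exists z; split=> //; rewrite ltNge.
have uM k : enorm (u k) <= M by have [/OM] := hu k.
have [z clz] := bounded_seq_cluster uM.
have approx (w m : V) : enorm m = 1 -> (forall k, normc (hdot (u k - w) m) < k.+1%:R^-1) -> hdot (z - w) m = 0.
  move=> m1 hk; apply/eqP; rewrite -normc_eq0 eq_le normc_ge0 andbT.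
  apply/ler_addgt0Pr => e e0; rewrite add0r; have e4 : 0 < e / 4 by lra.
  have [k kN kz] := clz (e / 4) (Num.bound (e / 4)^-1) e4.
  have k1 : k.+1%:R^-1 <= e / 4.
    rewrite invf_ple ?posrE ?ltr0n //; apply: ltW.
    apply: lt_le_trans (archi_boundP _) _; first by rewrite invr_ge0 ltW.
    by rewrite ler_nat; apply: leq_trans kN _; exact: leqnSn.
  have -> : hdot (z - w) m = hdot (u k - w) m - hdot (u k - z) m.
    by rewrite (hdotBl z w) (hdotBl (u k) w) (hdotBl (u k) z); ring.
  have := normc_hdot (u k - z) m; rewrite m1 mulr1; move: (hk k).
  move: (hdot (u k - w) m) (hdot (u k - z) m) => X Y hX hY.
  have hX' := lt_le_trans hX k1.
  by have := normcD X (- Y); rewrite normcN; lra.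
have zx : hdot (z - x) n = 0 by apply: approx => // k; have [] := hu k.
have zy : hdot (z - y) n' = 0 by apply: approx => // k; have [] := hu k.
have clOz : closure Om z.
  apply/closure_enormP => e e0; have [k _ kz] := clz e 0%N e0.
  by exists (u k) => //; have [] := hu k.
have supx := support cO oO C1 clx nOx; have supy := support cO oO C1' cly nOy.
have rzx : rdot (z - x) (g x) = 0.
  have /eqP := congr1 (@complex.Re R) zx; rewrite Re_hdot rdotZr /= mulf_eq0 invr_eq0 enorm_eq0.
  by rewrite (negbTE gx0) => /eqP.
have rzy : rdot (z - y) (g' y) = 0.
  have /eqP := congr1 (@complex.Re R) zy; rewrite Re_hdot rdotZr /= mulf_eq0 invr_eq0 enorm_eq0.
  by rewrite (negbTE gy0) => /eqP.
have nOz : ~ Om z by move=> /supx; rewrite rzx ltxx.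
have [Uz [rz [gz [C1z _]]]] := boundaryO clOz nOz.
(* Since <z - x, g x> = 0, the functional of x also supports the domain at z, so its normal is the
   one at z. *)
have [c c0 ec] : exists2 c, 0 < c & g x = cr c *: gz z.
  apply: (normal_unique cO oO C1z clOz O0) => v /supx.
  have -> : v - x = (v - z) + (z - x) by rewrite addrA subrK.
  by rewrite rdotDl rzx addr0.
have [c' c'0 ec'] : exists2 c, 0 < c & g' y = cr c *: gz z.
  apply: (normal_unique cO oO C1z clOz O0) => v /supy.
  have -> : v - y = (v - z) + (z - y) by rewrite addrA subrK.
  by rewrite rdotDl rzy addr0.
have nn : n' = n by rewrite /n /n' ec ec' !unit_normalZ.
move/eqP: xy; apply; rewrite nn in zy.
have -> : y - x = (z - x) - (z - y) by rewrite opprB [RHS]addrC addrA subrK.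
by rewrite hdotBl zx zy subrr.
Qed.

(** Any chain from p to q passes a point z away from both hyperplanes, and [near_boundary_length]
    applies to each of its two halves. *)
Lemma gromov_product_bounded x U rho g y o : C1_defining Om x U rho g -> hoelder_on alpha U g ->
  closure Om x -> ~ Om x -> closure Om y -> ~ Om y -> Om o ->
  hdot (y - x) (unit_normal (g x)) != 0 ->
  exists r C : R, 0 < r /\ forall p q, Om p -> Om q -> enorm (p - x) < r -> enorm (q - y) < r ->
    Kd Om p o + Kd Om q o <= Kd Om p q + C.
Proof.
move=> C1 Hg clx nOx cly nOy Oo xy.
have [U' [rho' [g' [C1' Hg']]]] := boundaryO cly nOy.
have [eps eps0 sep] := hyperplanes_separated C1 C1' clx nOx cly nOy (ex_intro _ o Oo) xy.
have eps2 : 0 < eps / 2 by lra.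
have ee : eps / 2 <= eps by lra.
have ne : ~ eps <= eps / 2 by apply/negP; rewrite -ltNge; lra.
have [r1 [C1c [r10 h1]]] := near_boundary_length C1 Hg clx nOx Oo eps2.
have [r2 [C2c [r20 h2]]] := near_boundary_length C1' Hg' cly nOy Oo eps2.
have n1 : enorm (unit_normal (g x)) = 1.
  by have [_ Ux _ _ /(_ x Ux)[gx0 _]] := C1; exact: enorm_unit_normal.
have n1' : enorm (unit_normal (g' y)) = 1.
  by have [_ Uy _ _ /(_ y Uy)[gy0 _]] := C1'; exact: enorm_unit_normal.
move: sep h1 h2 n1 n1'; set m := unit_normal (g x); set m' := unit_normal (g' y).
clearbody m m' => sep h1 h2 n1 n1'.
exists (Num.min (Num.min r1 r2) (eps / 4)), (C1c + C2c).
split; first by rewrite !lt_min r10 r20 divr_gt0.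
move=> p q Op Oq; rewrite !lt_min => /andP[/andP[pr1 _] pe] /andP[/andP[_ qr2] qe].
rewrite -lerBlDr; apply: (Kd_ge cO oO) => // l c.
pose h v := normc (hdot (v - x) m).
have hlip v w : Om v -> Om w -> `|h w - h v| <= 2 * enorm (w - v).
  move=> _ _; have e : hdot (w - x) m - hdot (v - x) m = hdot (w - v) m.
    by rewrite -hdotBl; congr hdot; rewrite opprB addrA subrK.
  apply: le_trans (normcB_abs _ _) _; rewrite e.
  by apply: le_trans (normc_hdot _ _) _; rewrite n1 mulr1.
have bound v w n : enorm n = 1 -> enorm (v - w) < eps / 4 -> normc (hdot (v - w) n) < eps / 2.
  move=> nn1 vw; apply: le_lt_trans (normc_hdot _ _) _; rewrite nn1 mulr1.
  have -> : eps / 2 = 2 * (eps / 4) by field.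
  by rewrite ltr_pM2l.
have hp : h p <= eps / 2 by apply: ltW; exact: bound.
have hq : eps / 2 <= h q.
  have [hx|hy] := sep q Oq; first exact: le_trans ee hx.
  by have := le_lt_trans hy (lt_le_trans (bound q y m' n1' qe) ee); rewrite ltxx.
(* At the level eps / 2 the functional of x is bounded below but less than eps, so [sep] forces the
   functional of y to be at least eps. *)
have [z [l1 [l2 [Oz hz c1 c2 <-]]]] := ch_cut M0 OM (ler0n R 2) hlip hp hq c.
have ze : eps / 2 <= normc (hdot (z - x) m) by rewrite -/(h z) hz.
have ze' : eps / 2 <= normc (hdot (z - y) m').
  have [zx|zy] := sep z Oz; last exact: le_trans ee zy.
  by case: ne; rewrite -hz.
have k1 := h1 _ _ _ Op Oz pr1 ze c1.
have k2 := h2 _ _ _ Oq Oz qr2 ze' (ch_sym c2).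
by rewrite lerBlDr; have := lerD k1 k2; rewrite addrACA.
Qed.

End GromovProduct.

(** * Escaping orbits accumulate on one complex tangent hyperplane *)

Section EscapingOrbits.
Variables (R : realType) (d : nat) (Om : set 'rV[Cx R]_d) (M alpha : R).
Local Notation V := 'rV[Cx R]_d.
Hypothesis M0 : 0 < M.
Hypothesis OM : forall v, Om v -> enorm v <= M.
Hypothesis cO : convexS Om.
Hypothesis oO : forall x, Om x -> exists2 r : R, 0 < r & forall y, enorm (y - x) < r -> Om y.
Hypothesis alpha0 : 0 < alpha.
Hypothesis alpha1 : alpha <= 1.
Hypothesis boundaryO : forall x, closure Om x -> ~ Om x ->
  exists U rho g, C1_defining Om x U rho g /\ hoelder_on alpha U g.
Variable f : V -> V.
Hypothesis fO : forall p, Om p -> Om (f p).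
Hypothesis fK : forall p q, Om p -> Om q -> Kd Om (f p) (f q) <= Kd Om p q.
Hypothesis escape : forall p B, Om p -> exists N, forall n, (N <= n)%N -> B < Kd Om p (iter n f p).

Lemma escape_boundary (u : nat -> V) x o : Om o -> (forall n, Om (u n)) ->
  (forall B, exists N, forall n, (N <= n)%N -> B < Kd Om o (u n)) ->
  (forall e (N : nat), 0 < e -> exists2 n, (N <= n)%N & enorm (u n - x) < e) ->
  closure Om x /\ ~ Om x.
Proof.
move=> Oo uO esc clx; split.
  by apply/closure_enormP => e e0; have [n _ h] := clx e 0%N e0; exists (u n).
move=> Ox; have [r r0 hr] := Kd_near oO Ox ltr01.
have [N hN] := esc (Kd Om o x + 1); have [n Nn /hr[Ou xu]] := clx r N r0.
have := hN n Nn; have := Kd_tri cO oO Oo Ox Ou; lra.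
Qed.

(* Karlsson: at a record time n of the distance from o, every earlier iterate has
   distance at most [Kd o (iter n f o)] to [iter n f o]. *)
Lemma record_times o : Om o -> forall N, exists n, (N <= n)%N /\
  forall k, (k <= n)%N -> Kd Om o (iter k f o) <= Kd Om o (iter n f o).
Proof.
move=> Oo N; pose a k := Kd Om o (iter k f o).
have [B hB] : exists B, forall k, (k <= N)%N -> a k <= B.
  elim: N => [|N [B hB]]; first by exists (a 0%N) => k; rewrite leqn0 => /eqP ->.
  exists (Num.max B (a N.+1)) => k; rewrite leq_eqVlt => /orP[/eqP ->|].
    by rewrite le_max lexx orbT.
  by rewrite ltnS le_max => /hB ->.
have [m0 hm0] := escape B Oo.
have ex : exists n, B < a n by exists m0; exact: hm0.
(* The first time at which the distance exceeds B, the bound over all times up to N, is a record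
   time beyond N. *)
case: (ex_minnP ex) => n nB nmin; exists n; split.
  by rewrite leqNgt; apply/negP => /ltnW /hB; rewrite leNgt nB.
move=> k; rewrite leq_eqVlt => /orP[/eqP -> //|kn].
apply: le_trans (ltW nB); rewrite leNgt; apply/negP => /nmin.
by rewrite leqNgt kn.
Qed.

(** The point x is fixed by the orbit of o alone. For each p, a cluster point y of its orbit off the
    hyperplane would contradict the bound on Gromov products at x and y. *)
Theorem escaping_orbits o : Om o -> exists x U rho g,
  [/\ closure Om x, ~ Om x, C1_defining Om x U rho g & forall p, Om p ->
   (fun k => normc (hdot (iter k f p - x) (unit_normal (g x)))) @ \oo --> (0 : R)].
Proof.
move=> Oo; have [n hn] := choice (record_times Oo).
have uO j : Om (iter (n j) f o) by exact: (iter_in fO _ Oo).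
have [x clu] := bounded_seq_cluster (fun j => OM (uO j)).
have escu B : exists N, forall j, (N <= j)%N -> B < Kd Om o (iter (n j) f o).
  have [N hN] := escape B Oo; exists N => j Nj; apply: hN.
  by apply: leq_trans Nj _; have [] := hn j.
have [clx nOx] := escape_boundary Oo uO escu clu.
have [U [rho [g [C1 Hg]]]] := boundaryO clx nOx.
exists x, U, rho, g; split=> // p Op.
set m := unit_normal (g x).
have m1 : enorm m = 1.
  by have [_ Ux _ _ /(_ x Ux)[gx0 _]] := C1; exact: enorm_unit_normal.
have pO k : Om (iter k f p) by exact: (iter_in fO _ Op).
have escp B : exists N, forall k, (N <= k)%N -> B < Kd Om o (iter k f p).
  have [N hN] := escape (B + Kd Om p o) Op; exists N => k /hN.
  by have := Kd_tri cO oO Op Oo (pO k); lra.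
apply/cvgrPdist_lt => e e0; apply: contrapT => nconv.
have freq (N : nat) : exists k, (N <= k)%N /\ e <= normc (hdot (iter k f p - x) m).
  apply: contrapT => /forallNP h; apply: nconv; exists N => // k /= Nk.
  have := h k; rewrite sub0r normrN ger0_norm ?normc_ge0 // => hk.
  by rewrite ltNge; apply/negP => he; apply: hk.
have [k hk] := choice freq.
have vO j : Om (iter (k j) f p) by exact: pO.
have [y cly] := bounded_seq_cluster (fun j => OM (vO j)).
have escv B : exists N, forall j, (N <= j)%N -> B < Kd Om o (iter (k j) f p).
  have [N hN] := escp B; exists N => j Nj; apply: hN.
  by apply: leq_trans Nj _; have [] := hk j.
have [clOy nOy] := escape_boundary Oo vO escv cly.
have xy : hdot (y - x) m != 0.
  apply/eqP => h0; have e4 : 0 < e / 4 by lra.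
  have [j _ jy] := cly (e / 4) 0%N e4; have [_ ej] := hk j; move: ej.
  have -> : hdot (iter (k j) f p - x) m = hdot (iter (k j) f p - y) m.
    by rewrite -[RHS]addr0 -h0 -hdotDl; congr hdot; rewrite addrA subrK.
  rewrite leNgt => /negP; apply; apply: le_lt_trans (normc_hdot _ _) _.
  rewrite m1 mulr1; lra.
have [r [C [r0 hC]]] := gromov_product_bounded M0 OM cO oO alpha0 alpha1 boundaryO C1 Hg clx nOx clOy nOy Oo xy.
(* With n a record time and k <= n, K(f^n o, f^k p) <= K(o, f^(n-k) o) + K(o, p) <= K(f^n o, o) +
   K(p, o). The Gromov bound then leaves K(f^k p, o) <= C + K(p, o), which fails for this choice of
   k. *)
have [N hN] := escv (C + Kd Om p o).
have [j Nj jy] := cly r N r0.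
have [i ki ix] := clu r (k j) r0.
have kn : (k j <= n i)%N by apply: leq_trans ki _; have [] := hn i.
have G := hC _ _ (uO i) (vO j) ix jy.
have rec : Kd Om o (iter (n i - k j) f o) <= Kd Om o (iter (n i) f o).
  by have [_] := hn i; apply; exact: leq_subr.
have t1 : Kd Om (iter (n i) f o) (iter (k j) f o) <= Kd Om o (iter (n i - k j) f o).
  have {1}-> : n i = (k j + (n i - k j))%N by rewrite subnKC.
  rewrite iterD (Kd_sym _ o); apply: iter_contr => //; exact: iter_in.
have t2 := Kd_tri cO oO (uO i) (iter_in fO (k j) Oo) (vO j).
have t3 := iter_contr fO fK (k j) Oo Op; rewrite (Kd_sym _ o p) in t3.
have := hN j Nj; rewrite (Kd_sym _ o).
rewrite (Kd_sym _ o) in rec; rewrite (Kd_sym _ o (iter (n i) f o)) in rec.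
rewrite (Kd_sym _ o) in t1.
move: G rec t1 t2 t3.
move: (Kd _ (iter (n i) f o) o) (Kd _ (iter (k j) f p) o) => a1 a2.
move: (Kd _ (iter (n i) f o) (iter (k j) f p)) (Kd _ (iter (n i - k j) f o) o) => a3 a4.
move: (Kd _ (iter (n i) f o) (iter (k j) f o)) (Kd _ (iter (k j) f o) (iter (k j) f p)) (Kd _ p o) => a5 a6 a7.
lra.
Qed.

End EscapingOrbits.

Theorem theorem2p12 (R : realType) (d : nat) (Omega : set 'rV[Cx R]_d)
    (alpha : R) (f : 'rV[Cx R]_d -> 'rV[Cx R]_d)
    (Omega_domain : is_domain Omega)
    (Omega_bounded : bounded_set Omega)
    (Omega_convex : convex_set Omega)
    (alpha_gt0 : 0 < alpha) (alpha_le1 : alpha <= 1)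
    (Omega_C1alpha : C1alpha_boundary alpha Omega)
    (f_Omega : forall p, Omega p -> Omega (f p))
    (f_lipschitz : forall p q, Omega p -> Omega q ->
       (kobayashi Omega (f p) (f q) <= kobayashi Omega p q)%E) :
  (exists p, Omega p /\ f p = p) \/
  (exists x, boundary Omega x /\
     forall p, Omega p ->
       (fun k : nat => dEuc (iter k f p) (complex_tangent Omega x))
         @ \oo --> (0 : R)).
Proof.
have [[z0 Oz0] opO _] := Omega_domain.
have [M M0 OM] := bounded_enormP Omega_bounded.
have oO := (open_enormP _).1 opO.
have cO : convexS Omega.
  move=> t x y t0 t1 Ox Oy.
  have c0 : 0 <= cr (1 - t) by rewrite -[0]cr0 lecr subr_ge0.
  have c1 : cr (1 - t) <= 1 by rewrite -cr1 lecr gerBl.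
  (* [convex_set] takes its weights from the interval [0, 1] of the complex field, whose elements
     are real. *)
  have := Omega_convex x y (Itv01 c0 c1); rewrite !inE => /(_ Ox Oy).
  rewrite /conv /=; congr (Omega (_ + _ *: _)).
  by rewrite /unstable.onem crD crN cr1 opprB addrC subrK.
have bdry x : closure Omega x -> ~ Omega x -> boundary Omega x.
  by move=> clx nOx; split=> // /interior_subset.
have bO x (clx : closure Omega x) (nOx : ~ Omega x) := Omega_C1alpha x (bdry x clx nOx).
have sup x : closure Omega x -> ~ Omega x -> exists w, forall v, Omega v -> rdot (v - x) w < 0.
  move=> clx nOx; have [U [rho [g [C1 _]]]] := bO x clx nOx.
  by exists (g x); exact: (support cO oO C1 clx nOx).
have fK p q : Omega p -> Omega q -> Kd Omega (f p) (f q) <= Kd Omega p q.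
  move=> Op Oq; have := f_lipschitz p q Op Oq.
  by rewrite !kobayashiE ?lee_fin //; exact: f_Omega.
have [[q [Oq fq]]|esc] := fixed_or_escape M0 OM cO oO sup f_Omega fK.
  by left; exists q.
right; have [x [U [rho [g [clx nOx C1 conv]]]]] :=
  escaping_orbits M0 OM cO oO alpha_gt0 alpha_le1 bO f_Omega fK esc Oz0.
exists x; split; first exact: bdry.
move=> p Op; set m := unit_normal (g x) in conv.
have gx0 : g x != 0 by have [_ Ux _ _ /(_ x Ux)[]] := C1.
have m1 : enorm m = 1 by exact: enorm_unit_normal.
have dE z : 0 <= dEuc z (complex_tangent Omega x) /\ dEuc z (complex_tangent Omega x) <= normc (hdot (z - x) m).
  (* The orthogonal projection of z to the complex tangent hyperplane at x, at distance |<z - x, m>|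
     from z. *)
  pose y := z - hdot (z - x) m *: m.
  have Ty : complex_tangent Omega x y.
    have hy : hdot (y - x) (g x) = 0.
      have gE : g x = cr (enorm (g x)) *: m by rewrite scalerA -crM divff ?enorm_eq0 // cr1 scale1r.
      rewrite gE hdotZr; have -> : y - x = (z - x) - hdot (z - x) m *: m by rewrite /y addrAC.
      by rewrite hdotBl hdotZl hdotvv m1 expr1n cr1 mulr1 subrr mulr0.
    exists U, rho, g; split=> //; first exact: (congr1 (@complex.Re R) hy).
    by have /eqP := congr1 (@complex.Im R) hy; rewrite /= oppr_eq0 => /eqP.
  have lb : lbound [set enorm (z - y) | y in complex_tangent Omega x] 0.
    by move=> _ [w _ <-]; exact: enorm_ge0.
  split; first by apply: lb_le_inf => //; exists (enorm (z - y)), y.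
  have -> : normc (hdot (z - x) m) = enorm (z - y).
    have -> : z - y = hdot (z - x) m *: m by rewrite /y opprB [LHS]addrC subrK.
    by rewrite enormZ m1 mulr1.
  by apply: ge_inf; [exists 0 | exists y].
apply: (@squeeze_cvgr _ _ _ _ (fun _ => 0) (fun k => normc (hdot (iter k f p - x) m))).
- by near=> k; have [-> ->] := dE (iter k f p).
- exact: cvg_cst.
- exact: conv.
Unshelve. all: by end_near. Qed.
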